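(* There are $\alpha>0$ and $C>0$ such that, for all even integers $R\ge 2$, $$E_{\frac{R^2}{2},R^2}(N_R^0)\ \ge\ C R^{\alpha},$$ where $N_R^0$ is the number of vertices of the $R\times R$ box $V_R$ of the triangular lattice that are $0$-pivotal for the horizontal crossing event $A_R$, and $E_{\frac{R^2}{2},R^2}$ denotes expectation with respect to $P_{\frac{R^2}{2},R^2}$, the uniform distribution on configurations in $\{0,1\}^{V_R}$ with exactly $R^2/2$ occupied vertices.
   Context: The $R\times R$ box in the triangular lattice is the graph with vertex set $V_R=\{x+y\exp(i\pi/3): x,y\in\mathbb{Z},\ 0\le x,y\le R-1\}\subset\mathbb{C}$, in which two vertices $v,w$ share an edge iff $|v-w|=1$. A configuration is an element $\omega\in\{0,1\}^{V_R}$; a vertex $v$ is occupied if $\omega_v=1$ and vacant if $\omega_v=0$. $A_R$ is the event that there is an occupied path which crosses the box horizontally, i.e. a path in this graph, all of whose vertices are occupied, from the left side $\{x=0\}$ to the right side $\{x=R-1\}$ of the box. For $0\le k\le R^2$, $P_{k,R^2}=P_{k,V_R}$ is the distribution on $\{0,1\}^{V_R}$ giving probability $1/\binom{R^2}{k}$ to each $\omega$ with $\sum_v\omega_v=k$, and $0$ to all other $\omega$. A vertex $v$ is $0$-pivotal for an event $A$ in the configuration $\omega$ if $\omega_v=0$ and exactly one of $\omega$ and $\omega^{(v)}$ is in $A$, where $\omega^{(v)}$ is obtained from $\omega$ by replacing $\omega_v$ by $1-\omega_v$. *)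

(* Defs.v *)
From mathcomp Require Export all_boot all_order all_algebra.
From mathcomp Require Export complex.
From mathcomp Require Export boolp reals trigo exp.

Set Implicit Arguments.
Unset Strict Implicit.
Unset Printing Implicit Defensive.

Import Order.TTheory GRing.Theory Num.Theory.
Local Open Scope ring_scope.
Local Open Scope complex_scope.

(* The vertex x + y exp(i pi/3) of the n x n box is represented by its lattice
   coordinates (x, y). *)
Definition box (n : nat) : finType := ('I_n * 'I_n)%type.

Definition expi (K : realType) (t : K) : K[i] := cos t +i* sin t.

Definition box_pos (K : realType) (n : nat) (v : box n) : K[i] :=
  v.1%:R + v.2%:R * expi (pi / 3).

Definition box_adj (K : realType) (n : nat) : rel (box n) :=
  fun v w => `|box_pos K v - box_pos K w| == 1.

Definition config (V : finType) := {ffun V -> bool}.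

(* The crossing is represented by the vertex sequence v :: p.  The sides are
   given by the lattice coordinate x, not by the real part of the position. *)
Definition crossing (K : realType) (n : nat) : {set config (box n)} :=
  [set w : config (box n) |
    `[< exists (v : box n) (p : seq (box n)),
          [/\ path (@box_adj K n) v p,
              all (fun u => w u) (v :: p),
              v.1 = 0%N :> nat
            & (last v p).1 = n.-1 :> nat] >] ].

Definition flip (V : finType) (w : config V) (v : V) : config V :=
  [ffun u => if u == v then ~~ w u else w u].

Definition pivotal0 (V : finType) (A : {set config V}) (w : config V) (v : V)
    : bool :=
  ~~ w v && ((w \in A) (+) (flip w v \in A)).

Definition num_pivotal0 (V : finType) (A : {set config V}) (w : config V)
    : nat :=
  #|[set v | pivotal0 A w v]|.

Definition prob_fixed (K : realType) (V : finType) (k : nat) (w : config V)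
    : K :=
  if (\sum_v w v == k)%N then 'C(#|V|, k)%:R^-1 else 0.

Definition expect_fixed (K : realType) (V : finType) (k : nat)
    (X : config V -> K) : K :=
  \sum_w prob_fixed K k w * X w.

(* Main.v *)
(* Write the uniform configuration with R^2/2 occupied vertices as a uniformly random pairing of the
   vertices in which the two members of each pair receive opposite states, decided by independent fair
   bits.  Given the pairing, the O'Donnell-Saks-Schramm-Servedio inequality bounds the variance of the
   crossing event by a sum of revealments times influences; an influence is at most twice the expected
   number of 0-pivotals in the pair.  The variance averaged over pairings is at least half the variance
   on the slice, because any two configurations of the slice admit a common pairing, and the latter
   variance is 1/4 by Hex duality.  So the expected number of 0-pivotals is at least a constant over the
   maximal revealment.

   The algorithm explores the occupied clusters of a column, and the revealments are averaged over the
   column.  A vertex far from the column is revealed only if an occupied arm leaves its neighbourhood at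
   a power scale of R, where for all but few pairings at most one pair lies inside; the one-arm
   probability decays polynomially because each annulus is blocked with probability bounded below.

   The blocking estimate is a Russo-Seymour-Welsh bound.  Exploring the clusters of one side of a
   rhombus and reflecting the unexplored colours shows that a chevron, the union of a rhombus and its
   mirror image, has no occupied crossing from bottom to top with probability at least 1/16.  Chevrons
   sharing rhombi form staircases, and four staircases separate the inside of an annulus from its
   outside.  All planarity comes from the game of Y on a triangle, by Schensted's reduction.

   Lattice vertices are points of Z^2 with adjacency +-(1,0), +-(0,1), +-(1,1); the vertex (x, y) of the
   box becomes (x, -y). *)

From Stdlib Require Import ZArith Lia.
Require Import Defs.
From mathcomp Require Import fingroup perm.
From mathcomp Require Import zify ring lra.
Import Order.TTheory GRing.Theory Num.Theory.
Local Open Scope ring_scope.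
Delimit Scope Z_scope with Z.

Set Implicit Arguments.
Unset Strict Implicit.
Unset Printing Implicit Defensive.

(** * Connectivity and Lipschitz crossings *)

Section Conn.
Variables (T : Type) (adj : T -> T -> Prop).

Inductive conn (S : T -> Prop) : T -> T -> Prop :=
| conn0 u : S u -> conn S u u
| connS u v w : S u -> adj u v -> conn S v w -> conn S u w.

Lemma conn_start S u v : conn S u v -> S u.
Proof. by case. Qed.

Lemma conn_next S u v : conn S u v -> u = v \/ exists w, S w /\ adj u w.
Proof. by case=> [w|w x y _ wx /conn_start Sx]; [left|right; exists x]. Qed.

Lemma conn_end S u v : conn S u v -> S v.
Proof. by elim. Qed.

Lemma conn_trans S u v w : conn S u v -> conn S v w -> conn S u w.
Proof. by move=> h; elim: h w => // a b c Sa ab _ IH w /IH; apply: connS. Qed.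

Lemma conn1 (S : T -> Prop) u v : S u -> S v -> adj u v -> conn S u v.
Proof. by move=> Su Sv uv; apply: (connS _ uv) => //; apply: conn0. Qed.

Lemma conn_mono (S S' : T -> Prop) u v :
  (forall z, S z -> S' z) -> conn S u v -> conn S' u v.
Proof.
move=> sub; elim=> [a /sub|a b c /sub Sa ab _]; first exact: conn0.
exact: connS.
Qed.

Lemma conn_sym (S : T -> Prop) u v :
  (forall a b, adj a b -> adj b a) -> conn S u v -> conn S v u.
Proof.
move=> adj_sym; elim=> [a|a b c Sa ab bc IH]; first exact: conn0.
by apply: conn_trans IH _; apply: conn1 => //; [apply: conn_start bc|apply: adj_sym].
Qed.

(** Applied with [P] the membership in a cluster, it places a path inside the cluster that it
    spans. *)
Lemma conn_inv (S P : T -> Prop) u v :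
  (forall a b, S a -> S b -> adj a b -> P a -> P b) ->
  conn S u v -> P u -> conn (fun z => S z /\ P z) u v.
Proof.
move=> step; elim=> [a Sa Pa|a b c Sa ab bc IH Pa]; first exact: conn0.
by apply: (connS _ ab) => //; apply: IH; apply: (step _ _ _ _ ab Pa) => //; apply: conn_start bc.
Qed.

End Conn.
Arguments conn {T}.

Lemma conn_map (T T' : Type) (adj : T -> T -> Prop) (adj' : T' -> T' -> Prop)
    (h : T -> T') (S : T -> Prop) (S' : T' -> Prop) u v :
  (forall a, S a -> S' (h a)) ->
  (forall a b, S a -> S b -> adj a b -> adj' (h a) (h b)) ->
  conn adj S u v -> conn adj' S' (h u) (h v).
Proof.
move=> hS hadj; elim=> [a /hS|a b c Sa ab bc]; first exact: conn0.
apply: connS; first exact: hS.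
by apply: hadj => //; apply: conn_start bc.
Qed.

Section Lipschitz.
Variables (T : Type) (adj : T -> T -> Prop) (S : T -> Prop) (f : T -> Z).
Hypothesis lip :
  forall u v, S u -> S v -> adj u v -> (Z.abs (f u - f v) <= 1)%Z.

(** A discrete intermediate value theorem: [f] changes by at most 1 per step, so a path from below
    [a] to above [b] contains a stretch that stays between the two levels and joins them. *)
Lemma conn_crossing (a b : Z) u v : (a <= b)%Z ->
  conn adj S u v -> (f u <= a)%Z -> (b <= f v)%Z ->
  exists u' v', [/\ conn adj (fun z => S z /\ (a <= f z <= b)%Z) u' v',
                    conn adj S u u', f u' = a & f v' = b].
Proof.
move=> ab uv; pose X w := conn adj (fun z => S z /\ (a <= f z <= b)%Z) w.
(* The induction treats both positions of the start: from inside the strip, either a complete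
   stretch comes later or level [b] is reached before the strip is left. *)
have main : (b <= f v)%Z ->
  ((f u <= a)%Z -> exists u' v', [/\ X u' v', conn adj S u u', f u' = a & f v' = b]) /\
  ((a <= f u <= b)%Z -> (exists u' v', [/\ X u' v', conn adj S u u', f u' = a & f v' = b]) \/
    exists v', X u v' /\ f v' = b).
  elim: uv => [w Sw bw|w x y Sw wx xy IH by_].
    split=> h.
      have e : f w = a by lia.
      by exists w, w; split; [apply: conn0; split=> //; lia|apply: conn0| |lia].
    by right; exists w; split; [apply: conn0; split=> //|]; lia.
  have lw := lip Sw (conn_start xy) wx.
  have [IH1 IH2] := IH by_.
  have ext u' v' : [/\ X u' v', conn adj S x u', f u' = a & f v' = b] ->
      exists u' v', [/\ X u' v', conn adj S w u', f u' = a & f v' = b].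
    by case=> *; exists u', v'; split=> //; apply: (connS _ wx).
  have second : (a <= f w <= b)%Z -> (exists u' v', [/\ X u' v', conn adj S w u', f u' = a & f v' = b]) \/
    exists v', X w v' /\ f v' = b.
    move=> h; case: (Z.eq_dec (f w) b) => [e|ne].
      by right; exists w; split=> //; apply: conn0; split=> //; lia.
    case: (Z_le_gt_dec a (f x)) => hx.
      have /IH2 : (a <= f x <= b)%Z by lia.
      case=> [[u' [v' /ext]]|[v' [xv' e]]]; first by left.
      by right; exists v'; split=> //; apply: (connS _ wx); [split=> //; lia|].
    have /IH1 [u' [v' /ext]] : (f x <= a)%Z by lia.
    by left.
  split=> // h; case: (Z.eq_dec (f w) a) => [e|ne].
    have /second [//|[v' [wv' e']]] : (a <= f w <= b)%Z by lia.
    by exists w, v'; split=> //; apply: conn0.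
  have /IH1 [u' [v' /ext //]] : (f x <= a)%Z by lia.
by move=> fu fv; case: (main fv) => h _; apply: h.
Qed.

Lemma conn_below (b : Z) u v : conn adj S u v -> (f u <= b)%Z ->
  conn adj (fun z => S z /\ (f z <= b)%Z) u v \/
  exists w, conn adj S u w /\ f w = (b + 1)%Z.
Proof.
elim=> [w Sw h|w x y Sw wx xy IH h]; first by left; apply: conn0.
have lw := lip Sw (conn_start xy) wx.
case: (Z_le_gt_dec (f x) b) => hx.
  case: (IH hx) => [c|[z [c e]]]; first by left; apply: (connS _ wx).
  by right; exists z; split=> //; apply: (connS _ wx).
right; exists x; split; last lia.
by apply: conn1 => //; apply: conn_start xy.
Qed.

End Lipschitz.

(** * The game of Y *)

Definition pt : Type := (Z * Z)%type.

(** The bound on the difference of the coordinates excludes the steps +-(1,-1) and leaves the six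
    neighbours of the triangular lattice. *)
Definition pt_adj (u v : pt) : Prop :=
  (-1 <= u.1 - v.1 <= 1 /\ -1 <= u.2 - v.2 <= 1 /\
   -1 <= (u.1 - u.2) - (v.1 - v.2) <= 1 /\ (u.1 <> v.1 \/ u.2 <> v.2))%Z.

Lemma pt_adj_sym u v : pt_adj u v -> pt_adj v u.
Proof. rewrite /pt_adj; lia. Qed.

Notation pconn := (conn pt_adj).

Lemma pconn_sym S u v : pconn S u v -> pconn S v u.
Proof. by apply: conn_sym; apply: pt_adj_sym. Qed.

Definition tri (N : Z) (z : pt) : Prop := (0 <= z.2 /\ z.2 <= z.1 /\ z.1 <= N)%Z.

(** A winning Y: one cluster meets all three sides of the triangle, a corner belonging to both of
    its sides. *)
Definition ywin (N : Z) (S : pt -> Prop) : Prop :=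
  exists a b c, let X := fun z => tri N z /\ S z in
    [/\ pconn X a b, pconn X a c, a.2 = 0%Z, b.1 = N & c.1 = c.2].

(** Schensted's reduction: a vertex of the triangle of size N takes the majority colour of a
    three-vertex cell of the triangle of size N + 1. *)
Definition ymaj (S : pt -> Prop) (q : pt) : Prop :=
  let a := S q in
  let b := S (q.1 + 1, q.2)%Z in
  let c := S (q.1 + 1, q.2 + 1)%Z in
  (a /\ b) \/ (a /\ c) \/ (b /\ c).

Definition incell (q z : pt) : Prop :=
  z = q \/ z = (q.1 + 1, q.2)%Z \/ z = (q.1 + 1, q.2 + 1)%Z.

Lemma incell_adj (S : pt -> Prop) q q' z : incell q z -> incell q' z ->
  S q -> S q' -> pconn S q q'.
Proof.
move=> hq hq' Sq Sq'; have [->|ne] := pselect (q = q'); first exact: conn0.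
apply: conn1 => //; move: q q' z hq hq' ne {Sq Sq'} => [q1 q2] [r1 r2] [z1 z2].
rewrite /incell /pt_adj /= => hq hq' ne.
have {}ne : (q1 <> r1 \/ q2 <> r2).
  by case: (Z.eq_dec q1 r1); case: (Z.eq_dec q2 r2) => e1 e2; [case: ne; congr pair|right|left|left].
case: hq => [|[]] [h1 h2]; case: hq' => [|[]] [h3 h4]; lia.
Qed.

(** Every edge of the larger triangle is a side of some cell, and two vertices in [S] make a
    majority there. *)
Lemma edge_cell N (S : pt -> Prop) u v :
  tri (N + 1) u /\ S u -> tri (N + 1) v /\ S v -> pt_adj u v ->
  exists q, [/\ tri N q /\ ymaj S q, incell q u & incell q v].
Proof.
move: u v => [x y] [x' y'] [Tu Su] [Tv Sv] uv.
have cases : ((x' = x + 1 /\ y' = y) \/ (x' = x - 1 /\ y' = y) \/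
              (x' = x /\ y' = y + 1) \/ (x' = x /\ y' = y - 1) \/
              (x' = x + 1 /\ y' = y + 1) \/ (x' = x - 1 /\ y' = y - 1))%Z.
  move: uv; rewrite /pt_adj /=; lia.
rewrite /incell; move: Tu Tv uv; rewrite /tri /pt_adj /= => Tu Tv uv.
have close q1 q2 : (0 <= q2 /\ q2 <= q1 /\ q1 <= N)%Z ->
    (x, y) = (q1, q2) \/ (x, y) = (q1 + 1, q2)%Z \/ (x, y) = (q1 + 1, q2 + 1)%Z ->
    (x', y') = (q1, q2) \/ (x', y') = (q1 + 1, q2)%Z \/ (x', y') = (q1 + 1, q2 + 1)%Z ->
  exists q : pt,
  [/\ (0 <= q.2 /\ q.2 <= q.1 /\ q.1 <= N)%Z /\ ymaj S q,
    (x, y) = q \/ (x, y) = ((q.1 + 1)%Z, q.2) \/ (x, y) = ((q.1 + 1)%Z, (q.2 + 1)%Z)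
  & (x', y') = q \/ (x', y') = ((q.1 + 1)%Z, q.2) \/ (x', y') = ((q.1 + 1)%Z, (q.2 + 1)%Z)].
  move=> h hu hv; exists (q1, q2); split=> //; split=> //.
  rewrite /ymaj /=.
  case: hu => [|[]] hu; case: hv => [|[]] hv; rewrite ?hu ?hv in Su Sv; try tauto;
    by exfalso; move: hu hv uv => [-> ->] [-> ->]; lia.
case: cases => [|[|[|[|[|]]]]] [e1 e2]; subst x' y'.
- by apply: (close x y); [lia|left|right; left].
- apply: (close (x - 1)%Z y); [lia|right; left|left] => //; congr pair; lia.
- apply: (close (x - 1)%Z y); [lia|right; left|right; right] => //; congr pair; lia.
- apply: (close (x - 1)%Z (y - 1)%Z); [lia|right; right|right; left] => //; congr pair; lia.
- by apply: (close x y); [lia|left|right; right].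
- apply: (close (x - 1)%Z (y - 1)%Z); [lia|right; right|left] => //; congr pair; lia.
Qed.

(** Consecutive edges of a path share a vertex, so their cells coincide or are adjacent; the reduced
    path follows these cells, and a cell meeting a side sits on that side of the smaller
    triangle. *)
Lemma ywin_down N S : (0 <= N)%Z -> ywin (N + 1) S -> ywin N (ymaj S).
Proof.
move=> N0 [a [b [c [ab ac ha hb hc]]]].
set X := (fun z => tri N z /\ ymaj S z).
have lift u v : pconn (fun z => tri (N + 1) z /\ S z) u v ->
    forall q, X q -> incell q u -> exists q', [/\ X q', incell q' v & pconn X q q'].
  elim=> [w _ q Xq qw|u0 w z Su uw wz IH q Xq qu]; first by exists q; split=> //; apply: conn0.
  have [q1 [Xq1 q1u q1w]] := edge_cell Su (conn_start wz) uw.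
  have [q' [Xq' q'z c1]] := IH _ Xq1 q1w.
  by exists q'; split=> //; apply: conn_trans c1; apply: incell_adj qu q1u _ _.
have [q [Xq qa]] : exists q, X q /\ incell q a.
  (* If both paths were trivial, [a] would lie on all three sides, which forces N + 1 = 0. *)
  have [w [Sw aw]] : exists w, (tri (N + 1) w /\ S w) /\ pt_adj a w.
    case: (conn_next ab) => [eb|//]; case: (conn_next ac) => [ec|//].
    by move: ha hb hc; rewrite -eb -ec; lia.
  by have [q [Xq qa _]] := edge_cell (conn_start ab) Sw aw; exists q.
have [qb [Xqb qbb cb]] := lift _ _ ab _ Xq qa.
have [qc [Xqc qcc cc]] := lift _ _ ac _ Xq qa.
exists q, qb, qc; split=> //.
- move: ha qa Xq; rewrite /X /incell /tri; case: (q) (a) => [q1 q2] [a1 a2] /=.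
  by move=> -> [|[]] [? ?] []; lia.
- move: hb qbb Xqb; rewrite /X /incell /tri; case: (qb) (b) => [q1 q2] [a1 a2] /=.
  by move=> -> [|[]] [? ?] []; lia.
- move: hc qcc Xqc; rewrite /X /incell /tri; case: (qc) (c) => [q1 q2] [a1 a2] /=.
  by move=> -> [|[]] [? ?] []; lia.
Qed.

Lemma incell_pconn N S q u v : tri N q -> incell q u -> incell q v -> S u -> S v ->
  pconn (fun z => tri (N + 1) z /\ S z) u v.
Proof.
move=> Tq qu qv Su Sv.
have T w : incell q w -> tri (N + 1) w.
  by move: Tq; rewrite /incell /tri; case: (w) (q) => [w1 w2] [q1 q2] /= h [|[]] [? ?]; lia.
have [<-|ne] := pselect (u = v); first by apply: conn0; split=> //; apply: T.
apply: conn1; [by split=> //; apply: T|by split=> //; apply: T|].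
move: qu qv ne; rewrite /incell /pt_adj; case: (u) (v) (q) => [x y] [x' y'] [q1 q2] /=.
by case=> [|[]] [-> ->] [|[]] [-> ->] ne; try (by case: ne); lia.
Qed.

Lemma ymaj_ex (S : pt -> Prop) q (a b : pt) : ymaj S q -> incell q a -> incell q b -> a <> b ->
  S a \/ S b.
Proof.
by rewrite /ymaj => m [|[]] -> [|[]] -> ne; try (by case: ne); tauto.
Qed.

(** Adjacent cells share a vertex. If it is not in [S], both majorities consist of the remaining
    vertices, among which some pair is adjacent. *)
Lemma ymaj_step N S q q' : tri N q -> tri N q' -> ymaj S q -> ymaj S q' ->
  pt_adj q q' ->
  exists u v, [/\ S u, S v, incell q u, incell q' v &
    pconn (fun z => tri (N + 1) z /\ S z) u v].
Proof.
move=> Tq Tq' m m' qq'.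
suff [u [v [Su Sv qu qv uv]]] : exists u v, [/\ S u, S v, incell q u, incell q' v &
    u = v \/ pt_adj u v].
  exists u, v; split=> //.
  have T p w : tri N p -> incell p w -> tri (N + 1) w.
    by rewrite /incell /tri; case: (w) (p) => [w1 w2] [q1 q2] /= h [|[]] [? ?]; lia.
  case: uv => [uv|uv]; first by rewrite -uv; apply: conn0; split=> //; apply: T qu.
  by apply: conn1 uv; split=> //; [apply: T qu|apply: T qv].
case: q q' {Tq Tq'} m m' qq' => [x y] [x' y'] m m' qq'.
have cases : ((x' = x + 1 /\ y' = y) \/ (x = x' + 1 /\ y = y') \/
              (x' = x /\ y' = y + 1) \/ (x' = x /\ y = y' + 1) \/
              (x' = x + 1 /\ y' = y + 1) \/ (x = x' + 1 /\ y = y' + 1))%Z.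
  by move: qq'; rewrite /pt_adj /=; lia.
have fin u v : S u -> S v -> incell (x, y) u -> incell (x', y') v -> u = v \/ pt_adj u v ->
  exists u v : pt, [/\ S u, S v, incell (x, y) u, incell (x', y') v & u = v \/ pt_adj u v].
  by move=> *; exists u, v.
(* Here [s] is the shared vertex, and [p1], [p3] is the adjacent pair used when [s] is not in
   [S]. *)
have go (s p1 p2 p3 p4 : pt) : incell (x, y) s -> incell (x', y') s ->
  incell (x, y) p1 -> incell (x, y) p2 -> incell (x', y') p3 -> incell (x', y') p4 ->
  s <> p1 -> s <> p2 -> s <> p3 -> s <> p4 -> pt_adj p1 p3 ->
  exists u v : pt, [/\ S u, S v, incell (x, y) u, incell (x', y') v & u = v \/ pt_adj u v].
  move=> i1 i2 i3 i4 i5 i6 n1 n2 n3 n4 p13.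
  have [Ss|nSs] := pselect (S s); first by apply: (fin s s) => //; left.
  case: (ymaj_ex m i1 i3 n1) => // Sp1.
  case: (ymaj_ex m' i2 i5 n3) => // Sp3.
  by apply: (fin p1 p3) => //; right.
case: cases => [|[|[|[|[|]]]]] [e1 e2]; subst.
- apply: (go (x + 1, y)%Z (x + 1, y + 1)%Z (x,y) (x + 1 + 1, y + 1)%Z (x + 1 + 1, y)%Z);
  rewrite /incell /pt_adj /=; try tauto; try lia; by case; lia.
- apply: (go (x' + 1, y')%Z (x' + 1 + 1, y' + 1)%Z (x'+1+1,y')%Z (x' + 1, y' + 1)%Z (x', y')%Z);
  rewrite /incell /pt_adj /=; try tauto; try lia; by case; lia.
- apply: (go (x + 1, y + 1)%Z (x, y)%Z (x+1,y)%Z (x, y + 1)%Z (x + 1, y + 1 + 1)%Z);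
  rewrite /incell /pt_adj /=; try tauto; try lia; by case; lia.
- apply: (go (x + 1, y' + 1)%Z (x, y'+1)%Z (x+1,y'+1+1)%Z (x, y')%Z (x + 1, y')%Z);
  rewrite /incell /pt_adj /=; try tauto; try lia; by case; lia.
- apply: (go (x + 1, y + 1)%Z (x+1, y)%Z (x,y)%Z (x+1+1, y+1)%Z (x + 1+1, y+1+1)%Z);
  rewrite /incell /pt_adj /=; try tauto; try lia; by case; lia.
- apply: (go (x' + 1, y' + 1)%Z (x'+1+1, y'+1)%Z (x'+1+1,y'+1+1)%Z (x'+1, y')%Z (x', y')%Z);
  rewrite /incell /pt_adj /=; try tauto; try lia; by case; lia.
Qed.

Lemma ywin_up N S : ywin N (ymaj S) -> ywin (N + 1) S.
Proof.
case=> [q [qb [qc [cb cc hq hb hc]]]].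
have lift q0 q1 : pconn (fun z => tri N z /\ ymaj S z) q0 q1 ->
    forall u v, incell q0 u -> incell q1 v -> S u -> S v ->
    pconn (fun z => tri (N + 1) z /\ S z) u v.
  elim=> [w [Tw mw] u v wu wv Su Sv|w x y [Tw mw] wx xy IH u v wu yv Su Sv].
    exact: incell_pconn wu wv Su Sv.
  have [Tx mx] := conn_start xy.
  have [u1 [v1 [Su1 Sv1 wu1 xv1 uv1]]] := ymaj_step Tw Tx mw mx wx.
  apply: conn_trans (incell_pconn Tw wu wu1 Su Su1) _.
  by apply: conn_trans uv1 _; apply: IH.
(* A cell on a side has two vertices on the corresponding side of the larger triangle, and the
   majority contains one of them. *)
have pick (p a b : pt) : tri N p /\ ymaj S p -> incell p a -> incell p b -> a <> b ->
    exists z, [/\ incell p z, S z & z = a \/ z = b].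
  by move=> [_ m] pa pb ne; case: (ymaj_ex m pa pb ne) => h; [exists a|exists b]; split=> //; tauto.
have [a [qa Sa ea]] : exists z, [/\ incell q z, S z & z = q \/ z = (q.1 + 1, q.2)%Z].
  apply: pick (conn_start cb) _ _ _; rewrite /incell; try tauto.
  by case: (q) => q1 q2 /= []; lia.
have [b [qbb Sb eb]] : exists z, [/\ incell qb z, S z & z = (qb.1 + 1, qb.2)%Z \/ z = (qb.1 + 1, qb.2 + 1)%Z].
  apply: pick (conn_end cb) _ _ _; rewrite /incell; try tauto.
  by case: (qb) => q1 q2 /= []; lia.
have [c [qcc Sc ec]] : exists z, [/\ incell qc z, S z & z = qc \/ z = (qc.1 + 1, qc.2 + 1)%Z].
  apply: pick (conn_end cc) _ _ _; rewrite /incell; try tauto.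
  by case: (qc) => q1 q2 /= []; lia.
exists a, b, c; split.
- exact: lift cb _ _ qa qbb Sa Sb.
- exact: lift cc _ _ qa qcc Sa Sc.
- by case: ea => ->.
- by case: eb => -> /=; rewrite hb.
- by case: ec => -> /=; rewrite hc.
Qed.

(** Two majorities of one cell share a vertex, so reduction preserves disjointness; it ends at a
    single vertex. *)
Lemma ywin_disjoint N (S S' : pt -> Prop) : (0 <= N)%Z ->
  (forall z, S z -> S' z -> False) -> ywin N S -> ywin N S' -> False.
Proof.
move=> N0; move: N N0 S S'; apply: natlike_ind => [|N N0 IH] S S' dis.
  move=> [a [b [c [ab ac ha hb hc]]]] [a' [b' [c' [ab' ac' ha' hb' hc']]]].
  have [Ta Sa] := conn_start ab; have [Ta' Sa'] := conn_start ab'.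
  apply: (dis (0, 0)%Z); [have <- // : a = (0, 0)%Z|have <- // : a' = (0, 0)%Z].
    by move: Ta; rewrite /tri; case: (a) => x y /= h; congr pair; lia.
  by move: Ta'; rewrite /tri; case: (a') => x y /= h; congr pair; lia.
rewrite -Z.add_1_r => /(ywin_down N0) w /(ywin_down N0) w'.
by apply: IH w w' => z; rewrite /ymaj => h h'; case: h => [|[]] [h1 h2]; case: h' => [|[]] [h3 h4];
  eauto.
Qed.

(** Reduction commutes with complements, so the colour of the last remaining vertex decides. *)
Lemma ywin_exists N (S : pt -> Prop) : (0 <= N)%Z ->
  ywin N S \/ ywin N (fun z => ~ S z).
Proof.
move=> N0; move: N N0 S; apply: natlike_ind => [|N N0 IH] S.
  have T0 : tri 0 (0, 0)%Z by rewrite /tri /=; lia.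
  by case: (pselect (S (0, 0)%Z)) => h; [left|right]; exists (0, 0)%Z, (0, 0)%Z, (0, 0)%Z;
    split=> //; apply: conn0.
rewrite -Z.add_1_r; case: (IH (ymaj S)) => [/ywin_up|[a [b [c [ab ac ha hb hc]]]]]; first by left.
right; apply: ywin_up; exists a, b, c; split=> //.
  apply: conn_mono ab => z [Tz h]; split=> //; move: h; rewrite /ymaj.
  by case: (pselect (S z)); case: (pselect (S ((z.1 + 1)%Z, z.2)));
   case: (pselect (S ((z.1 + 1)%Z, (z.2 + 1)%Z))); tauto.
apply: conn_mono ac => z [Tz h]; split=> //; move: h; rewrite /ymaj.
by case: (pselect (S z)); case: (pselect (S ((z.1 + 1)%Z, z.2)));
   case: (pselect (S ((z.1 + 1)%Z, (z.2 + 1)%Z))); tauto.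
Qed.

(** * The game of Hex *)

Lemma pconn_vline (S : pt -> Prop) x y y' : (y <= y')%Z ->
  (forall t, (y <= t <= y')%Z -> S (x, t)) -> pconn S (x, y) (x, y').
Proof.
move=> yy' hS; rewrite -(Zplus_minus y y'); have : (0 <= y' - y)%Z by lia.
have : (y' - y <= y' - y)%Z by lia.
move: {1 3 4}(y' - y)%Z => k hk k0; move: k k0 hk; apply: natlike_ind => [|k k0 IH] hk.
  by rewrite Z.add_0_r; apply: conn0; apply: hS; lia.
apply: conn_trans (IH _) _; first lia.
apply: conn1; [apply: hS; lia|apply: hS; lia|rewrite /pt_adj /=; lia].
Qed.

Lemma pconn_hline (S : pt -> Prop) x x' y : (x <= x')%Z ->
  (forall t, (x <= t <= x')%Z -> S (t, y)) -> pconn S (x, y) (x', y).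
Proof.
move=> xx' hS.
apply: (@conn_map _ _ pt_adj _ (fun z : pt => (z.2, z.1)) (fun z => S (z.2, z.1)) S (y, x) (y, x')) => //=.
  by move=> a b _ _; rewrite /pt_adj /=; lia.
exact: pconn_vline.
Qed.

Definition sq (M : Z) (z : pt) : Prop := (0 <= z.1 <= M /\ 0 <= z.2 <= M)%Z.

(* The square is a rhombus of the lattice; it is completed to a triangle whose
   two added corners carry one colour each. *)
Lemma hex_disjoint M (S S' : pt -> Prop) a b c d :
  (forall z, sq M z -> S z -> S' z -> False) ->
  pconn (fun z => sq M z /\ S z) a b -> a.1 = 0%Z -> b.1 = M ->
  pconn (fun z => sq M z /\ S' z) c d -> c.2 = 0%Z -> d.2 = M -> False.
Proof.
move=> dis ab ha hb cd hc hd.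
have [qa Sa] := conn_start ab; have [qb Sb] := conn_end ab.
have [qc Sc] := conn_start cd; have [qd Sd] := conn_end cd.
case: (Z_le_gt_dec M 0) => M1.
  apply: (dis a) => //; suff -> : a = c by [].
  by move: qa qc; rewrite /sq; case: (a) (c) => [? ?] [? ?] /= ? ?; congr pair; lia.
pose T := (M + M)%Z.
(* The corner left of the shifted square meets the bottom and the diagonal and goes to [S1]; the
   corner above it meets the right side and the diagonal and goes to [S1']. *)
pose S1 z := (z.1 < M /\ z.2 <= M)%Z \/ sq M (z.1 - M, z.2)%Z /\ S (z.1 - M, z.2)%Z.
pose S1' z := (z.1 >= M /\ z.2 > M)%Z \/ sq M (z.1 - M, z.2)%Z /\ S' (z.1 - M, z.2)%Z.
apply: (@ywin_disjoint T S1 S1'); first by rewrite /T; lia.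
- move=> z [h|[h1 h2]] [h'|[h3 h4]]; try by move: h'; lia.
  + by move: h3; rewrite /sq /=; lia.
  + by move: h1; rewrite /sq /=; lia.
  + exact: dis h2 h4.
- exists (M - 1, 0)%Z, (b.1 + M, b.2)%Z, (M - 1, M - 1)%Z => X; split=> //=.
  + pose y := Z.min a.2 (M - 1).
    move: qa; rewrite /sq => qa'.
    apply: (@conn_trans _ _ _ _ (M - 1, y)%Z).
      apply: pconn_vline; first by rewrite /y; lia.
      by move=> t; rewrite /y /X /tri /S1 /T /= => ht; split; [lia|left; lia].
    have sh u v : pconn (fun z => sq M z /\ S z) u v -> pconn X (u.1 + M, u.2)%Z (v.1 + M, v.2)%Z.
      apply: (conn_map (h := fun z : pt => (z.1 + M, z.2)%Z)) => [z|? ? _ _]; last by rewrite /pt_adj /=; lia.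
      rewrite /X /tri /S1 /T /= => -[h Sz]; split; first by move: h; rewrite /sq; lia.
      by right; rewrite Z.add_simpl_r; case: (z) h Sz.
    have ab' := sh _ _ ab.
    apply: conn_trans ab'; apply: conn1; last by rewrite /pt_adj /y /=; lia.
      by rewrite /X /tri /S1 /T /y /=; split; [lia|left; lia].
    exact: conn_start (sh _ _ ab).
  + by apply: pconn_vline; [lia|move=> t ht]; rewrite /X /tri /S1 /T /=; split; [lia|left; lia].
  + by rewrite hb.
- have sh u v : pconn (fun z => sq M z /\ S' z) u v ->
      pconn (fun z => tri T z /\ S1' z) (u.1 + M, u.2)%Z (v.1 + M, v.2)%Z.
    apply: (conn_map (h := fun z : pt => (z.1 + M, z.2)%Z)) => [z|? ? _ _]; last by rewrite /pt_adj /=; lia.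
    rewrite /tri /S1' /T /= => -[h Sz]; split; first by move: h; rewrite /sq; lia.
    by right; rewrite Z.add_simpl_r; case: (z) h Sz.
  have top x : (M + 1 <= x <= T)%Z -> (fun z => tri T z /\ S1' z) (x, M + 1)%Z.
    by rewrite /tri /S1' /T /= => h; split; [lia|left; lia].
  pose x := Z.max (d.1 + M) (M + 1); move: (qd); rewrite /sq => qd'.
  have xT : (M + 1 <= x <= T)%Z by rewrite /x /T; lia.
  have cx : pconn (fun z => tri T z /\ S1' z) (c.1 + M, c.2)%Z (x, M + 1)%Z.
    apply: conn_trans (sh _ _ cd) _; apply: conn1; [exact: conn_end (sh _ _ cd)|exact: top|].
    by rewrite /pt_adj /x /=; lia.
  exists (c.1 + M, c.2)%Z, (T, M + 1)%Z, (M + 1, M + 1)%Z => X; split=> //=.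
  + by apply: conn_trans cx _; apply: pconn_hline; [lia|move=> t ht; apply: top; lia].
  + by apply: conn_trans cx _; apply: pconn_sym; apply: pconn_hline; [lia|move=> t ht; apply: top; lia].
Qed.

Lemma lip_fst (S : pt -> Prop) u v : S u -> S v -> pt_adj u v -> (Z.abs (u.1 - v.1) <= 1)%Z.
Proof. rewrite /pt_adj; lia. Qed.

Lemma lip_snd (S : pt -> Prop) u v : S u -> S v -> pt_adj u v -> (Z.abs (u.2 - v.2) <= 1)%Z.
Proof. rewrite /pt_adj; lia. Qed.

(** In the same triangle, a Y of [S1] contains a path from the diagonal to the right side, which
    crosses the square horizontally; a Y of the complement contains a path from the bottom to the
    upper part of the diagonal, which crosses it vertically. *)
Lemma hex_exists M (S : pt -> Prop) : (0 <= M)%Z ->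
  (exists a b, [/\ pconn (fun z => sq M z /\ S z) a b, a.1 = 0%Z & b.1 = M]) \/
  (exists c d, [/\ pconn (fun z => sq M z /\ ~ S z) c d, c.2 = 0%Z & d.2 = M]).
Proof.
move=> M0; pose T := (M + M)%Z.
pose S1 (z : pt) := (z.1 < M)%Z \/ (z.2 <= M)%Z /\ S (z.1 - M, z.2)%Z.
have shadj (u v : pt) : pt_adj u v -> pt_adj (u.1 - M, u.2)%Z (v.1 - M, v.2)%Z.
  by rewrite /pt_adj /=; lia.
case: (@ywin_exists T S1); first by rewrite /T; lia.
- case=> [a [b [c [ab ac ha hb hc]]]]; left.
  have cb := conn_trans (pconn_sym ac) ab.
  have c1 : (c.1 <= M)%Z by case: (conn_start cb) => _ [|[]]; lia.
  have [||u [v [uv _ hu hv]]] := conn_crossing (@lip_fst _) _ cb c1 (b := T); rewrite ?hb; [by rewrite /T; lia|lia|].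
  exists (u.1 - M, u.2)%Z, (v.1 - M, v.2)%Z; split=> /=; [|rewrite hu; lia|rewrite hv /T; lia].
  apply: (conn_map (h := fun z : pt => (z.1 - M, z.2)%Z)) uv => [z|? ? _ _]; last exact: shadj.
  by rewrite /T /tri /sq /= => -[[h [|[h1 h2]]] h3]; [lia|split=> //; lia].
- case=> [a [b [c [ab ac ha hb hc]]]]; right.
  have c2 : (M <= c.2)%Z.
    case: (conn_end ac) => _; rewrite /S1 -hc => h.
    by case: (Z_lt_le_dec c.1 M) => // ?; case: h; left.
  have a2 : (a.2 <= 0)%Z by lia.
  have [|u [v [uv _ hu hv]]] := conn_crossing (@lip_snd _) M0 ac a2 (b := M); first by [].
  exists (u.1 - M, u.2)%Z, (v.1 - M, v.2)%Z; split=> //=.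
  apply: (conn_map (h := fun z : pt => (z.1 - M, z.2)%Z)) uv => [z|? ? _ _]; last exact: shadj.
  rewrite /T /tri /sq /S1 /= => -[[h h1] h3].
  case: (Z_lt_le_dec z.1 M) => h4; first by case: h1; left.
  by split; [lia|move=> h5; case: h1; right; split=> //; lia].
Qed.

(** * Averages over fair bits *)

Section Averages.
Variable K : realFieldType.

Section OneType.
Variable T : finType.
Implicit Types (F G : {ffun T -> bool} -> K) (w : {ffun T -> bool}) (p : T) (s : seq T).

Definition upd w p (b : bool) : {ffun T -> bool} := [ffun u => if u == p then b else w u].

(** The conditional expectation given all bits but [p]. Folding it over an enumeration yields [avg],
    which allows induction over the bits. *)
Definition avg1 p F w : K := (F (upd w p false) + F (upd w p true)) / 2.
Definition avgs s F := foldr avg1 F s.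
Definition avg F : K := (\sum_w F w) / 2 ^+ #|T|.

Definition insens p F := forall w b, F (upd w p b) = F w.
Definition cle w w' := forall u, w u ==> w' u.
Definition cmono F := forall w w', cle w w' -> F w <= F w'.

Lemma upd_upd w p b b' : upd (upd w p b) p b' = upd w p b'.
Proof. by apply/ffunP => u; rewrite !ffunE; case: eqP. Qed.

Lemma updC w p q b b' : p != q -> upd (upd w p b) q b' = upd (upd w q b') p b.
Proof. by move=> pq; apply/ffunP => u; rewrite !ffunE; case: eqP => // ->; rewrite eq_sym (negbTE pq). Qed.

Lemma upd_id w p : upd w p (w p) = w.
Proof. by apply/ffunP => u; rewrite !ffunE; case: eqP => // ->. Qed.

Lemma expr2n_neq0 (n : nat) : (2 ^+ n : K) != 0.
Proof. by rewrite expf_neq0 // pnatr_eq0. Qed.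

Lemma expr2n_gt0 (n : nat) : 0 < (2 ^+ n : K).
Proof. by rewrite exprn_gt0. Qed.

Lemma upd_reindex p F : \sum_w F (upd w p (~~ w p)) = \sum_w F w.
Proof.
pose h w := upd w p (~~ w p).
have hK : involutive h.
  move=> w; rewrite /h; apply/ffunP => u; rewrite !ffunE eqxx; case: eqP => // ->.
  by rewrite negbK.
by rewrite [RHS](reindex_inj (inv_inj hK)).
Qed.

Lemma avg1E p F w : avg1 p F w = (F w + F (upd w p (~~ w p))) / 2.
Proof. by rewrite /avg1 -{3}(upd_id w p); case: (w p) => //=; rewrite addrC. Qed.

Lemma avg_avg1 p F : avg (avg1 p F) = avg F.
Proof.
rewrite /avg (eq_bigr _ (fun w _ => avg1E p F w)) -mulr_suml big_split /= upd_reindex.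
by field; apply: expr2n_neq0.
Qed.

Lemma avg_avgs s F : avg (avgs s F) = avg F.
Proof. by elim: s => //= p s IH; rewrite avg_avg1. Qed.

Lemma insens_avg1 p F : insens p (avg1 p F).
Proof. by move=> w b; rewrite /avg1 !upd_upd. Qed.

Lemma insens_avg1' p q F : insens p F -> insens p (avg1 q F).
Proof.
move=> hF w b; rewrite /avg1; have [->|pq] := eqVneq p q; first by rewrite !upd_upd.
by rewrite !(updC _ _ _ pq) !hF.
Qed.

Lemma insens_avgs p s F : (p \in s) || `[< insens p F >] -> insens p (avgs s F).
Proof.
elim: s => [|q s IH] /=; first by move/asboolP.
have [e|pq] := eqVneq p q; first by move=> _; rewrite e; apply: insens_avg1.
by rewrite in_cons (negbTE pq) => /IH; apply: insens_avg1'.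
Qed.

Lemma insens_eq F w w' : (forall p, w p != w' p -> insens p F) -> F w = F w'.
Proof.
suff: forall s, (forall p, w p != w' p -> p \in s) ->
   (forall p, w p != w' p -> insens p F) -> F w = F w'.
  by move/(_ (enum T)); apply=> p; rewrite mem_enum.
move=> s; elim: s w => [|q s IH] w hs hF.
  by congr F; apply/ffunP => u; apply/eqP; apply: contraT => /hs.
rewrite -(IH (upd w q (w' q))).
- have [e|ne] := eqVneq (w q) (w' q); first by rewrite -e upd_id.
  by rewrite hF.
- move=> p; rewrite ffunE; have [->|pq] := eqVneq p q; first by rewrite eqxx.
  by move/hs; rewrite in_cons (negbTE pq).
- move=> p; rewrite ffunE; have [->|pq] := eqVneq p q; first by rewrite eqxx.
  exact: hF.
Qed.

Lemma avg_const (c : K) : avg (fun=> c) = c.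
Proof.
rewrite /avg sumr_const card_ffun card_bool -[c *+ _]mulr_natr natrX.
by field; apply: expr2n_neq0.
Qed.

Lemma eq_avg F G : F =1 G -> avg F = avg G.
Proof. by move=> e; rewrite /avg (eq_bigr _ (fun w _ => e w)). Qed.

Lemma avg_enum F w : avg F = avgs (enum T) F w.
Proof.
rewrite -(avg_avgs (enum T)) -[RHS]avg_const; apply: eq_avg => w'.
by apply: insens_eq => p _; apply: insens_avgs; rewrite mem_enum.
Qed.

Lemma ler_avg F G : (forall w, F w <= G w) -> avg F <= avg G.
Proof. by move=> h; rewrite /avg ler_pM2r ?invr_gt0 ?expr2n_gt0 //; apply: ler_sum. Qed.

Lemma avgD F G : avg (fun w => F w + G w) = avg F + avg G.
Proof. by rewrite /avg big_split /= mulrDl. Qed.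

Lemma avgZ c F : avg (fun w => c * F w) = c * avg F.
Proof. by rewrite /avg -mulr_sumr mulrA. Qed.

Lemma avgN F : avg (fun w => - F w) = - avg F.
Proof. by rewrite /avg sumrN mulNr. Qed.

Lemma avgB F G : avg (fun w => F w - G w) = avg F - avg G.
Proof. by rewrite avgD avgN. Qed.

Lemma avg_ge0 F : (forall w, 0 <= F w) -> 0 <= avg F.
Proof. by move=> h; rewrite -[X in X <= _](avg_const 0); apply: ler_avg. Qed.

Lemma cle_upd w w' p b : cle w w' -> cle (upd w p b) (upd w' p b).
Proof. by move=> h u; rewrite !ffunE; case: eqP => // _; case: b. Qed.

Lemma cmono_avg1 p F : cmono F -> cmono (avg1 p F).
Proof.
by move=> hF w w' h; rewrite /avg1 ler_pM2r ?invr_gt0 // lerD // hF //; apply: cle_upd.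
Qed.

Lemma cmono_avgs s F : cmono F -> cmono (avgs s F).
Proof. by move=> hF; elim: s => //= p s; apply: cmono_avg1. Qed.

Lemma ler_avg1 p F G : (forall w, F w <= G w) -> forall w, avg1 p F w <= avg1 p G w.
Proof. by move=> h w; rewrite /avg1 ler_pM2r ?invr_gt0 // lerD. Qed.

(** Induction over the bits: for a single bit it is Chebyshev's inequality (F1 - F0)(G1 - G0) >= 0,
    and partial averages stay monotone. *)
Lemma harris F G : cmono F -> cmono G -> avg F * avg G <= avg (fun w => F w * G w).
Proof.
move=> hF hG; pose w0 : {ffun T -> bool} := [ffun=> false].
rewrite !(avg_enum _ w0); elim: (enum T) w0 => //= p s IH w.
apply: le_trans (ler_avg1 p IH w).
have := cmono_avgs s hF (w := upd w p false) (w' := upd w p true).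
have := cmono_avgs s hG (w := upd w p false) (w' := upd w p true).
have le01 : cle (upd w p false) (upd w p true) by move=> u; rewrite !ffunE; case: eqP => // _; apply: implybb.
move=> /(_ le01); rewrite -subr_ge0 => h1 /(_ le01); rewrite -subr_ge0 => h2.
have := mulr_ge0 h2 h1; rewrite /avg1; lra.
Qed.

Lemma avg_indep (e : pred T) F G :
  (forall p, ~~ e p -> insens p F) -> (forall p, e p -> insens p G) ->
  avg (fun w => F w * G w) = avg F * avg G.
Proof.
move=> hF hG; pose w0 : {ffun T -> bool} := [ffun=> false].
rewrite !(avg_enum _ w0); elim: (enum T) w0 => //= p s IH w.
rewrite /avg1 !IH; case: (boolP (e p)) => ep.
  have iG : insens p (avgs s G) by apply: insens_avgs; apply/orP; right; apply/asboolP; apply: hG.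
  by rewrite !iG; field.
have iF : insens p (avgs s F) by apply: insens_avgs; apply/orP; right; apply/asboolP; apply: hF.
by rewrite !iF; field.
Qed.

Lemma avg_xor (a : {ffun T -> bool}) F : avg (fun w => F [ffun u => w u (+) a u]) = avg F.
Proof.
pose h w : {ffun T -> bool} := [ffun u => w u (+) a u].
have hK : involutive h by move=> w; apply/ffunP => u; rewrite !ffunE -addbA addbb addbF.
by rewrite /avg [in RHS](reindex_inj (inv_inj hK)).
Qed.

End OneType.

Lemma avg_inj (S T : finType) (i : S -> T) (F : {ffun S -> bool} -> K) : injective i ->
  avg (fun w : {ffun T -> bool} => F [ffun q => w (i q)]) = avg F.
Proof.
move=> inj_i; pose r (w : {ffun T -> bool}) : {ffun S -> bool} := [ffun q => w (i q)].
(* Averaging over the bits in the image of [i] commutes with reading through [i], and over the whole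
   image it already leaves a constant. *)
have push s : avgs [seq i q | q <- s] (fun w => F (r w)) =1 (fun w => avgs s F (r w)).
  elim: s => //= q s IH w; rewrite /avg1 !IH.
  have e b : r (upd w (i q) b) = upd (r w) q b by apply/ffunP => u; rewrite !ffunE (inj_eq inj_i).
  by rewrite !e.
rewrite -(avg_avgs [seq i q | q <- enum S]) (eq_avg (push _)) -[RHS](avg_const T).
by apply: eq_avg => w; rewrite -avg_enum.
Qed.

End Averages.

(** * Probabilities of events and Harris' inequality for decreasing events *)

Section Probability.
Variables (K : realFieldType) (T : finType).
Implicit Types A B : {ffun T -> bool} -> Prop.

Definition prob A : K := avg (fun w => (`[< A w >])%:R).

Lemma prob_le A B : (forall w, A w -> B w) -> prob A <= prob B.
Proof.
move=> h; apply: ler_avg => w; rewrite ler_nat; case: asboolP => // /h Bw.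
by case: asboolP.
Qed.

Lemma prob_ge0 A : 0 <= prob A.
Proof. by apply: avg_ge0 => w. Qed.

Lemma prob_le1 A : prob A <= 1.
Proof. by rewrite -[X in _ <= X](avg_const T 1); apply: ler_avg => w; case: asboolP. Qed.

Lemma eq_prob A B : (forall w, A w <-> B w) -> prob A = prob B.
Proof. by move=> h; apply/eqP; rewrite eq_le !prob_le // => w /h. Qed.

Lemma prob_compl A : prob (fun w => ~ A w) = 1 - prob A.
Proof.
rewrite -[1](avg_const T) -avgB; apply: eq_avg => w.
by rewrite asbool_neg; case: asboolP => _ /=; rewrite ?subrr ?subr0.
Qed.

Lemma prob_or A B : prob (fun w => A w \/ B w) <= prob A + prob B.
Proof.
rewrite -avgD; apply: ler_avg => w; rewrite asbool_or.
by case: asboolP; case: asboolP => //= _ _; rewrite ?addr0 ?add0r // ler_wpDr.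
Qed.

Lemma prob_True : prob (fun=> True) = 1.
Proof. by rewrite -[RHS](avg_const T); apply: eq_avg => w; rewrite asboolT. Qed.

Definition decr A := forall w w', cle w w' -> A w' -> A w.

Lemma harris_decr A B : decr A -> decr B ->
  prob A * prob B <= prob (fun w => A w /\ B w).
Proof.
move=> dA dB.
have mono C : decr C -> cmono (fun w => - (`[< C w >])%:R : K).
  move=> dC w w' h; rewrite lerN2 ler_nat; have := dC _ _ h.
  by case: asboolP => // Cw' /(_ Cw') Cw; case: asboolP.
have := harris (mono _ dA) (mono _ dB); rewrite !avgN mulrNN => h.
apply: le_trans h _; rewrite le_eqVlt; apply/orP; left; apply/eqP.
by apply: eq_avg => w; rewrite mulrNN asbool_and -natrM mulnb.
Qed.

Lemma harris_all (I : Type) (l : seq I) (A : I -> {ffun T -> bool} -> Prop) (c : K) :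
  0 <= c -> (forall i, decr (A i)) -> (forall i, c <= prob (A i)) ->
  c ^+ size l <= prob (fun w => foldr (fun i P => A i w /\ P) True l).
Proof.
move=> c0 dA hA; elim: l => [|i l IH] /=; first by rewrite expr0 prob_True.
have dl : decr (fun w => foldr (fun i P => A i w /\ P) True l).
  by elim: l {IH} => [|j l IH] w w' h //= [a b]; split; [apply: dA a|apply: IH b].
apply: le_trans (harris_decr (dA i) dl); rewrite exprS.
by apply: ler_pM => //; apply: exprn_ge0.
Qed.

End Probability.

(** * Reflection across a lattice line *)

Lemma prob_involution (K : realFieldType) (T : finType) (h : {ffun T -> bool} -> {ffun T -> bool})
  (A : {ffun T -> bool} -> Prop) : involutive h -> prob K (fun w => A (h w)) = prob K A.
Proof. by move=> hK; rewrite /prob /avg [in RHS](reindex_inj (inv_inj hK)). Qed.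

Section Reflection.
Variables (K : realFieldType) (T : finType) (adj : T -> T -> Prop) (rho : T -> T).
(** In the application, [Lft] is the open left half of a chevron, [BL] its lower side, [TL] its
    upper side together with the upper end of the axis, [B] the whole lower side, and [rho] the
    reflection. *)
Variables Lft BL TL B : T -> Prop.
Hypothesis adj_sym : forall u v, adj u v -> adj v u.
Hypothesis rhoK : involutive rho.
Hypothesis rho_adj : forall u v, adj u v -> adj (rho u) (rho v).
Hypothesis Lft_disj : forall u, Lft u -> Lft (rho u) -> False.
Hypothesis axis : forall u, ~ Lft u -> ~ Lft (rho u) -> rho u = u.
Hypothesis noadj : forall u v, Lft u -> Lft (rho v) -> adj u v -> False.
Hypothesis BL_Lft : forall u, BL u -> Lft u.
Hypothesis B_cases : forall u, B u ->
  BL u \/ BL (rho u) \/ (rho u = u /\ exists w, BL w /\ adj u w).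
Hypothesis TL_side : forall u, TL u -> ~ Lft (rho u).
Hypothesis planar : forall X Y : T -> Prop, (forall z, X z -> Y z -> False) ->
  forall a b c d, TL (rho a) -> BL b -> conn adj X a b ->
                  TL c -> BL (rho d) -> conn adj Y c d -> False.

Implicit Types w : {ffun T -> bool}.

Definition cross_left w : Prop :=
  exists b t, [/\ BL b, TL t & conn adj (fun z => w z /\ Lft z) b t].

Definition cross_top w : Prop :=
  exists t b, [/\ TL t, B b & conn adj (fun z => w z) t b].

Definition cluster w z : Prop :=
  exists b, BL b /\ conn adj (fun z => w z /\ Lft z) b z.

(** The cluster of the left bottom side with its boundary in the left half: the vertices whose
    states an exploration from that side reveals. *)
Definition explored w v : Prop :=
  Lft v /\ (BL v \/ exists z, cluster w z /\ adj z v).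

Definition known w v : Prop := explored w v \/ explored w (rho v).

(* The explored set depends only on the states inside it, so this is an involution; it exchanges
   [touch_right] and [touch_left], which exclude each other by planarity, hence the factor 1/2 in
   [prob_cross_top]. *)
Definition recolour w : {ffun T -> bool} :=
  [ffun v => if `[< known w v >] then w v else ~~ w (rho v)].

Lemma cluster_explored w z : cluster w z -> explored w z.
Proof.
move=> [b [Bb /(conn_sym adj_sym) zb]]; have [_ Lz] := conn_start zb; split=> //.
case: zb Lz Bb => [u _|u v x Su uv vx] Lz Bb; first by left.
right; exists v; split; last exact: adj_sym.
by exists x; split=> //; apply: conn_sym.
Qed.

Lemma explored_cluster w z : explored w z -> w z -> cluster w z.
Proof.
move=> [Lz [Bz|[v [[b [Bb bv]] vz]]]] wz; first by exists z; split=> //; apply: conn0.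
exists b; split=> //; apply: (conn_trans bv); apply: conn1 => //.
by have [_] := cluster_explored (ex_intro _ b (conj Bb bv)); have [] := conn_end bv.
Qed.

Lemma known_rho w v : known w (rho v) <-> known w v.
Proof. by rewrite /known rhoK; tauto. Qed.

Lemma recolour_known w v : known w v -> recolour w v = w v.
Proof. by rewrite ffunE; case: asboolP. Qed.

Lemma recolour_unknown w v : ~ known w v -> recolour w v = ~~ w (rho v).
Proof. by rewrite ffunE; case: asboolP. Qed.

(** The recolouring keeps the states of all explored vertices, and these alone determine the
    exploration. *)
Lemma cluster_recolour w : cluster (recolour w) = cluster w.
Proof.
apply/funext => z; apply/propext; split.
- have step b v : conn adj (fun z => recolour w z /\ Lft z) b v -> cluster w b -> cluster w v.
    elim=> // a c x Sa ac cx IH ca; apply: IH.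
    have [wc Lc] := conn_start cx.
    have ec : explored w c by split=> //; right; exists a.
    by apply: explored_cluster => //; rewrite -recolour_known //; left.
  move=> [b [Bb bz]]; apply: (step _ _ bz); have [wb Lb] := conn_start bz.
  have eb : explored w b by split=> //; left.
  by apply: explored_cluster => //; rewrite -recolour_known //; left.
- move=> [b [Bb bz]]; exists b; split=> //.
  suff : conn adj (fun z => (w z /\ Lft z) /\ cluster w z) b z.
    apply: conn_mono => v [[wv Lv] cv]; split=> //; rewrite recolour_known //.
    by left; apply: cluster_explored.
  apply: (conn_inv _ bz).
    move=> u v Su Sv uv [b' [Bb' b'u]]; exists b'; split=> //.
    by apply: conn_trans b'u _; apply: conn1.
  by exists b; split=> //; apply: conn0; apply: conn_start bz.
Qed.

Lemma explored_recolour w : explored (recolour w) = explored w.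
Proof. by rewrite /explored cluster_recolour. Qed.

Lemma known_recolour w : known (recolour w) = known w.
Proof. by rewrite /known explored_recolour. Qed.

Lemma recolourK : involutive recolour.
Proof.
move=> w; apply/ffunP => v; case: (pselect (known w v)) => h.
  by rewrite recolour_known ?known_recolour // recolour_known.
rewrite recolour_unknown ?known_recolour // recolour_unknown ?known_rho //.
by rewrite rhoK negbK.
Qed.

Definition touch_right w : Prop :=
  exists t v u, [/\ TL t, conn adj (fun z => w z /\ ~ known w z) t v,
                    explored w (rho u) & adj v u].

Definition touch_left w : Prop :=
  exists t v u, [/\ TL (rho t), conn adj (fun z => ~~ w z /\ ~ known w z) t v,
                    explored w u & adj v u].

Lemma touch_recolour w : touch_right w -> touch_left (recolour w).
Proof.
move=> [t [v [u [Tt tv eu vu]]]]; exists (rho t), (rho v), (rho u).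
rewrite rhoK explored_recolour; split=> //; last exact: rho_adj.
apply: conn_map tv => [z [wz kz]|a b _ _]; last exact: rho_adj.
rewrite known_recolour; split; last by rewrite known_rho.
by rewrite recolour_unknown ?known_rho // rhoK wz.
Qed.

Lemma explored_conn w u : explored w u ->
  exists b, BL b /\ conn adj (explored w) u b.
Proof.
move=> eu; have [Lu [Bu|[z [cz zu]]]] := eu; first by exists u; split=> //; apply: conn0.
have ez := cluster_explored cz; have [b [Bb bz]] := cz; exists b; split=> //.
apply: connS eu (adj_sym zu) _; apply: (conn_sym adj_sym).
suff : conn adj (fun z => (w z /\ Lft z) /\ cluster w z) b z.
  by apply: conn_mono => v [_]; apply: cluster_explored.
apply: (conn_inv _ bz).
  move=> x y Sx Sy xy [b' [Bb' b'x]]; exists b'; split=> //.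
  by apply: conn_trans b'x _; apply: conn1.
by exists b; split=> //; apply: conn0; apply: conn_start bz.
Qed.

(** The two paths, prolonged to the bottom through the mirror image of the explored set and through
    the explored set, would join top left to bottom right and top right to bottom left inside
    disjoint sets. *)
Lemma touch_disjoint w : touch_right w -> touch_left w -> False.
Proof.
move=> [t [v [u [Tt tv eu vu]]]] [t' [v' [u' [Tt' tv' eu' vu']]]].
pose X z := explored w z \/ (~~ w z /\ ~ known w z).
pose Y z := explored w (rho z) \/ (w z /\ ~ known w z).
have [b [Bb ub]] := explored_conn eu; have [b' [Bb' ub']] := explored_conn eu'.
apply: (@planar X Y _ t' b' t (rho b) Tt' Bb' _ Tt).
- move=> z [ez|[wz kz]] [ez'|[wz' kz']].
  + by case: ez ez' => Lz _ [Lz' _]; apply: Lft_disj Lz Lz'.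
  + by case: kz'; left.
  + by case: kz; right.
  + by move: wz; rewrite wz'.
- apply: (@conn_trans _ _ _ _ u'); last by apply: conn_mono ub' => z; left.
  apply: (@conn_trans _ _ _ _ v'); first by apply: conn_mono tv' => z; right.
  by apply: conn1 vu'; [right; apply: conn_end tv'|left].
- by rewrite rhoK.
- apply: (@conn_trans _ _ _ _ u).
    apply: (@conn_trans _ _ _ _ v); first by apply: conn_mono tv => z; right.
    by apply: conn1 vu; [right; apply: conn_end tv|left].
  rewrite -[u]rhoK; apply: conn_map ub => [z ez|x y _ _]; last exact: rho_adj.
  by left; rewrite rhoK.
Qed.

(** The path from the top is followed until it meets the known region. If it meets the explored half
    first, the preceding vertex is unexplored and hence on the axis, so it also touches the mirror
    image. If it never does, it ends at the axis vertex of the bottom, next to the mirror image of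
    [BL]. *)
Lemma cross_top_touch w : cross_top w -> ~ cross_left w -> touch_right w.
Proof.
move=> [t [b [Tt Bb tb]]] nL.
have kt : ~ known w t.
  case=> [et|[Lt _]]; last exact: TL_side Tt Lt.
  have [b' [Bb' b't]] := explored_cluster et (conn_start tb).
  by case: nL; exists b', t.
have spread c : conn adj (fun z => w z) t c -> ~ known w t ->
    conn adj (fun z => w z /\ ~ known w z) t c \/
    exists x y, [/\ conn adj (fun z => w z /\ ~ known w z) t x, w y, known w y & adj x y].
  elim=> [a wa ka|a d x wa ad dx IH ka]; first by left; apply: conn0.
  case: (pselect (known w d)) => kd.
    by right; exists a, d; split=> //; [apply: conn0|apply: conn_start dx].
  case: (IH kd) => [c1|[x1 [y1 [c1 wy ky xy]]]]; first by left; apply: (connS _ _ c1).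
  by right; exists x1, y1; split=> //; apply: (connS _ _ c1).
case: (spread _ tb kt) => [tb'|[x [y [tx wy ky xy]]]].
- have [_ kb] := conn_end tb'.
  case: (B_cases Bb) => [Bb'|[Bb'|[rb [v [Bv bv]]]]].
  + by case: kb; left; split; [apply: BL_Lft|left].
  + by case: kb; right; split; [apply: BL_Lft|left].
  + exists t, b, (rho v); split=> //; last by rewrite -rb; apply: rho_adj.
    by rewrite rhoK; split; [apply: BL_Lft|left].
- case: ky => [ey|ey]; last by exists t, x, y.
  have cy := explored_cluster ey wy; have [Ly _] := ey.
  have [_ kx] := conn_end tx.
  have nLx : ~ Lft x by move=> Lx; apply: kx; left; split=> //; right; exists y; split=> //; apply: adj_sym.
  have nRx : ~ Lft (rho x) by move=> Lx; apply: noadj Ly Lx (adj_sym xy).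
  have rx := axis nLx nRx.
  exists t, x, (rho y); split=> //; first by rewrite rhoK.
  by rewrite -rx; apply: rho_adj.
Qed.

(** Given no left crossing, [touch_left] excludes [touch_right] and, by the involution, is at least
    as likely; so a top crossing has conditional probability at most 1/2. *)
Lemma prob_cross_top : prob K (fun w => ~ cross_left w) / 2 <= prob K (fun w => ~ cross_top w).
Proof.
pose G w := ~ cross_left w.
have GP w : G w -> G (recolour w).
  move=> g [b [t [Bb Tt bt]]]; apply: g.
  have : cluster (recolour w) t by exists b.
  by rewrite cluster_recolour => -[b' [Bb' b't]]; exists b', t.
have h1 : prob K (fun w => G w /\ touch_right w) <= prob K (fun w => G w /\ touch_left w).
  rewrite -[X in _ <= X](prob_involution _ _ recolourK); apply: prob_le => w [g t].
  by split; [apply: GP|apply: touch_recolour].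
have h2 : prob K (fun w => G w /\ touch_right w) + prob K (fun w => G w /\ touch_left w) <= prob K G.
  rewrite -avgD; apply: ler_avg => w; rewrite !asbool_and.
  have := @touch_disjoint w.
  case: asboolP => // _; case: asboolP => //; case: asboolP => // *; rewrite ?addr0 ?add0r //; tauto.
have h3 : prob K G <= prob K (fun w => ~ cross_top w) + prob K (fun w => G w /\ touch_right w).
  apply: le_trans (prob_or _ _ _); apply: prob_le => w g.
  by case: (pselect (cross_top w)) => c; [right; split=> //; apply: cross_top_touch|left].
rewrite -/G; lra.
Qed.

End Reflection.

(** * Rhombi and chevrons *)

Definition occ (T : finType) (p : T -> pt) (w : {ffun T -> bool}) (z : pt) : Prop :=
  exists s, p s = z /\ w s.

(** Transports an event from a standard shape to its image under [h] inside any set of sites that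
    covers this image. *)
Lemma prob_transfer (K : realFieldType) (S T : finType) (p : S -> pt) (q : T -> pt)
    (h : pt -> pt) (E : (pt -> Prop) -> Prop) :
  injective p -> injective q -> injective h -> (forall s, exists t, q t = h (p s)) ->
  prob K (fun w => E (fun z => (exists s, p s = z) /\ occ q w (h z))) =
  prob K (fun w => E (occ p w)).
Proof.
move=> inj_p inj_q inj_h cov; have [i hi] := choice cov.
have inj_i : injective i.
  by move=> s s' /(congr1 q); rewrite !hi => /inj_h /inj_p.
rewrite -[RHS](avg_inj _ inj_i); apply: eq_avg => w; congr (_%:R); congr nat_of_bool.
congr asbool; congr E; apply/funext => z; apply/propext; split.
- move=> [[s ps] [t [qt wt]]]; exists s; split=> //; rewrite ffunE.
  suff -> : i s = t by [].
  by apply: inj_q; rewrite hi qt ps.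
- move=> [s [ps ws]]; split; first by exists s.
  by exists (i s); rewrite hi ps; move: ws; rewrite ffunE.
Qed.

Definition site (n : nat) : finType := ('I_n.+1 * 'I_n.+1)%type.
Definition site_pos n (u : site n) : pt := (Z.of_nat u.1, Z.of_nat u.2).

Lemma site_pos_inj n : injective (@site_pos n).
Proof.
move=> [a b] [c d] [/= h1 h2]; congr pair; apply: val_inj => /=; lia.
Qed.

Lemma site_posP n z : (exists s, @site_pos n s = z) <-> sq (Z.of_nat n) z.
Proof.
rewrite /sq; split=> [[[[a ha] [b hb]] <-]|]; rewrite /site_pos /=; first by lia.
case: z => x y /= h.
have hx : (Z.to_nat x < n.+1)%N by lia.
have hy : (Z.to_nat y < n.+1)%N by lia.
exists (Ordinal hx, Ordinal hy); rewrite /=; congr pair; lia.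
Qed.

Lemma sq_site n (u : site n) : sq (Z.of_nat n) (site_pos u).
Proof. by apply/site_posP; exists u. Qed.

Definition hcross n (S : pt -> Prop) : Prop :=
  exists a b, [/\ pconn (fun z => sq n z /\ S z) a b, a.1 = 0%Z & b.1 = n].

Lemma hcross_mono n (S S' : pt -> Prop) : (forall z, sq n z -> S z -> S' z) -> hcross n S -> hcross n S'.
Proof.
move=> sub [a [b [ab ha hb]]]; exists a, b; split=> //.
by apply: conn_mono ab => z [qz /(sub _ qz)].
Qed.

Definition swap_pt (z : pt) : pt := (z.2, z.1).
Definition swap_site n (u : site n) : site n := (u.2, u.1).

(** Exchanging coordinates and colours preserves the law. A crossing after the exchange is a vacant
    vertical crossing before it, which excludes an occupied horizontal one. *)
Lemma prob_hcross_site (K : realFieldType) n :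
  prob K (fun w : {ffun site n -> bool} => hcross (Z.of_nat n) (occ (@site_pos n) w)) <= 1 / 2.
Proof.
pose h (w : {ffun site n -> bool}) : {ffun site n -> bool} := [ffun u => ~~ w (swap_site u)].
have hK : involutive h.
  by move=> w; apply/ffunP => -[a b]; rewrite !ffunE negbK.
set A := (fun w => _).
have e : prob K (fun w => A (h w)) = prob K A by exact: prob_involution.
suff : prob K A + prob K (fun w => A (h w)) <= 1 by rewrite e; lra.
rewrite -[X in _ <= X](avg_const (site n)) -avgD; apply: ler_avg => w.
case: asboolP; case: asboolP => //=; rewrite ?addr0 ?add0r //.
move=> [c [d [cd hc hd]]] [a [b [ab ha hb]]]; exfalso.
apply: (@hex_disjoint (Z.of_nat n) (occ (@site_pos n) w) (fun z => ~ occ (@site_pos n) w z)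
  a b (swap_pt c) (swap_pt d)) => //.
apply: conn_map cd => [z [qz [s [<- hs]]]|u v _ _]; last by rewrite /pt_adj /swap_pt /=; lia.
split; first by move: (sq_site s); rewrite /sq /=; tauto.
move=> [t [ht wt]]; move: hs; rewrite ffunE; suff -> : swap_site s = t by rewrite wt.
by apply: site_pos_inj; rewrite ht.
Qed.

Lemma prob_hcross (K : realFieldType) (T : finType) (q : T -> pt) (h : pt -> pt) n :
  injective q -> injective h -> (forall z, sq (Z.of_nat n) z -> exists t, q t = h z) ->
  1 / 2 <= prob K (fun w => ~ hcross (Z.of_nat n) (fun z => occ q w (h z))).
Proof.
move=> iq ih cov; rewrite prob_compl.
suff -> : prob K (fun w => hcross (Z.of_nat n) (fun z => occ q w (h z))) =
  prob K (fun w : {ffun site n -> bool} => hcross (Z.of_nat n) (occ (@site_pos n) w)).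
  by have := prob_hcross_site K n; lra.
rewrite -(prob_transfer _ _ (@site_pos_inj n) iq ih) => [|s]; last exact/cov/sq_site.
by apply: eq_prob => w; split; apply: hcross_mono => z qz; [split=> //; apply/site_posP|case].
Qed.

(** The rhombus [0 <= x <= n], [x <= y <= x + n] and its mirror image in the diagonal; the minimum
    of the coordinates is the height above the bottom. *)
Definition chev (n : Z) (z : pt) : Prop :=
  (0 <= Z.min z.1 z.2 <= n /\ - n <= z.1 - z.2 <= n)%Z.

Definition ccross n (S : pt -> Prop) : Prop :=
  exists a b, [/\ pconn (fun z => chev n z /\ S z) a b,
    Z.min a.1 a.2 = 0%Z & Z.min b.1 b.2 = n].

Lemma ccross_mono n (S S' : pt -> Prop) : (forall z, chev n z -> S z -> S' z) -> ccross n S -> ccross n S'.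
Proof.
move=> sub [a [b [ab ha hb]]]; exists a, b; split=> //.
by apply: conn_mono ab => z [qz /(sub _ qz)].
Qed.

Section Chevron.
Variables (K : realFieldType) (n : nat).
Hypothesis n_gt0 : (0 < n)%N.
Let N := Z.of_nat n.
Let T := site (n + n).
Let pos : T -> pt := @site_pos (n + n).
(** The sites fill a square of side 2n around the chevron; restricting the edges confines the paths
    to it. *)
Let adj (u v : T) := pt_adj (pos u) (pos v) /\ chev N (pos u) /\ chev N (pos v).
Let rho : T -> T := @swap_site (n + n).
Let Lft (u : T) := ((pos u).1 < (pos u).2)%Z.
Let BL (u : T) := (pos u).1 = 0%Z /\ (0 < (pos u).2 <= N)%Z.
Let TL (u : T) := (pos u).1 = N /\ (N <= (pos u).2)%Z.
Let B (u : T) := chev N (pos u) /\ Z.min (pos u).1 (pos u).2 = 0%Z.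

Let rho1 u : (pos (rho u)).1 = (pos u).2. Proof. by []. Qed.
Let rho2 u : (pos (rho u)).2 = (pos u).1. Proof. by []. Qed.

Let pos_range u : (0 <= (pos u).1 <= N + N /\ 0 <= (pos u).2 <= N + N)%Z.
Proof. have : sq (Z.of_nat (n + n)) (pos u) by exact: sq_site.
by rewrite /sq /N; lia. Qed.

Let adj_conn (X : T -> Prop) a b : chev N (pos a) -> conn adj X a b ->
  pconn (fun z => chev N z /\ exists u, pos u = z /\ X u) (pos a) (pos b).
Proof.
move=> ca ab; suff : conn adj (fun z => X z /\ chev N (pos z)) a b.
  apply: conn_map => [u [Xu cu]|u v _ _ [uv _]] //; split=> //; by exists u.
by apply: conn_inv ab ca => u v _ _ [_ [_ cv]] _.
Qed.

Let planarity (X Y : T -> Prop) : (forall z, X z -> Y z -> False) ->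
  forall a b c d, TL (rho a) -> BL b -> conn adj X a b ->
                  TL c -> BL (rho d) -> conn adj Y c d -> False.
Proof.
move=> dis a b c d; rewrite /TL /BL !rho1 !rho2.
move=> [a2 a1] [b1 b2] ab [c1 c2] [d2 d1] cd.
have n1 : (1 <= N)%Z by rewrite /N; lia.
have ra := pos_range a; have rc := pos_range c.
have ca : chev N (pos a) by rewrite /chev; lia.
have cc : chev N (pos c) by rewrite /chev; lia.
have Xa := conn_start ab; have Yc := conn_start cd.
move/(adj_conn ca): ab => ab; move/(adj_conn cc): cd => cd.
(* In a square of side 2N + 1, the first path is prolonged along row N + 1 to the right side and the
   second along column N + 1 to the top, which contradicts Hex. *)
pose M := (N + N + 1)%Z.
pose inX (X : T -> Prop) z := chev N z /\ exists u, pos u = z /\ X u.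
pose S z := inX X z \/ (z.2 = N + 1 /\ (pos a).1 + 1 <= z.1)%Z.
pose S' z := inX Y z \/ (z.1 = N + 1 /\ (pos c).2 + 1 <= z.2)%Z.
have inS (V : T -> Prop) z : inX V z -> sq M z.
  by move=> [_ [u [<- _]]]; have := pos_range u; rewrite /sq /M; lia.
apply: (@hex_disjoint M S S' (pos b) (M, N + 1)%Z (pos d) (N + 1, M)%Z) => //.
- move=> z qz [[cz [u [uz Xu]]]|[h1 h2]] [[cz' [v [vz Yv]]]|[h3 h4]].
  + by apply: (dis u) => //; suff -> : u = v by []; apply: (@site_pos_inj (n + n)); rewrite -/pos uz.
  + by move: cz; rewrite /chev; lia.
  + by move: cz'; rewrite /chev; lia.
  (* The prolongations meet only when both paths start at the axis vertex (N, N). *)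
  + suff ac : a = c by apply: (dis a) => //; rewrite ac.
    apply: (@site_pos_inj (n + n)); rewrite -/pos; move: a1 a2 c1 c2 h1 h2 h3 h4.
    by case: (pos a) (pos c) => [x y] [x' y'] /= *; congr pair; lia.
- apply: (@conn_trans _ _ _ _ (pos a)).
    by apply: pconn_sym; apply: conn_mono ab => z h; split; [apply: inS h|left].
  have aS : sq M (pos a) /\ S (pos a) by split; [rewrite /sq /M; lia|left; split=> //; exists a].
  apply: (@connS _ _ _ _ ((pos a).1 + 1, N + 1)%Z _ aS); first by rewrite /pt_adj; cbn [fst snd]; lia.
  apply: pconn_hline => [|t ht]; first by rewrite /M; lia.
  by split; [rewrite /sq /M; cbn [fst snd]; lia|right; cbn [fst snd]; lia].
- apply: pconn_sym; apply: (@conn_trans _ _ _ _ (pos c)); last first.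
    by apply: conn_mono cd => z h; split; [apply: inS h|left].
  have cS : sq M (pos c) /\ S' (pos c) by split; [rewrite /sq /M; lia|left; split=> //; exists c].
  apply: pconn_sym.
  apply: (@connS _ _ _ _ (N + 1, (pos c).2 + 1)%Z _ cS); first by rewrite /pt_adj; cbn [fst snd]; lia.
  apply: pconn_vline => [|t ht]; first by rewrite /M; lia.
  by split; [rewrite /sq /M; cbn [fst snd]; lia|right; cbn [fst snd]; lia].
Qed.

(** Hex gives 1/2 for the left rhombus, reflection 1/4 for crossings starting on the left half of
    the top, and Harris 1/16 for both halves together. *)
Lemma prob_ccross_site :
  1 / 16 <= prob K (fun w : {ffun T -> bool} => ~ ccross N (occ pos w)).
Proof.
have n1 : (1 <= N)%Z by rewrite /N; lia.
have h1 : 1 / 2 <= prob K (fun w => ~ cross_left adj Lft BL TL w).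
  pose h (z : pt) : pt := (z.1, z.1 + N - z.2)%Z.
  have ih : injective h by move=> [x y] [x' y'] []; rewrite /= => -> e; congr pair; lia.
  apply: le_trans (prob_hcross K (n := n) (@site_pos_inj (n + n)) ih _) _.
    move=> z hz; apply/site_posP; move: hz; rewrite /sq /h /=; lia.
  apply: prob_le => w nh [b [t [Bb Tt bt]]]; apply: nh.
  have cb : chev N (pos b) by move: Bb; rewrite /BL /chev; lia.
  exists (h (pos b)), (h (pos t)); split; [|by case: Bb|by case: Tt].
  apply: (conn_map (h := h)) (adj_conn cb bt) => [z [cz [u [uz [wu Lu]]]]|u v _ _]; last first.
    by rewrite /pt_adj /h /=; lia.
  split; first by move: cz Lu; rewrite /Lft uz /chev /sq /h -/N /=; lia.
  exists u; split=> //; rewrite -/pos uz /h; case: (z) => x y /=; congr pair; lia.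
have h2 : 1 / 4 <= prob K (fun w => ~ cross_top adj TL B w).
  suff h : prob K (fun w => ~ cross_left adj Lft BL TL w) / 2 <=
           prob K (fun w => ~ cross_top adj TL B w) by lra.
  apply: (@prob_cross_top K T adj rho Lft BL TL B).
  - by move=> u v [uv [cu cv]]; split=> //; apply: pt_adj_sym.
  - by case.
  - by move=> u v [uv [cu cv]]; split; [|move: cu cv]; move: uv; rewrite /pt_adj /chev !rho1 !rho2; lia.
  - by move=> u; rewrite /Lft ?rho1 ?rho2; lia.
  - move=> u; rewrite /Lft ?rho1 ?rho2 => *; apply: (@site_pos_inj (n + n)); rewrite -/pos.
    by rewrite [LHS]surjective_pairing [RHS]surjective_pairing rho1 rho2; congr pair; lia.
  - by move=> u v; rewrite /Lft ?rho1 ?rho2 => ? ? [uv _]; move: uv; rewrite /pt_adj; lia.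
  - by move=> u; rewrite /BL /Lft; lia.
  - move=> u [cu mu]; rewrite /BL ?rho1 ?rho2.
    case: (Z_lt_le_dec 0 (pos u).2) => u2; first by left; move: cu mu; rewrite /chev; lia.
    case: (Z_lt_le_dec 0 (pos u).1) => u1; first by right; left; move: cu mu; rewrite /chev; lia.
    right; right; split.
      apply: (@site_pos_inj (n + n)); rewrite -/pos; have := pos_range u => *.
      by rewrite [LHS]surjective_pairing [RHS]surjective_pairing rho1 rho2; congr pair; lia.
    have [v hv] : exists v, @site_pos (n + n) v = (0, 1)%Z by apply/site_posP; rewrite /sq /=; lia.
    exists v; rewrite /adj /pos hv /=; split; first by lia.
    have := pos_range u; move: u1 u2 cu; rewrite /pos /pt_adj /chev /= => *; lia.
  - by move=> u; rewrite /TL /Lft ?rho1 ?rho2; lia.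
  - exact: planarity.
pose R (w : {ffun T -> bool}) : {ffun T -> bool} := [ffun u => w (rho u)].
have RK : involutive R by move=> w; apply/ffunP => -[a b]; rewrite !ffunE.
have d1 : decr (fun w => ~ cross_top adj TL B w).
  move=> w w' le nc [t [b [Tt Bb tb]]]; apply: nc; exists t, b; split=> //.
  by apply: conn_mono tb => z wz; apply: (implyP (le z)).
have d2 : decr (fun w => ~ cross_top adj TL B (R w)).
  by move=> w w' le; apply: d1 => u; rewrite !ffunE; apply: le.
apply: le_trans (@prob_le K T (fun w => ~ cross_top adj TL B w /\ ~ cross_top adj TL B (R w)) _ _); last first.
  move=> w [n1' n2] [a [b [ab ha hb]]].
  have lift u v : pconn (fun z => chev N z /\ occ pos w z) u v ->
      exists s t, [/\ pos s = u, pos t = v, chev N u & conn adj (fun z => w z) s t].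
    elim=> [z [cz [s [ps ws]]]|z z1 z2 [cz [s [ps ws]]] zz1 cc [s' [t [ps' pt' cz1 c]]]].
      by exists s, s; split=> //; apply: conn0.
    by exists s, t; split=> //; apply: connS c => //; rewrite /adj ps ps'.
  have [s [t [ps pt' cb c]]] := lift _ _ (pconn_sym ab).
  have ca := (conn_start ab).1.
  have Bt : B t by rewrite /B pt'.
  have Bt' : B (rho t) by move: Bt; rewrite /B /chev rho1 rho2; lia.
  case: (Z_le_gt_dec (pos s).1 (pos s).2) => le.
    by apply: n1'; exists s, t; split=> //; rewrite /TL; move: hb; rewrite -ps; lia.
  apply: n2; exists (rho s), (rho t); split=> //.
    by rewrite /TL ?rho1 ?rho2; move: hb; rewrite -ps; lia.
  apply: conn_map c => [z|u v _ _ [uv [cu cv]]]; first by rewrite ffunE; case: z.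
  by split; [|move: cu cv]; move: uv; rewrite /pt_adj /chev !rho1 !rho2; lia.
apply: le_trans (harris_decr K d1 d2); rewrite (prob_involution K (fun w => ~ cross_top adj TL B w) RK).
by apply: le_trans (ler_pM _ _ h2 h2); lra.
Qed.

End Chevron.

Lemma prob_ccross (K : realFieldType) (T : finType) (q : T -> pt) (h : pt -> pt) n : (0 < n)%N ->
  injective q -> injective h -> (forall z, sq (Z.of_nat (n + n)) z -> exists t, q t = h z) ->
  1 / 16 <= prob K (fun w => ~ ccross (Z.of_nat n) (fun z => occ q w (h z))).
Proof.
move=> n0 iq ih cov; apply: le_trans (prob_ccross_site K n0) _.
rewrite -(prob_transfer _ (fun S => ~ ccross (Z.of_nat n) S) 
  (@site_pos_inj (n + n)) iq ih) => [|s]; last exact/cov/sq_site.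
apply: prob_le => w nc c; apply: nc; apply: ccross_mono c => z cz o; split=> //.
by apply/site_posP; move: cz; rewrite /chev /sq; lia.
Qed.

(** * Staircases *)

Section Staircase.
Variable n : Z.
Hypothesis n1 : (1 <= n)%Z.

Definition diag (z : pt) : Z := (z.1 - z.2)%Z.

(* Constant and of slope 1 on alternate intervals of length n: the strip [0 <= height <= n] is a chain
   of rhombi in which any two consecutive ones form a chevron. *)
Definition stair (d : Z) : Z :=
  ((d / (2 * n)) * n + Z.max 0 (d mod (2 * n) - n))%Z.

Definition height (z : pt) : Z := (z.2 + stair (diag z))%Z.

Lemma stair_even k d : (2 * k * n <= d <= (2 * k + 1) * n)%Z -> stair d = (k * n)%Z.
Proof.
move=> h; rewrite /stair.
have e : (d / (2 * n) = k)%Z by symmetry; apply: (Z.div_unique_pos _ _ _ (d - 2 * k * n)); nia.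
have := Z.div_mod d (2 * n); rewrite e => hm; nia.
Qed.

Lemma stair_odd k d : ((2 * k + 1) * n <= d <= (2 * k + 2) * n)%Z ->
  stair d = (d - (k + 1) * n)%Z.
Proof.
move=> h; case: (Z.eq_dec d ((2 * k + 2) * n)) => [e|ne].
  rewrite (@stair_even (k + 1)); nia.
rewrite /stair.
have e : (d / (2 * n) = k)%Z by symmetry; apply: (Z.div_unique_pos _ _ _ (d - 2 * k * n)); nia.
have := Z.div_mod d (2 * n); rewrite e => hm; nia.
Qed.

Lemma stair_cases d : exists k,
  (2 * k * n <= d < (2 * k + 1) * n \/ (2 * k + 1) * n <= d < (2 * k + 2) * n)%Z.
Proof.
exists (d / (2 * n))%Z.
have := Z.div_mod d (2 * n); have := Z.mod_pos_bound d (2 * n); nia.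
Qed.

Lemma stair_step d : (0 <= stair (d + 1) - stair d <= 1)%Z.
Proof.
have [k [h|h]] := stair_cases d.
  rewrite !(@stair_even k); nia.
rewrite !(@stair_odd k); nia.
Qed.

(** The mean slope of [stair] is 1/2, so the staircase follows the line x + y = 0. *)
Lemma stair_bound d : (d - n <= 2 * stair d <= d)%Z.
Proof.
have [k [h|h]] := stair_cases d; first by rewrite (@stair_even k); nia.
rewrite (@stair_odd k); nia.
Qed.

Lemma height_bound z : (z.1 + z.2 - n <= 2 * height z <= z.1 + z.2)%Z.
Proof. have := stair_bound (diag z); rewrite /height /diag; lia. Qed.

Lemma lip_height (S : pt -> Prop) u v : S u -> S v -> pt_adj u v ->
  (Z.abs (height u - height v) <= 1)%Z.
Proof.
move=> _ _; rewrite /height /pt_adj => h.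
have : (diag u = diag v \/ diag u = diag v + 1 \/ diag v = diag u + 1)%Z by rewrite /diag; lia.
case=> [e|[e|e]]; rewrite e.
- lia.
- have := stair_step (diag v); move: e; rewrite /diag; lia.
- have := stair_step (diag u); move: e; rewrite /diag; lia.
Qed.

Lemma lip_diag (S : pt -> Prop) u v : S u -> S v -> pt_adj u v ->
  (Z.abs (diag u - diag v) <= 1)%Z.
Proof. rewrite /diag /pt_adj; lia. Qed.

(** The diagonals from j n to (j + 1) n cut rhombus j out of the strip. It is crossed lengthwise
    here, whereas [across] crosses the chevron of rhombi j and j + 1 between the two edges of the
    strip. *)
Definition along j (S : pt -> Prop) : Prop := exists u v,
  [/\ pconn (fun z => S z /\ 0 <= height z <= n /\ j * n <= diag z <= (j + 1) * n)%Z u v,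
      diag u = (j * n)%Z & diag v = ((j + 1) * n)%Z].

Definition across j (S : pt -> Prop) : Prop := exists u v,
  [/\ pconn (fun z => S z /\ 0 <= height z <= n /\ j * n <= diag z <= (j + 2) * n)%Z u v,
      height u = 0%Z & height v = n].

(** A path through the strip starting in rhombus j either stays within a chevron containing that
    rhombus or traverses one of the rhombi j - 1, j, j + 1 lengthwise. *)
Lemma stair_cross (W : Z) (S : pt -> Prop) u v :
  pconn S u v -> (height u <= 0)%Z -> (n <= height v)%Z ->
  (forall z, S z -> - W * n <= diag z <= W * n)%Z ->
  exists j, (- W - 1 <= j <= W + 1)%Z /\ (along j S \/ across j S).
Proof.
move=> uv hu hv hW.
have n0 : (0 <= n)%Z by lia.
have [a [b [ab _ ha hb]]] := conn_crossing (@lip_height S) n0 uv hu hv.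
pose X z := S z /\ (0 <= height z <= n)%Z; rewrite -/(X) in ab.
have [Sa _] := conn_start ab; have ha' := hW _ Sa.
pose j := (diag a / n)%Z.
have hj : (j * n <= diag a < (j + 1) * n)%Z.
  by have := Z.div_mod (diag a) n; have := Z.mod_pos_bound (diag a) n; rewrite /j; nia.
have jW : (- W <= j <= W)%Z by nia.
have al i x y : pconn X x y -> (diag x <= i * n)%Z -> ((i + 1) * n <= diag y)%Z -> along i S.
  move=> xy hx hy; have [|p [q [pq _ hp hq]]] := conn_crossing (@lip_diag X) _ xy hx hy; first by nia.
  exists p, q; split=> //; apply: conn_mono pq => z; rewrite /X; tauto.
pose f z := (- diag z)%Z.
have lipf (V : pt -> Prop) x y : V x -> V y -> pt_adj x y -> (Z.abs (f x - f y) <= 1)%Z.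
  by rewrite /f /diag /pt_adj; lia.
case: (conn_below (@lip_diag X) ab (b := ((j + 1) * n)%Z)); first by lia.
- move=> ab1.
  case: (conn_below (lipf _) ab1 (b := (- ((j - 1) * n))%Z)); first by rewrite /f; nia.
  + move=> ab2; exists (j - 1)%Z; split; first lia.
    right; exists a, b; split=> //; apply: conn_mono ab2 => z [[[Sz hz] h1] h2].
    by split=> //; split=> //; move: h2; rewrite /f; nia.
  + move=> [x [ax hx]]; exists (j - 1)%Z; split; first lia.
    left; apply: (al _ x a); [|move: hx; rewrite /f; lia|nia].
    by apply: pconn_sym; apply: conn_mono ax => z [].
- move=> [x [ax hx]].
  case: (conn_below (@lip_diag X) ab (b := ((j + 2) * n)%Z)); first by nia.
  + move=> ab1; case: (conn_below (lipf _) ab1 (b := (- (j * n))%Z)); first by rewrite /f; nia.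
    * move=> ab2; exists j; split; first lia.
      right; exists a, b; split=> //; apply: conn_mono ab2 => z [[[Sz hz] h1] h2].
      by split=> //; split=> //; move: h2; rewrite /f; nia.
    * move=> [y [ay hy]]; exists j; split; first lia.
      left; apply: (al _ y x); [|move: hy; rewrite /f; lia|lia].
      apply: conn_trans ax; apply: pconn_sym; apply: conn_mono ay => z; tauto.
  + move=> [y [ay hy]]; exists (j + 1)%Z; split; first lia.
    by left; apply: (al _ a y) => //; nia.
Qed.

(* These lattice symmetries carry the standard rhombus and chevron to the pieces of the staircase. *)
Definition along_map (k : Z) (odd : bool) (z : pt) : pt :=
  (if odd then (z.2 + (k + 1) * n, z.2 - z.1 - k * n)
   else (z.1 - z.2 + k * n + n, n - k * n - z.2))%Z.

Definition across_map (k : Z) (odd : bool) (z : pt) : pt :=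
  (if odd then (z.1 + (k + 1) * n, z.2 - (k + 1) * n)
   else (n + (k + 1) * n - z.1, n - k * n - z.2))%Z.

Definition parity (b : bool) : Z := if b then 1%Z else 0%Z.

Lemma along_map_inj k b : injective (along_map k b).
Proof.
by move=> [x y] [x' y']; rewrite /along_map; case: b => /= -[] *; congr pair; lia.
Qed.

Lemma across_map_inj k b : injective (across_map k b).
Proof.
by move=> [x y] [x' y']; rewrite /across_map; case: b => /= -[] *; congr pair; lia.
Qed.

Lemma along_hcross k b S : along (2 * k + parity b) S ->
  hcross n (fun z => S (along_map k b z)).
Proof.
move=> [u [v [uv hu hv]]].
pose g (z : pt) : pt := (if b then (z.1 - z.2 - (2 * k + 1) * n, z.1 - (k + 1) * n)
   else (z.1 - z.2 - 2 * k * n, n - z.2 - k * n))%Z.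
have gK z : along_map k b (g z) = z.
  by rewrite /along_map /g; case: z => x y; case: (b); cbn [fst snd]; congr pair; lia.
exists (g u), (g v); split.
- apply: (conn_map (h := g)) uv => [z [Sz [hz dz]]|x y _ _]; last first.
    by rewrite /pt_adj /g; case: (b); cbn [fst snd parity]; lia.
  split; last by rewrite gK.
  move: hz dz; rewrite /sq /g /height; case: (b); cbn [fst snd parity] => hz dz.
    by move: hz; rewrite (@stair_odd k) ?/diag; move: dz; rewrite /diag; nia.
  by move: hz; rewrite (@stair_even k) ?/diag; move: dz; rewrite /diag; nia.
- by move: hu; rewrite /g /diag; case: (b); cbn [fst snd parity]; lia.
- by move: hv; rewrite /g /diag; case: (b); cbn [fst snd parity]; lia.
Qed.

Lemma across_ccross k b S : across (2 * k + parity b) S ->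
  ccross n (fun z => S (across_map k b z)).
Proof.
move=> [u [v [uv hu hv]]].
pose g (z : pt) : pt := (if b then (z.1 - (k + 1) * n, z.2 + (k + 1) * n)
   else (n + (k + 1) * n - z.1, n - k * n - z.2))%Z.
have gK z : across_map k b (g z) = z.
  by rewrite /across_map /g; case: z => x y; case: (b); cbn [fst snd]; congr pair; lia.
pose X z := (S z /\ 0 <= height z <= n /\
  (2 * k + parity b) * n <= diag z <= (2 * k + parity b + 2) * n)%Z.
(* The chevrons of even index are upside down in the staircase, so there [g] reverses the height. *)
have hmin z : X z -> Z.min (g z).1 (g z).2 = (if b then height z else n - height z)%Z.
  move=> [_ [_]]; rewrite /g /height; case: (b); cbn [fst snd parity] => dz.
    case: (Z_le_gt_dec (diag z) ((2 * k + 2) * n)) => h.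
      by rewrite (@stair_odd k); rewrite /diag in dz h *; nia.
    by rewrite (@stair_even (k + 1)); rewrite /diag in dz h *; nia.
  case: (Z_le_gt_dec (diag z) ((2 * k + 1) * n)) => h.
    by rewrite (@stair_even k); rewrite /diag in dz h *; nia.
  by rewrite (@stair_odd k); rewrite /diag in dz h *; nia.
have guv : pconn (fun z => chev n z /\ S (across_map k b z)) (g u) (g v).
  apply: (conn_map (h := g)) uv => [z Xz|x y _ _]; last first.
    by rewrite /pt_adj /g; case: (b); cbn [fst snd parity]; lia.
  split; last by rewrite gK; case: Xz.
  rewrite /chev (hmin _ Xz); case: Xz => _ [hz].
  by rewrite /g /diag; case: (b); cbn [fst snd parity] => dz; nia.
have eu := hmin _ (conn_start uv); have ev := hmin _ (conn_end uv).
move: guv eu ev; case: (b) => guv eu ev.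
  by exists (g u), (g v); rewrite eu ev hu hv.
by exists (g v), (g u); rewrite eu ev hu hv; split; [apply: pconn_sym|lia|lia].
Qed.

End Staircase.

(** * Annuli *)

(** The graph distance from the origin; its balls are hexagons. *)
Definition hnorm (z : pt) : Z := Z.max (Z.max (Z.abs z.1) (Z.abs z.2)) (Z.abs (z.1 - z.2)).

Lemma lip_hnorm (S : pt -> Prop) u v : S u -> S v -> pt_adj u v ->
  (Z.abs (hnorm u - hnorm v) <= 1)%Z.
Proof. rewrite /hnorm /pt_adj; lia. Qed.

Definition arm (m : Z) (S : pt -> Prop) : Prop := exists u v,
  [/\ pconn (fun z => S z /\ m < hnorm z <= 6 * m)%Z u v,
      hnorm u = (m + 1)%Z & hnorm v = (6 * m)%Z].

(** [rot] is a rotation by sixty degrees and [neg] the half turn; their combinations place the four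
    staircases. *)
Definition turn (neg rot : bool) (z : pt) : pt :=
  let z' := if rot then (z.2, z.2 - z.1)%Z else z in
  if neg then (- z'.1, - z'.2)%Z else z'.

Definition place (m : Z) (neg rot : bool) (z : pt) : pt :=
  turn neg rot (z.1 + (m + 1), z.2 + (m + 1))%Z.

Lemma place_inj m s r : injective (place m s r).
Proof.
by move=> [x y] [x' y']; rewrite /place /turn; case: s; case: r => /= -[] *; congr pair; lia.
Qed.

(* One of the functionals +-(x + y), +-(2x - y) is at least 6m at the outer end and at most 2(m + 1) at
   the inner one; a staircase of width m, shifted by (m + 1, m + 1), fits between the two levels. *)
Lemma arm_pieces m S : (2 <= m)%Z -> arm m S ->
  exists s r j, (- 7 <= j <= 7)%Z /\
    (along m j (fun z => S (place m s r z)) \/ across m j (fun z => S (place m s r z))).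
Proof.
move=> m2 [u [v [uv hu hv]]]; have m1 : (1 <= m)%Z by lia.
have [s [r]] : exists s r : bool, let g (z : pt) : pt :=
    let z' := if s then (- z.1, - z.2)%Z else z in
    if r then (z'.1 - z'.2, z'.1)%Z else z' in (6 * m <= (g v).1 + (g v).2)%Z.
  have [h|[h|[h|h]]] : (6 * m <= v.1 + v.2 \/ v.1 + v.2 <= - (6 * m) \/
     6 * m <= 2 * v.1 - v.2 \/ 2 * v.1 - v.2 <= - (6 * m))%Z by move: hv; rewrite /hnorm; lia.
  - by exists false, false => /=.
  - by exists true, false; cbn [fst snd]; lia.
  - by exists false, true; cbn [fst snd]; lia.
  - by exists true, true; cbn [fst snd]; lia.
pose g (z : pt) : pt := let z' := if s then (- z.1, - z.2)%Z else z in
    if r then (z'.1 - z'.2, z'.1)%Z else z'.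
move=> gv'; have {gv'} gv : (6 * m <= (g v).1 + (g v).2)%Z := gv'.
pose f (z : pt) : pt := ((g z).1 - (m + 1), (g z).2 - (m + 1))%Z.
have fK z : place m s r (f z) = z.
  by rewrite /place /f /g /turn; case: z => x y; case: (s); case: (r); cbn [fst snd]; congr pair; lia.
have gnorm z : hnorm (g z) = hnorm z.
  by rewrite /hnorm /g; case: (s); case: (r); cbn [fst snd]; lia.
have fuv : pconn (fun z => S (place m s r z) /\ (hnorm (place m s r z) <= 6 * m)%Z) (f u) (f v).
  apply: (conn_map (h := f)) uv => [z [Sz hz]|x y _ _]; first by rewrite fK; split=> //; lia.
  by rewrite /pt_adj /f /g; case: (s); case: (r); cbn [fst snd]; lia.
have hf z : (2 * height m (f z) <= (g z).1 + (g z).2 - 2 * (m + 1))%Z.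
  by have := height_bound m1 (f z); rewrite /f; cbn [fst snd]; lia.
have hf' z : ((g z).1 + (g z).2 - 2 * (m + 1) - m <= 2 * height m (f z))%Z.
  by have := height_bound m1 (f z); rewrite /f; cbn [fst snd]; lia.
have gu : ((g u).1 + (g u).2 <= 2 * (m + 1))%Z by move: hu; rewrite -gnorm /hnorm; lia.
(* The arm stays in the ball of radius 6m, hence within 6 rhombi on either side; this gives the
   range of [j]. *)
have [||z [_ hz]|j [hj h]] := stair_cross m1 (W := 6%Z) fuv.
- by have := hf u; lia.
- by have := hf' v; lia.
- by move: hz; rewrite /hnorm /place /turn /diag; case: (s); case: (r); cbn [fst snd]; lia.
exists s, r, j; split; first lia.
case: h => [[a [b [ab ha hb]]]|[a [b [ab ha hb]]]]; [left|right]; exists a, b; split=> //;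
  by apply: conn_mono ab => z; tauto.
Qed.

Section ArmBound.
Variables (K : realFieldType) (T : finType) (q : T -> pt) (n : nat).
Hypothesis q_inj : injective q.
Hypothesis n2 : (2 <= n)%N.
Let m := Z.of_nat n.
Hypothesis q_cov : forall z, (hnorm z <= 100 * m)%Z -> exists t, q t = z.

Let piece (i : bool * bool * 'I_15 * bool) (S : pt -> Prop) : Prop :=
  let: (s, r, k, b) := i in
  let j := (Z.of_nat k - 7)%Z in
  if b then along m j (fun z => S (place m s r z)) else across m j (fun z => S (place m s r z)).

Let prob_piece i : 1 / 16 <= prob K (fun w => ~ piece i (occ q w)).
Proof.
case: i => [[[s r] k] b]; rewrite /piece.
set j := (Z.of_nat k - 7)%Z.
have hj : (- 7 <= j <= 7)%Z by have := ltn_ord k; rewrite /j; lia.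
have m1 : (1 <= m)%Z by rewrite /m; lia.
have ej : j = (2 * Z.div2 j + parity (Z.odd j))%Z by rewrite [LHS]Z.div2_odd; case: Z.odd.
set k' := Z.div2 j in ej; set o := Z.odd j in ej.
have hk : (- 4 <= k' <= 4)%Z by move: ej; rewrite /parity; case: (o); lia.
have hkm : (- (4 * m) <= k' * m <= 4 * m)%Z by nia.
have cov (h : pt -> pt) c :
    (forall z, sq (2 * m) z -> (-10 * m <= (h z).1 <= 10 * m /\ -10 * m <= (h z).2 <= 10 * m)%Z) ->
    sq (2 * m) c -> exists t, q t = place m s r (h c).
  move=> hh /hh hc; apply: q_cov; move: hc m1 n2; rewrite /hnorm /place /turn /m.
  by case: (s); case: (r); cbn [fst snd]; lia.
case: b.
  apply: le_trans (_ : _ <= 1 / 2) _; first lra.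
  have ih : injective (fun z => place m s r (along_map m k' o z)).
    by move=> x y /place_inj /along_map_inj.
  apply: le_trans (prob_hcross K (n := n) q_inj ih _) _.
    move=> z hz; apply: (cov (along_map m k' o)); last by move: hz; rewrite /sq -/m; lia.
    by move=> x; rewrite /sq /along_map; case: (o); cbn [fst snd]; lia.
  by apply: prob_le => w nh; rewrite ej => /(along_hcross m1).
have ih : injective (fun z => place m s r (across_map m k' o z)).
  by move=> x y /place_inj /across_map_inj.
apply: le_trans (prob_ccross K (n := n) _ q_inj ih _) _; first by lia.
  move=> z hz; apply: (cov (across_map m k' o)); last by move: hz; rewrite /sq /m; lia.
  by move=> x; rewrite /sq /across_map; case: (o); cbn [fst snd]; lia.
by apply: prob_le => w nh; rewrite ej => /(across_ccross m1).
Qed.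

Let decr_piece i : decr (fun w => ~ piece i (occ q w)).
Proof.
have mono (S S' : pt -> Prop) : (forall z, S z -> S' z) -> piece i S -> piece i S'.
  rewrite /piece; case: i => [[[s r] k] [|]] sub [a [b [ab ha hb]]]; exists a, b; split=> //;
  by apply: conn_mono ab => z [/sub].
move=> w w' le np p; apply: np; apply: mono p => z [t [qt wt]].
by exists t; split=> //; apply: (implyP (le t)).
Qed.

(** An arm crosses one of 4 * 15 * 2 pieces, and by Harris all of them are blocked together with
    probability at least (1/16)^120. *)
Lemma prob_arm : prob K (fun w => arm m (occ q w)) <= 1 - (1 / 16) ^+ 120.
Proof.
suff : (1 / 16) ^+ 120 <= prob K (fun w => ~ arm m (occ q w)) by rewrite prob_compl lerBrDl -lerBrDr.
have c0 : 0 <= (1 / 16 : K) by lra.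
have := harris_all (enum {: bool * bool * 'I_15 * bool}) c0 decr_piece prob_piece.
have -> : size (enum {: bool * bool * 'I_15 * bool}) = 120%N.
  by rewrite -cardE !card_prod !card_bool card_ord.
move/le_trans; apply; apply: prob_le => w hall ha.
have none i : ~ piece i (occ q w).
  have : i \in enum {: bool * bool * 'I_15 * bool} by rewrite mem_enum.
  elim: (enum _) hall => //= j l IH [nj hl]; rewrite in_cons => /orP[/eqP -> //|]; exact: IH.
have m2 : (2 <= m)%Z by rewrite /m; lia.
have [s [r [j [hj h]]]] := arm_pieces m2 ha.
have kb : (Z.to_nat (j + 7) < 15)%N by lia.
have ej : (Z.of_nat (Ordinal kb) - 7)%Z = j by rewrite /=; lia.
case: h => h; [apply: (none (s, r, Ordinal kb, true))|apply: (none (s, r, Ordinal kb, false))];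
by rewrite /piece ej.
Qed.

End ArmBound.

(** * The one-arm bound *)

Lemma prob_indep (K : realFieldType) (T : finType) (e : pred T) (A B : {ffun T -> bool} -> Prop) :
  (forall p, ~~ e p -> forall w b, A (upd w p b) <-> A w) ->
  (forall p, e p -> forall w b, B (upd w p b) <-> B w) ->
  prob K (fun w => A w /\ B w) = prob K A * prob K B.
Proof.
move=> hA hB; rewrite -(avg_indep (e := e)).
- by apply: eq_avg => w; rewrite asbool_and -natrM mulnb.
- by move=> p /hA h w b; rewrite (asbool_equiv_eq (h w b)).
- by move=> p /hB h w b; rewrite (asbool_equiv_eq (h w b)).
Qed.

Lemma arm_ext m (S S' : pt -> Prop) :
  (forall z, (m < hnorm z <= 6 * m)%Z -> S z -> S' z) -> arm m S -> arm m S'.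
Proof.
move=> sub [u [v [uv hu hv]]]; exists u, v; split=> //.
by apply: conn_mono uv => z [Sz hz]; split=> //; apply: sub.
Qed.

(** The ratio 6 makes the annuli of consecutive scales adjacent and disjoint; the first radius is 2
    because [arm_pieces] requires it. *)
Definition scale (j : nat) : nat := (2 * 6 ^ j)%N.

Definition arms (J : nat) (S : pt -> Prop) : Prop :=
  forall j, (j < J)%N -> arm (Z.of_nat (scale j)) S.

Lemma arms_mono J (S S' : pt -> Prop) : (forall z, S z -> S' z) -> arms J S -> arms J S'.
Proof. by move=> sub h j /h; apply: arm_ext => z _; apply: sub. Qed.

Lemma scaleS j : scale j.+1 = (6 * scale j)%N.
Proof. by rewrite /scale expnS; lia. Qed.

Lemma leq_scale i j : (i <= j)%N -> (scale i <= scale j)%N.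
Proof. by move=> ij; rewrite /scale leq_mul2l leq_pexp2l. Qed.

Lemma scale_ge2 j : (2 <= scale j)%N.
Proof. exact: (@leq_scale 0 j). Qed.

Definition arm_const (K : realFieldType) : K := 1 - (1 / 16) ^+ 120.

Section OneArm.
Variable K : realFieldType.

Lemma arm_const_ge0 : 0 <= arm_const K.
Proof. by rewrite subr_ge0 exprn_ile1 //; lra. Qed.

(** Different annuli read disjoint sets of bits, so the probabilities multiply. *)
Lemma prob_arms_cover (T : finType) (q : T -> pt) J : injective q ->
  (forall z, (hnorm z <= 100 * Z.of_nat (scale J))%Z -> exists t, q t = z) ->
  prob K (fun w => arms J (occ q w)) <= arm_const K ^+ J.
Proof.
move=> iq; elim: J => [|J IH] cov; first by rewrite expr0; apply: prob_le1.
have cov' : forall z, (hnorm z <= 100 * Z.of_nat (scale J))%Z -> exists t, q t = z.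
  by move=> z hz; apply: cov; rewrite scaleS; lia.
have e : prob K (fun w => arms J.+1 (occ q w)) =
    prob K (fun w => arms J (occ q w) /\ arm (Z.of_nat (scale J)) (occ q w)).
  apply: eq_prob => w; split=> [h|[h1 h2] j]; first by split=> [j hj|]; apply: h => //; lia.
  by rewrite ltnS leq_eqVlt => /orP[/eqP ->|/h1].
have occ_upd w p b z : q p <> z -> occ q (upd w p b) z <-> occ q w z.
  move=> ne; split=> -[t [qt wt]]; exists t; split=> //; move: wt; rewrite ffunE;
    by case: eqP => // tp; case: ne; rewrite -tp.
rewrite e (@prob_indep _ _ (fun t => `[< (hnorm (q t) <= Z.of_nat (scale J))%Z >])).
- rewrite exprSr; apply: ler_pM; [exact: prob_ge0|exact: prob_ge0|exact: IH|].
  by apply: prob_arm => //; apply: scale_ge2.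
- move=> p /asboolP hp w b; split=> h j hj; apply: arm_ext (h j hj) => z hz /occ_upd; apply;
    by move=> ez; apply: hp; rewrite ez; have := leq_scale hj; rewrite scaleS; lia.
- move=> p /asboolP hp w b; split; apply: arm_ext => z hz /occ_upd; apply;
    by move=> ez; rewrite ez in hp; lia.
Qed.

(** The sites are embedded into a set covering a large ball; arms are increasing, so the added sites
    only raise the probability. *)
Lemma prob_arms (S : finType) (p : S -> pt) J : injective p ->
  prob K (fun w => arms J (occ p w)) <= arm_const K ^+ J.
Proof.
move=> ip.
have [L hL] : exists L : nat, (forall s, (hnorm (p s) <= Z.of_nat L)%Z) /\ (100 * scale J <= L)%N.
  exists (100 * scale J + \sum_s Z.to_nat (hnorm (p s)))%N; split; last by lia.
  move=> s; rewrite (bigD1 s) //=; lia.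
case: hL => hp hJ.
pose q (u : site (L + L)) : pt := ((site_pos u).1 - Z.of_nat L, (site_pos u).2 - Z.of_nat L)%Z.
have iq : injective q.
  move=> u v euv; have := congr1 snd euv; have := congr1 fst euv; rewrite /q; cbn [fst snd] => h1 h2.
  by apply: site_pos_inj; rewrite [LHS]surjective_pairing [RHS]surjective_pairing; congr pair; lia.
have cov z : (hnorm z <= Z.of_nat L)%Z -> exists t, q t = z.
  move=> hz; have [t ht] : exists t, @site_pos (L + L) t = (z.1 + Z.of_nat L, z.2 + Z.of_nat L)%Z.
    by apply/site_posP; move: hz; rewrite /hnorm /sq; cbn [fst snd]; lia.
  exists t; rewrite /q ht; case: z {hz ht} => x y; cbn [fst snd]; congr pair; lia.
have [i hi] := choice (fun s => cov _ (hp s)).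
have inj_i : injective i by move=> s s' /(congr1 q); rewrite !hi => /ip.
rewrite /prob -(avg_inj _ inj_i).
apply: le_trans (prob_arms_cover iq (J := J) _); last by move=> z hz; apply: cov; lia.
apply: prob_le => w; apply: arms_mono => z [s [ps ws]]; exists (i s).
by rewrite hi ps; move: ws; rewrite ffunE.
Qed.

(* A coincidence of labels at [s2] costs a factor 2: the label of [s2] is replaced by a fresh bit. *)
Lemma prob_arms_labels (I S : finType) (p : S -> pt) (e : S -> I) (sg : S -> bool) (s2 : S) J :
  injective p -> (forall s s', e s = e s' -> s = s' \/ s = s2 \/ s' = s2) ->
  prob K (fun w : {ffun I -> bool} => arms J (occ p [ffun s => w (e s) (+) sg s]))
    <= 2 * arm_const K ^+ J.
Proof.
move=> ip he.
pose e' s := if s == s2 then None else Some (e s).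
have ie' : injective e'.
  move=> s s'; rewrite /e'; case: (eqVneq s s2) => [->|n1]; case: (eqVneq s' s2) => [->|n2] //.
  by case=> /he [//|[|]] h; rewrite h eqxx in n1 n2.
pose F (x : {ffun S -> bool}) : K := (`[< arms J (occ p x) >])%:R.
pose G (w : {ffun option I -> bool}) : K := F [ffun s => w (e' s) (+) sg s].
have hG : avg G <= arm_const K ^+ J.
  pose sg' : {ffun S -> bool} := [ffun s => sg s].
  have -> : avg G = avg F.
    rewrite -(avg_xor sg') -(avg_inj _ ie'); apply: eq_avg => w; congr F.
    by apply/ffunP => s; rewrite !ffunE.
  exact: prob_arms.
apply: le_trans (ler_wpM2l _ hG) => //.
have some_inj : injective (@Some I) by move=> ? ? [].
rewrite /prob -(avg_inj _ some_inj) -(avg_avg1 None G) -avgZ.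
apply: ler_avg => w; rewrite /avg1.
have F0 x : 0 <= F x by [].
(* One of the two values of the fresh bit agrees with the true label of [s2], so averaging over this
   bit loses at most a factor 2. *)
have key b : w (Some (e s2)) = b ->
   F [ffun s => [ffun q => w (Some q)] (e s) (+) sg s] = G (upd w None b).
  move=> hb; congr F; apply/ffunP => s; rewrite !ffunE /e'.
  by case: (eqVneq s s2) => [->|ne] /=; rewrite ?hb.
have [h|h] : w (Some (e s2)) = true \/ w (Some (e s2)) = false by case: (w _); [left|right].
- by rewrite -/(F _) (key _ h); have := F0 [ffun s => upd w None false (e' s) (+) sg s]; rewrite -/(G _); lra.
- by rewrite -/(F _) (key _ h); have := F0 [ffun s => upd w None true (e' s) (+) sg s]; rewrite -/(G _); lra.
Qed.

End OneArm.

(** * Decision trees *)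

Section DecisionTree.
Variables (K : realFieldType) (I : finType).
Implicit Types (w : {ffun I -> bool}) (i : I).

Inductive dtree := Leaf of bool | Node of I & dtree & dtree.

Fixpoint dvars t : seq I :=
  if t is Node i t0 t1 then i :: dvars t0 ++ dvars t1 else [::].

(** No variable is queried twice along a branch, so the subtrees do not depend on the bit of the
    root. *)
Fixpoint dfresh t : bool :=
  if t is Node i t0 t1 then
    [&& i \notin dvars t0, i \notin dvars t1, dfresh t0 & dfresh t1]
  else true.

Fixpoint deval t w : bool :=
  match t with
  | Leaf b => b
  | Node i t0 t1 => if w i then deval t1 w else deval t0 w
  end.

Fixpoint dquery t w : pred I :=
  match t with
  | Leaf b => pred0
  | Node i t0 t1 => [pred j | (j == i) || (if w i then dquery t1 w j else dquery t0 w j)]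
  end.

Lemma deval_upd t w i b : i \notin dvars t -> deval t (upd w i b) = deval t w.
Proof.
elim: t => //= j t0 IH0 t1 IH1; rewrite in_cons mem_cat !negb_or => /and3P[ij i0 i1].
by rewrite ffunE eq_sym (negbTE ij) IH0 ?IH1.
Qed.

Lemma dquery_upd t w i b j : i \notin dvars t -> dquery t (upd w i b) j = dquery t w j.
Proof.
elim: t => //= k t0 IH0 t1 IH1; rewrite in_cons mem_cat !negb_or => /and3P[ij i0 i1].
by rewrite ffunE [k == i]eq_sym (negbTE ij) IH0 ?IH1.
Qed.

Definition reveal t j : K := avg (fun w => (dquery t w j)%:R).

Definition influence (g : {ffun I -> bool} -> bool) i : K :=
  avg (fun w => (g w != g (upd w i (~~ w i)))%:R).

Lemma influence_ge0 (g : {ffun I -> bool} -> bool) i : 0 <= influence g i.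
Proof. by apply: avg_ge0 => w. Qed.

Lemma upd_neg (g : {ffun I -> bool} -> bool) w i :
  (g w != g (upd w i (~~ w i))) = (g (upd w i false) != g (upd w i true)).
Proof. by rewrite -{1}(upd_id w i); case: (w i) => //=; rewrite eq_sym. Qed.

Lemma reveal_node i t0 t1 j : i \notin dvars t0 -> i \notin dvars t1 ->
  (reveal t0 j + reveal t1 j) / 2 <= reveal (Node i t0 t1) j.
Proof.
move=> i0 i1; rewrite -[X in _ <= X](avg_avg1 i) -avgD mulrC -avgZ; apply: ler_avg => w.
rewrite /avg1 /= !ffunE eqxx /= !dquery_upd //.
by case: eqP => _ /=; case: dquery; case: dquery => /=; lra.
Qed.

Lemma reveal_root i t0 t1 : reveal (Node i t0 t1) i = 1.
Proof. by rewrite -[RHS](avg_const I); apply: eq_avg => w /=; rewrite eqxx. Qed.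

(* Revealing the root costs a quarter of its influence: with the root resampled, the values of the
   two subtrees differ by at most 1 while g changes only with the probability of its influence. *)
Lemma osss_cov (g : {ffun I -> bool} -> bool) t : dfresh t ->
  avg (fun w => (deval t w)%:R * (g w)%:R) - avg (fun w => (deval t w)%:R) * avg (fun w => (g w)%:R)
  <= 4^-1 * \sum_i reveal t i * influence g i.
Proof.
elim: t => [b _|i t0 IH0 t1 IH1 /= /and4P[i0 i1 /IH0 {}IH0 /IH1 {}IH1]].
  rewrite avgZ avg_const subrr mulr_ge0 ?invr_ge0 // sumr_ge0 // => i _.
  by rewrite mulr_ge0 ?influence_ge0 // avg_ge0.
pose G w : K := (g w)%:R.
pose D t w : K := (deval t w)%:R.
have hD t' w b : i \notin dvars t' -> D t' (upd w i b) = D t' w by move=> ?; rewrite /D deval_upd.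
have e1 : avg (fun w => D (Node i t0 t1) w) = (avg (D t0) + avg (D t1)) / 2.
  rewrite -(avg_avg1 i) -avgD mulrC -avgZ; apply: eq_avg => w.
  by rewrite /avg1 /D /= !ffunE eqxx !deval_upd //; ring.
have e2 t' : i \notin dvars t' ->
    avg (fun w => D t' w * G w) = avg (fun w => D t' w * (G (upd w i false) + G (upd w i true)) / 2).
  by move=> it'; rewrite -(avg_avg1 i); apply: eq_avg => w; rewrite /avg1 !hD //; ring.
(* Averaged over bit [i], the two sides differ before the influence term by (D1 - D0)(G1 - G0) / 4,
   at most a quarter of the indicator that this bit changes [g]. *)
have main : avg (fun w => D (Node i t0 t1) w * G w) <=
    (avg (fun w => D t0 w * G w) + avg (fun w => D t1 w * G w)) / 2 + 4^-1 * influence g i.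
  rewrite (e2 t0) // (e2 t1) // -(avg_avg1 i) -avgD [_ / 2]mulrC -!avgZ -avgD; apply: ler_avg => w.
  rewrite upd_neg /avg1 /D /G /= !ffunE eqxx !deval_upd //.
  by case: (deval t0 w); case: (deval t1 w); case: (g (upd w i false)); case: (g (upd w i true)) => /=; lra.
have sums : (\sum_j reveal t0 j * influence g j + \sum_j reveal t1 j * influence g j) / 2
    + influence g i <= \sum_j reveal (Node i t0 t1) j * influence g j.
  rewrite -big_split mulr_suml (bigD1 i) //= [X in _ <= X](bigD1 i) //= reveal_root mul1r.
  have r0 t' : i \notin dvars t' -> reveal t' i = 0.
    move=> it'; rewrite -[RHS](avg_const I); apply: eq_avg => w; apply/eqP.
    rewrite pnatr_eq0 eqb0; elim: t' it' => //= k s0 IHs0 s1 IHs1.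
    rewrite in_cons mem_cat !negb_or => /and3P[/negbTE -> ? ?] /=.
    by case: (w k); [apply: IHs1|apply: IHs0].
  rewrite (r0 t0) // (r0 t1) // !mul0r !add0r mul0r add0r [X in X <= _]addrC lerD2l; apply: ler_sum => j _.
  rewrite -mulrDl mulrAC; apply: ler_wpM2r; first exact: influence_ge0.
  exact: reveal_node.
rewrite -/(D _) -/(G _) e1; move: main IH0 IH1 sums; rewrite -!/(D _) -!/(G _); rewrite /D /G; lra.
Qed.

Lemma osss t : dfresh t ->
  prob K (fun w => deval t w) * (1 - prob K (fun w => deval t w)) <= 4^-1 * \sum_i reveal t i * influence (deval t) i.
Proof.
move=> ft; apply: le_trans (osss_cov (deval t) ft).
have e : prob K (fun w => deval t w) = avg (fun w => (deval t w)%:R).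
  by apply: eq_avg => w; rewrite asboolb.
have -> : avg (fun w => (deval t w)%:R * (deval t w)%:R) = avg (fun w => (deval t w)%:R) :> K.
  by apply: eq_avg => w; case: deval; rewrite /= ?mulr1 ?mulr0.
by rewrite e; lra.
Qed.

End DecisionTree.

(** * The slice as a mixture of pairings *)

(** Each level set of [g] is matched with that of [h] in the order of enumeration. *)
Lemma match_perm (V : finType) (X : eqType) (g h : V -> X) :
  (forall x, #|[pred v | g v == x]| = #|[pred v | h v == x]|) ->
  exists s : {perm V}, forall v, g v = h (s v).
Proof.
move=> e; pose f v := nth v (enum [pred u | h u == g v]) (index v (enum [pred u | g u == g v])).
have lt v : (index v (enum [pred u | g u == g v]) < size (enum [pred u | h u == g v]))%N.
  by rewrite -cardE -e cardE index_mem mem_enum inE.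
have hf v : h (f v) = g v.
  by have := mem_nth v (lt v); rewrite mem_enum inE => /eqP.
have inj_f : injective f.
  move=> v v' ef; have eg : g v = g v' by rewrite -hf ef hf.
  move/eqP: ef; rewrite /f eg (set_nth_default v') -?eg // nth_uniq ?enum_uniq // -?eg //; last by rewrite eg.
  move/eqP => ei; rewrite -(nth_index v (s := enum [pred u | g u == g v]) (x := v)).
    by rewrite ei eg nth_index // mem_enum inE.
  by rewrite mem_enum inE.
by exists (perm inj_f) => v; rewrite permE hf.
Qed.

Lemma uniq_perm_map (V : finType) (s s' : seq V) : uniq s -> uniq s' -> size s = size s' ->
  exists p : {perm V}, map p s = s'.
Proof.
elim: s s' => [|x s IH] [|x' s'] //=; first by exists 1%g.
move=> /andP[xs us] /andP[xs' us'] [/(IH _ us us')[p ps]].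
exists (p * tperm (p x) x')%g; rewrite permM tpermL; congr cons.
rewrite -ps; apply/eq_in_map => y ys; rewrite permM tpermD //.
  by apply: contraNneq xs => /perm_inj ->.
by apply: contraNneq xs' => ->; rewrite -ps map_f.
Qed.

Section Slice.
Variables (K : realFieldType) (V : finType).
Implicit Types (w : config V) (s : {perm V}).

Definition weight w : nat := (\sum_v w v)%N.

Definition pact s w : config V := [ffun v => w (s v)].

Definition slavg k (F : config V -> K) : K :=
  (\sum_(w | weight w == k) F w) / ('C(#|V|, k))%:R.

Lemma weight_pact s w : weight (pact s w) = weight w.
Proof.
by rewrite /weight [RHS](reindex_inj (@perm_inj _ s)); apply: eq_bigr => v _; rewrite ffunE.
Qed.

Lemma pact_inj s : injective (pact s).
Proof.
move=> w w' /ffunP e; apply/ffunP => v; have := e (s^-1%g v).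
by rewrite !ffunE permKV.
Qed.

Lemma weight_card w : weight w = #|[set v | w v]|.
Proof.
rewrite /weight -sum1_card big_mkcond [RHS]big_mkcond; apply: eq_bigr => v _.
by rewrite inE; case: (w v).
Qed.

Lemma card_slice k : #|[set w : config V | weight w == k]| = 'C(#|V|, k).
Proof.
rewrite -card_draws -(card_imset _ (f := fun w : config V => [set v | w v])).
  apply: eq_card => A; rewrite !inE; apply/imsetP/idP.
    by move=> [w]; rewrite inE weight_card => h ->.
  move=> h; exists [ffun v => v \in A]; last by apply/setP => v; rewrite inE ffunE.
  by rewrite inE weight_card (eq_card (B := A)) // => v; rewrite inE ffunE.
by move=> w w' /setP e; apply/ffunP => v; have := e v; rewrite !inE.
Qed.

Lemma sum_slice_const k (c : K) : \sum_(w : config V | weight w == k) c = c * ('C(#|V|, k))%:R.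
Proof.
rewrite sumr_const -card_slice mulr_natr; congr (_ *+ _).
by apply: eq_card => w; rewrite inE.
Qed.

Lemma slice_trans w w' : weight w = weight w' -> exists s, w = pact s w'.
Proof.
move=> e; have [s hs] : exists s : {perm V}, forall v, w v = w' (s v).
  apply: match_perm => -[].
    by move: e; rewrite !weight_card !cardsE => e; rewrite (eq_card (B := w)) ?e;
      [apply: eq_card => v|move=> v]; rewrite !inE eqb_id.
  have h (x : config V) : (#|[pred v | x v == false]| + weight x = #|V|)%N.
    by rewrite weight_card cardsE addnC -(cardC x); congr addn; apply: eq_card => v; rewrite !inE eqbF_neg.
  by apply/eqP; rewrite -(eqn_add2r (weight w)) h e h.
by exists s; apply/ffunP => v; rewrite ffunE.
Qed.

Lemma perm_card_gt0 : 0 < (#|{: {perm V}}|%:R : K).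
Proof. by rewrite ltr0n; apply/card_gt0P; exists 1%g. Qed.

Definition pavg (F : {perm V} -> K) : K := (\sum_s F s) / #|{: {perm V}}|%:R.

Lemma pavg_mull (F : {perm V} -> K) t : pavg (fun s => F (s * t)%g) = pavg F.
Proof. by rewrite /pavg [in RHS](reindex_inj (mulIg t)). Qed.

Lemma pavg_const c : pavg (fun=> c) = c.
Proof.
rewrite /pavg sumr_const -[c *+ _]mulr_natr mulfK //; exact: lt0r_neq0 perm_card_gt0.
Qed.

Lemma ler_pavg (F G : {perm V} -> K) : (forall s, F s <= G s) -> pavg F <= pavg G.
Proof. by move=> h; rewrite /pavg ler_pM2r ?invr_gt0 ?perm_card_gt0 //; apply: ler_sum. Qed.

Lemma pavgD (F G : {perm V} -> K) : pavg (fun s => F s + G s) = pavg F + pavg G.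
Proof. by rewrite /pavg big_split /= mulrDl. Qed.

Lemma pavgZ c (F : {perm V} -> K) : pavg (fun s => c * F s) = c * pavg F.
Proof. by rewrite /pavg -mulr_sumr mulrA. Qed.

(** Permutations act transitively on the slice, so the left side is the same for all its
    configurations; averaging it over the slice gives the right side. *)
Lemma slice_perm (F : config V -> K) w k : weight w = k ->
  pavg (fun s => F (pact s w)) = slavg k F.
Proof.
move=> wk.
have h w' : weight w' == k -> pavg (fun s => F (pact s w')) = pavg (fun s => F (pact s w)).
  move/eqP; rewrite -wk => /slice_trans[t ->].
  rewrite -[RHS](pavg_mull _ t); rewrite /pavg; congr (_ / _); apply: eq_bigr => s _; congr F.
  by apply/ffunP => v; rewrite !ffunE permM.
have C0 : (('C(#|V|, k))%:R : K) != 0.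
  by rewrite pnatr_eq0 -lt0n -card_slice; apply/card_gt0P; exists w; rewrite inE wk.
apply: (mulIf C0); rewrite /slavg mulfVK //.
have -> : pavg (fun s => F (pact s w)) * ('C(#|V|, k))%:R =
    \sum_(w' | weight w' == k) pavg (fun s => F (pact s w')).
  by rewrite (eq_bigr _ h) sum_slice_const.
rewrite /pavg -mulr_suml exchange_big /= (eq_bigr (fun=> \sum_(w' | weight w' == k) F w')).
  by rewrite sumr_const -[_ *+ _]mulr_natr mulfK //; apply: lt0r_neq0 perm_card_gt0.
move=> s _; rewrite [RHS](reindex_inj (@pact_inj s)).
by apply: eq_bigl => x; rewrite weight_pact.
Qed.

Lemma pavg_slavg k (F : {perm V} -> config V -> K) :
  pavg (fun s => slavg k (F s)) = slavg k (fun w => pavg (fun s => F s w)).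
Proof. by rewrite /pavg /slavg -mulr_suml exchange_big /= -[in RHS]mulr_suml mulrAC. Qed.

Lemma eq_slavg k (F G : config V -> K) : F =1 G -> slavg k F = slavg k G.
Proof. by move=> e; rewrite /slavg (eq_bigr _ (fun w _ => e w)). Qed.

Section Pairing.
Variables (I : finType) (lab : V -> I * bool) (unlab : I * bool -> V).
Hypothesis labK : cancel lab unlab.
Hypothesis unlabK : cancel unlab lab.
Implicit Types b t : {ffun I -> bool}.

(** [lab] is a reference pairing and a uniform [s] makes it random; the two members of pair i
    receive the states [b i] and [~~ b i]. *)
Definition cfg s b : config V := [ffun v => b (lab (s v)).1 (+) (lab (s v)).2].

Lemma card_pairing : #|V| = (#|I| + #|I|)%N.
Proof.
rewrite (bij_eq_card (f := lab)); last by exists unlab.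
by rewrite card_prod card_bool muln2 addnn.
Qed.

Lemma sum_pairing (R : nmodType) (F : V -> R) :
  \sum_v F v = \sum_i (F (unlab (i, false)) + F (unlab (i, true))).
Proof.
rewrite (reindex unlab) /=; last by exists lab => x _; rewrite ?labK ?unlabK.
transitivity (\sum_(p : I * bool) F (unlab (p.1, p.2))); first by apply: eq_bigr => -[].
rewrite -(pair_big xpredT xpredT (fun i c => F (unlab (i, c)))) /=.
by apply: eq_bigr => i _; rewrite big_bool addrC.
Qed.

Lemma weight_cfg s b : weight (cfg s b) = #|I|.
Proof.
rewrite /weight (reindex_inj (@perm_inj _ s^-1%g)) /= (sum_pairing (R := nat)).
rewrite (eq_bigr (fun=> 1%N)) ?sum1_card // => i _.
by rewrite !ffunE !permKV !unlabK /=; case: (b i).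
Qed.

Lemma pact_cfg s s' b : pact s (cfg s' b) = cfg (s * s')%g b.
Proof. by apply/ffunP => v; rewrite !ffunE permM. Qed.

Lemma pavg_cfg (F : config V -> K) : pavg (fun s => avg (fun b => F (cfg s b))) = slavg #|I| F.
Proof.
pose c0 b := cfg 1%g b.
rewrite /pavg /avg -mulr_suml mulrAC exchange_big /= mulr_suml.
rewrite (eq_bigr (fun=> slavg #|I| F)) => [|b _].
  by rewrite -[RHS](avg_const I).
rewrite -(@slice_perm F (cfg 1%g b)) ?weight_cfg // /pavg; congr (_ / _).
by apply: eq_bigr => s _; rewrite pact_cfg mulg1.
Qed.

(** Exchanging the members of the pairs selected by [b] has the same effect as flipping their bits,
    so a change of bits can be absorbed into the permutation. *)
Lemma twist_inj b : injective (fun v => unlab ((lab v).1, b (lab v).1 (+) (lab v).2)).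
Proof.
move=> v v' /(can_inj unlabK)[e1]; rewrite e1 => /(can_inj (addKb _)) e2.
by apply: (can_inj labK); rewrite [LHS]surjective_pairing e1 e2 -surjective_pairing.
Qed.

Lemma cfg_twist s b t : cfg s [ffun i => b i (+) t i] = cfg (s * perm (@twist_inj b))%g t.
Proof.
by apply/ffunP => v; rewrite !ffunE permM permE unlabK /= addbA [b _ (+) _]addbC -addbA.
Qed.

(** Both configurations occupy half of the vertices, so the joint states (0,1) and (1,0) are equally
    frequent, and so are (0,0) and (1,1). Vertices with opposite joint states are paired, and [t]
    marks the pairs of the first kind. *)
Lemma common_pairing w w' : weight w = #|I| -> weight w' = #|I| ->
  exists s t, w = cfg s [ffun=> false] /\ w' = cfg s t.
Proof.
move=> hw hw'.
pose cnt x y := #|[pred v | (w v, w' v) == (x, y)]|.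
have [A hA] : exists A : {set I}, #|A| = cnt false true.
  have le : (cnt false true <= #|I|)%N.
    by rewrite -hw' weight_card; apply: subset_leq_card; apply/subsetP => v; rewrite !inE => /eqP[_ ->].
  exists [set i in take (cnt false true) (enum I)].
  rewrite cardsE; have /card_uniqP -> : uniq (take (cnt false true) (enum I)).
    by rewrite take_uniq // enum_uniq.
  by rewrite size_takel // -cardE.
pose t : {ffun I -> bool} := [ffun i => i \in A].
have row1 x : (cnt x false + cnt x true = #|[pred v | w v == x]|)%N.
  rewrite -(cardID [pred v | w' v == true] [pred v | w v == x]) addnC; congr addn; apply: eq_card => v;
  by rewrite !inE xpair_eqE; case: (w' v); rewrite ?andbT ?andbF.
have col1 y : (cnt false y + cnt true y = #|[pred v | w' v == y]|)%N.
  rewrite -(cardID [pred v | w v == true] [pred v | w' v == y]) addnC; congr addn; apply: eq_card => v;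
  by rewrite !inE xpair_eqE; case: (w v); rewrite ?andbT ?andbF //= ?andTb.
have true_card x : #|[pred v | (x : config V) v == true]| = weight x.
  by rewrite weight_card cardsE; apply: eq_card => v; rewrite !inE eqb_id.
have false_card x : (#|[pred v | (x : config V) v == false]| + weight x = #|I| + #|I|)%N.
  rewrite -card_pairing weight_card cardsE addnC -(cardC x); congr addn; apply: eq_card => v.
  by rewrite !inE eqbF_neg.
have [s hs] : exists s : {perm V}, forall v, (w v, w' v) =
    ((lab (s v)).2, t (lab (s v)).1 (+) (lab (s v)).2).
  apply: (match_perm (h := fun u => ((lab u).2, t (lab u).1 (+) (lab u).2))) => -[x y].
  rewrite -/(cnt x y).
  have -> : #|[pred v | ((lab v).2, t (lab v).1 (+) (lab v).2) == (x, y)]| =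
      if x == y then (#|I| - #|A|)%N else #|A|.
    have -> : #|[pred v | ((lab v).2, t (lab v).1 (+) (lab v).2) == (x, y)]| =
        #|[pred i | t i == (x (+) y)]|.
      have inj_x : injective (fun i => unlab (i, x)) by move=> i j /(can_inj unlabK)[].
      rewrite -(card_image inj_x [pred i | t i == (x (+) y)]).
      apply: eq_card => v; rewrite !inE; apply/eqP/imageP.
        move=> [e1 e2]; exists (lab v).1; last by rewrite -e1 -surjective_pairing labK.
          by rewrite inE -e1 -e2; case: (t _); case: (_.2).
      move=> [j]; rewrite inE => /eqP ti ->; rewrite unlabK /= ti.
      by case: (x); case: (y).
    case: eqP => [->|ne].
      rewrite addbb -(cardC A) addKn; apply: eq_card => i; rewrite !inE ffunE.
      by rewrite eqbF_neg.
    have -> : x (+) y = true by case: (x) (y) ne => [] [].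
    by apply: eq_card => i; rewrite inE ffunE eqb_id.
  have := row1 true; have := row1 false; have := col1 true; have := col1 false.
  rewrite !true_card; have := false_card w; have := false_card w'.
  rewrite hw hw' hA; move: (#|[pred v | w' v == false]|)  (#|[pred v | w v == false]|) #|I|.
  case: (x); case: (y); rewrite ?eqxx /=; clearbody cnt;
  move: (cnt false false) (cnt false true) (cnt true false) (cnt true true) => c00 c01 c10 c11 *; lia.
exists s, t; split; apply/ffunP => v; have [h1 h2] := hs v; rewrite ?h1 ?h2 !ffunE //.
Qed.

Variable f : config V -> bool.
Let p s := prob K (fun b => f (cfg s b)).

(** Two independent configurations of the slice give different values of [f] with probability 2q(1 -
    q). Along a common pairing this is compared with the variance for fair bits. *)
Lemma slice_variance :
  slavg #|I| (fun w => (f w)%:R) * (1 - slavg #|I| (fun w => (f w)%:R)) <=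
  2 * pavg (fun s => p s * (1 - p s)).
Proof.
set q := slavg _ _; set D := pavg _.
pose ne w w' : K := (f w != f w')%:R.
have pE s : p s = avg (fun b => (f (cfg s b))%:R).
  by apply: eq_avg => b; rewrite asboolb.
have step w w' : weight w = #|I| -> weight w' = #|I| ->
    pavg (fun s => ne (pact s w) (pact s w')) <= 4 * D.
  move=> hw hw'; have [s0 [t [-> ->]]] := common_pairing hw hw'.
  have -> : pavg (fun s => ne (pact s (cfg s0 [ffun=> false])) (pact s (cfg s0 t))) =
      pavg (fun s => ne (cfg s [ffun=> false]) (cfg s t)).
    rewrite -[RHS](pavg_mull _ s0) /pavg; congr (_ / _); apply: eq_bigr => s _.
    by rewrite !pact_cfg.
  (* A uniform [b] can be added to the bits of both configurations, since a twist of the permutation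
     absorbs it. *)
  have eb b : pavg (fun s => ne (cfg s b) (cfg s [ffun i => b i (+) t i])) =
      pavg (fun s => ne (cfg s [ffun=> false]) (cfg s t)).
    rewrite -[RHS](pavg_mull _ (perm (@twist_inj b))) /pavg; congr (_ / _); apply: eq_bigr => s _.
    rewrite -!cfg_twist; congr (ne (cfg s _) _); apply/ffunP => i.
    by rewrite !ffunE addbF.
  rewrite -(avg_const I (pavg _)) -(eq_avg eb).
  have -> : avg (fun b => pavg (fun s => ne (cfg s b) (cfg s [ffun i => b i (+) t i]))) =
      pavg (fun s => avg (fun b => ne (cfg s b) (cfg s [ffun i => b i (+) t i]))).
    by rewrite /pavg /avg -!mulr_suml exchange_big /= mulrAC.
  rewrite /D -pavgZ; apply: ler_pavg => s.
  (* [m x] is the probability that fresh bits give a value other than [x]; it sums to 1 over two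
     different values and averages to 2p(1 - p). *)
  pose m (x : bool) : K := if x then 1 - p s else p s.
  have p01 : 0 <= p s /\ p s <= 1 by rewrite prob_ge0 prob_le1.
  have am : avg (fun b => m (f (cfg s b))) = 2 * (p s * (1 - p s)).
    have -> : avg (fun b => m (f (cfg s b))) =
        avg (fun b => p s + (1 - 2 * p s) * (f (cfg s b))%:R).
      by apply: eq_avg => b; rewrite /m; case: (f _) => /=; ring.
    by rewrite avgD avg_const (avgZ (1 - 2 * p s)) -pE; ring.
  apply: (@le_trans _ _ (avg (fun b => m (f (cfg s b)) + m (f (cfg s [ffun i => b i (+) t i]))))).
    apply: ler_avg => b; rewrite /ne /m.
    by case: (f (cfg s b)); case: (f _) => /=; lra.
  by rewrite avgD (avg_xor t (fun b => m (f (cfg s b)))) am; lra.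
pose c : K := ('C(#|V|, #|I|))%:R.
have c0 : 0 < c.
  by rewrite ltr0n bin_gt0 card_pairing leq_addr.
have sl x (F : config V -> K) : (forall w, weight w == #|I| -> F w <= x) ->
    slavg #|I| F <= x.
  move=> h; rewrite /slavg ler_pdivrMr //.
  by apply: le_trans (ler_sum _ h) _; rewrite sum_slice_const.
have e1 : slavg #|I| (fun w => slavg #|I| (fun w' => ne w w')) = 2 * (q * (1 - q)).
  have inner w : slavg #|I| (fun w' => ne w w') = q + (1 - 2 * q) * (f w)%:R.
    have -> : slavg #|I| (fun w' => ne w w') =
      slavg #|I| (fun w' => (f w)%:R * 1 + (1 - 2 * (f w)%:R) * (f w')%:R).
      rewrite /slavg; congr (_ / _); apply: eq_bigr => w' _.
      by rewrite /ne; case: (f w); case: (f w') => /=; ring.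
    rewrite /slavg big_split /= -!mulr_sumr sum_slice_const -/c /q /slavg -/c.
    by field; apply: lt0r_neq0.
  rewrite /slavg (eq_bigr _ (fun w _ => inner w)) big_split /= sum_slice_const.
  have -> : \sum_(w | weight w == #|I|) (1 - 2 * q) * (f w)%:R =
      (1 - 2 * q) * \sum_(w | weight w == #|I|) (f w)%:R by rewrite mulr_sumr.
  rewrite mulrDl -[(1 - 2 * q) * _ / _]mulrA -/(slavg #|I| (fun w => (f w)%:R)) -/q mulfK; first by ring.
  exact: lt0r_neq0.
suff : 2 * (q * (1 - q)) <= 4 * D by lra.
rewrite -e1.
have e2 s : slavg #|I| (fun w => slavg #|I| (fun w' => ne w w')) =
    slavg #|I| (fun w => slavg #|I| (fun w' => ne (pact s w) (pact s w'))).
  rewrite {1}/slavg (reindex_inj (@pact_inj s)) /=; congr (_ / _).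
  apply: eq_big => [w|w _]; first by rewrite weight_pact.
  rewrite /slavg (reindex_inj (@pact_inj s)) /=; congr (_ / _).
  by apply: eq_bigl => w'; rewrite weight_pact.
rewrite -(pavg_const (slavg _ _)).
have -> : pavg (fun=> slavg #|I| (fun w => slavg #|I| (fun w' => ne w w'))) =
   slavg #|I| (fun w => slavg #|I| (fun w' => pavg (fun s => ne (pact s w) (pact s w')))).
  transitivity (pavg (fun s => slavg #|I| (fun w => slavg #|I| (fun w' => ne (pact s w) (pact s w'))))).
    by rewrite /pavg; congr (_ / _); apply: eq_bigr => s _; apply: e2.
  by rewrite pavg_slavg; apply: eq_slavg => w; rewrite pavg_slavg.
by apply: (sl (4 * D)) => w /eqP hw; apply: sl => w' /eqP hw'; apply: step.
Qed.

End Pairing.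

End Slice.

(** * Influences, pivotals and crowded pairings *)

Section Pivotals.
Variables (K : realFieldType) (V I : finType) (lab : V -> I * bool) (unlab : I * bool -> V).
Hypothesis labK : cancel lab unlab.
Hypothesis unlabK : cancel unlab lab.
Variable A : {set config V}.
Hypothesis A_incr : forall w w', cle w w' -> w \in A -> w' \in A.

Lemma pivotal0_intro w w' v : w \notin A -> w' \in A -> ~~ w v -> cle w' (flip w v) ->
  pivotal0 A w v.
Proof.
by move=> nA wA wv /A_incr/(_ wA) fA; rewrite /pivotal0 wv (negbTE nA) fA.
Qed.

Variable s : {perm V}.
Let g b := cfg lab s b \in A.
Let vertex i c := s^-1%g (unlab (i, c)).
Let piv i b : K := (pivotal0 A (cfg lab s b) (vertex i false))%:R
                 + (pivotal0 A (cfg lab s b) (vertex i true))%:R.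

Let cfg_vertex b i c : cfg lab s b (vertex i c) = b i (+) c.
Proof. by rewrite ffunE permKV unlabK. Qed.

Let piv_ge0 i b : 0 <= piv i b.
Proof. by rewrite addr_ge0. Qed.

(** Flipping bit [i] occupies the vacant member [vertex i (b i)] and vacates the other one.
    Occupying the vacant member alone gives a larger configuration, so that member is 0-pivotal. *)
Lemma pivotal_pair b i c : g b = false -> g (upd b i c) = true -> 1 <= piv i b.
Proof.
move=> gb gb'.
have bc : b i != c by apply: contraTneq gb' => <-; rewrite upd_id gb.
have h : pivotal0 A (cfg lab s b) (vertex i (b i)).
  apply: (@pivotal0_intro _ (cfg lab s (upd b i c))); rewrite ?cfg_vertex ?addbb //.
    by move: gb; rewrite /g => ->.
  move=> u; have [e|ne] := eqVneq u (vertex i (b i)).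
    by apply/implyP => _; rewrite ffunE e eqxx cfg_vertex addbb.
  rewrite [flip _ _ _]ffunE (negbTE ne); have [e|ne'] := eqVneq u (vertex i (~~ b i)).
    by rewrite e !cfg_vertex ffunE eqxx; case: (b i) c bc {gb'} => [] [].
  rewrite !ffunE; case: eqP => [ei|_]; last exact: implybb.
  have eu : u = vertex i (lab (s u)).2.
    by rewrite /vertex -ei -surjective_pairing labK permK.
  move: ne ne'; rewrite eu; case: (lab (s u)).2; case: (b i) => /=; by rewrite ?eqxx.
rewrite /piv; case: (b i) h => ->; last by rewrite lerDl.
by rewrite lerDr.
Qed.

(** If bit [i] matters, a 0-pivotal member exists at whichever of its two values gives no event;
    summing over both values causes the factor 2. *)
Lemma influence_pivotal :
  \sum_i influence K g i <= 2 * avg (fun b => (num_pivotal0 A (cfg lab s b))%:R).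
Proof.
have e b : (num_pivotal0 A (cfg lab s b))%:R = \sum_i piv i b.
  rewrite /num_pivotal0 -sum1_card natr_sum big_mkcond /=.
  rewrite (reindex_inj (@perm_inj _ s^-1%g)) /= (sum_pairing labK unlabK (R := K)).
  by apply: eq_bigr => i _; rewrite /piv !inE -!mulrb.
have -> : avg (fun b => (num_pivotal0 A (cfg lab s b))%:R) = \sum_i avg (piv i).
  by rewrite (eq_avg e) /avg exchange_big /= mulr_suml.
rewrite mulr_sumr; apply: ler_sum => i _.
have -> : 2 * avg (piv i) = avg (fun b => piv i b + piv i (upd b i (~~ b i))).
  by rewrite avgD /avg upd_reindex; ring.
apply: ler_avg => b.
have [gb|gb] := boolP (g b); have [gb'|gb'] := boolP (g (upd b i (~~ b i))).
- by rewrite addr_ge0.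
- apply: le_trans (_ : _ <= piv i (upd b i (~~ b i))) _; last by rewrite lerDr.
  apply: (@pivotal_pair _ i (b i)); first exact: negbTE.
  by rewrite upd_upd upd_id.
- apply: le_trans (_ : _ <= piv i b) _; last by rewrite lerDl.
  by apply: (@pivotal_pair _ i (~~ b i)) => //; apply: negbTE.
- by rewrite addr_ge0.
Qed.

End Pivotals.

(** * Pairings with two pairs inside one ball *)

Section Coincidences.
Variables (K : realFieldType) (V I : finType) (lab : V -> I * bool) (unlab : I * bool -> V).
Hypothesis labK : cancel lab unlab.
Hypothesis unlabK : cancel unlab lab.
Implicit Types (s : {perm V}) (t : 4.-tuple V).

Definition paired s x y : bool := (lab (s x)).1 == (lab (s y)).1.

Definition paired2 s (l : seq V) : bool :=
  if l is [:: a; b; c; d] then paired s a b && paired s c d else false.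

Lemma paired_eq s x y z : paired s x y -> paired s x z -> x != y -> x != z -> y = z.
Proof.
rewrite /paired => /eqP xy /eqP xz nxy nxz; apply: (@perm_inj _ s); apply: (can_inj labK).
have neq u : lab (s x) <> lab (s u) -> (lab (s x)).1 = (lab (s u)).1 -> (lab (s u)).2 = ~~ (lab (s x)).2.
  by case: (lab (s x)) (lab (s u)) => i c [j d] /= ne e; case: c d ne => [] [] // []; rewrite e.
have inj u : x != u -> lab (s x) <> lab (s u).
  by move=> ne /(can_inj labK) /perm_inj e; rewrite e eqxx in ne.
rewrite [LHS]surjective_pairing [RHS]surjective_pairing -xy -xz.
by rewrite (neq y (inj _ nxy) xy) (neq z (inj _ nxz) xz).
Qed.

Definition crowded (B : V -> {set V}) s : bool :=
  [exists v, exists t : 4.-tuple V, [&& all [in B v] t, uniq t & paired2 s t]].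

(** At most one pair lies inside [B v]: one of its members serves as [z], and [x0] is the default
    when there is none. *)
Lemma not_crowded B s v (x0 : V) : ~~ crowded B s -> exists z : V, forall x y,
  x \in B v -> y \in B v -> paired s x y -> x = y \/ x = z \/ y = z.
Proof.
move=> nc; have [[x [y [xB yB xy pxy]]]|none] :=
  pselect (exists x y, [/\ x \in B v, y \in B v, x != y & paired s x y]); last first.
  exists x0 => x y xB yB pxy; left; apply/eqP; apply: contraT => ne.
  by case: none; exists x, y.
exists x => x' y' xB' yB' pxy'.
have [->|nx'] := eqVneq x' x; first by right; left.
have [->|ny'] := eqVneq y' x; first by right; right.
have [->|nxy'] := eqVneq x' y'; first by left.
have sym a b : paired s a b -> paired s b a by rewrite /paired eq_sym.
have nyx' : y != x'.
  apply: contraNneq ny' => e; rewrite e in xy pxy.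
  by apply/eqP; apply: (paired_eq pxy' (sym _ _ pxy)); rewrite // eq_sym.
have nyy' : y != y'.
  apply: contraNneq nx' => e; rewrite e in xy pxy.
  by apply/eqP; apply: (paired_eq (sym _ _ pxy') (sym _ _ pxy)); rewrite // eq_sym.
exfalso; case/negP: nc; apply/existsP; exists v; apply/existsP.
exists [tuple x; y; x'; y']; rewrite /= xB yB xB' yB' pxy pxy' /= !inE !negb_or.
by rewrite xy nxy' nyx' nyy' [x == x']eq_sym nx' [x == y']eq_sym ny'.
Qed.

Lemma pavg_mulr (F : {perm V} -> K) (p : {perm V}) : pavg (fun s => F (p * s)%g) = pavg F.
Proof. by rewrite /pavg [in RHS](reindex_inj (mulgI p)). Qed.

Let n := #|V|.

(** By symmetry all 4-tuples of distinct vertices are equally likely to form two pairs; for a fixed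
    pairing at most n^2 of them do, since the first and third entries determine the others. *)
Lemma pavg_paired2 (l : seq V) : uniq l -> size l = 4%N ->
  pavg (fun s => (paired2 s l)%:R) * (n ^_ 4)%:R <= (n ^ 2)%:R :> K.
Proof.
move=> ul sl; pose X := [set t : 4.-tuple V | all [in [set: V]] t & uniq t].
have eX : (n ^_ 4)%:R = \sum_(t in X) 1 :> K.
  by rewrite sumr_const card_uniq_tuples cardsT.
have inv t : t \in X -> pavg (fun s => (paired2 s l)%:R) = pavg (fun s => (paired2 s t)%:R) :> K.
  rewrite inE => /andP[_ ut]; have [p pl] := uniq_perm_map ul ut (etrans sl (esym (size_tuple t))).
  rewrite -(pavg_mulr _ p) -pl; rewrite /pavg; congr (_ / _); apply: eq_bigr => s _.
  by case: (l) => [|a [|b [|c [|d [|e l']]]]] //=; rewrite /paired !permM.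
rewrite eX mulr_sumr (eq_bigr (fun t => pavg (fun s => (paired2 s t)%:R))); last first.
  by move=> t /inv <-; rewrite mulr1.
have -> : \sum_(t in X) pavg (fun s => (paired2 s t)%:R) =
    pavg (fun s => \sum_(t in X) (paired2 s t)%:R) :> K.
  by rewrite /pavg exchange_big /= -mulr_suml.
rewrite -[X in _ <= X](pavg_const V); apply: ler_pavg => s.
have -> : \sum_(t in X) (paired2 s t)%:R = #|[set t in X | paired2 s t]|%:R :> K.
  rewrite -sum1_card natr_sum big_mkcond [RHS]big_mkcond /=; apply: eq_bigr => t _.
  by rewrite !inE; case: (_ && _); case: paired2.
rewrite ler_nat -mulnn -card_prod -(card_in_imset (f := fun t : 4.-tuple V => (tnth t ord0, tnth t (inord 2)))).
  exact: max_card.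
move=> [[|a [|b [|c [|d [|? ?]]]]] //= st] [[|a' [|b' [|c' [|d' [|? ?]]]]] //= st'].
rewrite !inE /= => /andP[/andP[_ u] /andP[ab cd]] /andP[/andP[_ u'] /andP[ab' cd']].
rewrite !(tnth_nth a) /= !inordK //= => -[ea ec]; apply: val_inj => /=.
move: u u'; rewrite /= !inE !negb_or => /and4P[/and3P[n1 _ _] _ n2 _] /and4P[/and3P[n1' _ _] _ n2' _].
subst a' c'; congr [:: _; _; _; _]; first exact: paired_eq ab ab' n1 n1'.
exact: paired_eq cd cd' n2 n2'.
Qed.

Lemma pavg_sum (J : finType) (P : pred J) (F : J -> {perm V} -> K) :
  pavg (fun s => \sum_(j | P j) F j s) = \sum_(j | P j) pavg (F j).
Proof. by rewrite /pavg exchange_big /= mulr_suml. Qed.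

Lemma pavg_crowded (B : V -> {set V}) m : (forall v, (#|B v| <= m)%N) ->
  pavg (fun s => (crowded B s)%:R) * (n ^_ 4)%:R <= (n * m ^ 4 * n ^ 2)%:R :> K.
Proof.
move=> hB; pose X v := [set t : 4.-tuple V | all [in B v] t & uniq t].
apply: (@le_trans _ _ (pavg (fun s => \sum_v \sum_(t in X v) (paired2 s t)%:R) * (n ^_ 4)%:R)).
  rewrite ler_wpM2r //; apply: ler_pavg => s; case: (boolP (crowded B s)) => [|_]; last first.
    by apply: sumr_ge0 => v _; apply: sumr_ge0.
  move=> /existsP[v /existsP[t /and3P[tB ut pt]]].
  rewrite (bigD1 v) //= (bigD1 t) /=; last by rewrite inE tB.
  by rewrite pt -addrA lerDl addr_ge0 // sumr_ge0 // => ? _; apply: sumr_ge0.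
rewrite pavg_sum mulr_suml.
apply: (@le_trans _ _ (\sum_(v : V) (m ^ 4 * n ^ 2)%:R)); last first.
  by rewrite sumr_const -mulrnA ler_nat [(_ * #|_|)%N]mulnC mulnA.
apply: ler_sum => v _; rewrite pavg_sum mulr_suml.
apply: (@le_trans _ _ (\sum_(t in X v) (n ^ 2)%:R)).
  apply: ler_sum => t; rewrite inE => /andP[_ ut]; apply: pavg_paired2 => //.
  exact: size_tuple.
rewrite sumr_const -mulrnA ler_nat [(_ * #|_|)%N]mulnC leq_mul2r; apply/orP; right.
rewrite card_uniq_tuples; apply: (@leq_trans (#|B v| ^ 4)); last by rewrite leq_exp2r.
move: #|B v| => c.
by rewrite !ffactnS ffactn0 !expnS expn0; do 4 (apply: leq_mul; first by lia).
Qed.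

End Coincidences.

(** * Exploring the clusters of a column *)

Definition xcross (r : Z) (S : pt -> Prop) : Prop :=
  exists a b, [/\ pconn S a b, a.1 = 0%Z & b.1 = r].

Section Exploration.
Variables (V I : finType) (lab : V -> I * bool) (pos : V -> pt) (s : {perm V}) (r k : Z).
Hypothesis k_range : (0 <= k <= r)%Z.
Implicit Types (Kn : {set I}) (b w : {ffun I -> bool}).

Definition label v : I := (lab (s v)).1.

Definition known_occ Kn b (z : pt) : Prop :=
  exists v, [/\ pos v = z, label v \in Kn & cfg lab s b v].

Definition touches (S : pt -> Prop) v : Prop :=
  (pos v).1 = k \/ exists c z, [/\ c.1 = k, pconn S c z & pt_adj z (pos v)].

Definition wanted Kn b : pred I :=
  [pred i | (i \notin Kn) && `[< exists v, label v = i /\ touches (known_occ Kn b) v >]].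

(** [b] records the answers received on [Kn], and [fuel] bounds the number of further queries;
    [#|I|] suffices because no pair is queried twice. *)
Fixpoint explore (fuel : nat) Kn b : dtree I :=
  let stop := Leaf I `[< xcross r (known_occ Kn b) >] in
  if fuel is fuel'.+1 then
    if [pick i | wanted Kn b i] is Some i then
      Node i (explore fuel' (i |: Kn) (upd b i false)) (explore fuel' (i |: Kn) (upd b i true))
    else stop
  else stop.

Definition agree Kn b w : Prop := forall i, i \in Kn -> b i = w i.

Lemma explore_vars f Kn b i : i \in dvars (explore f Kn b) -> i \notin Kn.
Proof.
elim: f Kn b => //= f IH Kn b; case: pickP => [j /andP[jK _]|_] //=.
rewrite in_cons mem_cat => /orP[/eqP -> //|/orP[]] /IH;
by rewrite in_setU1 negb_or => /andP[].
Qed.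

Lemma explore_fresh f Kn b : dfresh (explore f Kn b).
Proof.
elim: f Kn b => //= f IH Kn b; case: pickP => [j _|_] //=.
rewrite !IH !andbT; apply/andP; split; apply/negP => /explore_vars;
by rewrite setU11.
Qed.

Lemma agree_upd Kn b w i : agree Kn b w -> agree (i |: Kn) (upd b i (w i)) w.
Proof.
move=> h j; rewrite in_setU1 ffunE; case: eqP => [-> //|_ /=]; exact: h.
Qed.

Lemma known_occ_sub Kn b w z : agree Kn b w -> known_occ Kn b z -> occ pos (cfg lab s w) z.
Proof.
move=> h [v [pv lK bv]]; exists v; split=> //; move: bv; rewrite !ffunE.
by rewrite -/(label v) (h _ lK).
Qed.

Lemma occ_known Kn b w v : agree Kn b w -> label v \in Kn -> cfg lab s w v -> known_occ Kn b (pos v).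
Proof.
move=> h lK wv; exists v; split=> //; move: wv; rewrite !ffunE.
by rewrite -/(label v) (h _ lK).
Qed.

(* Every crossing meets column k, so once no vertex is wanted any more its whole cluster is known. *)
Lemma stop_correct Kn b w : agree Kn b w ->
  (forall v, label v \notin Kn -> ~ touches (known_occ Kn b) v) ->
  xcross r (known_occ Kn b) <-> xcross r (occ pos (cfg lab s w)).
Proof.
move=> ag stop; split=> [[a [c [ac ha hc]]]|[a [c [ac ha hc]]]].
  by exists a, c; split=> //; apply: conn_mono ac => z; apply: known_occ_sub.
have [||u [v [_ au hu _]]] := conn_crossing (@lip_fst _) (Z.le_refl k) ac; [lia|lia|].
set S := occ pos (cfg lab s w) in ac au.
have closed z z' : S z' -> known_occ Kn b z -> pconn (known_occ Kn b) u z -> pt_adj z z' ->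
    known_occ Kn b z'.
  move=> [v' [<- wv']] kz uz zz'; apply: (occ_known ag) wv'.
  apply: contraT => lv; exfalso; apply: (stop _ lv); right; exists u, z.
  by split.
have ku : known_occ Kn b u.
  have [v' [pv' wv']] := conn_end au; rewrite -pv'; apply: (occ_known ag) wv'.
  by apply: contraT => lv; exfalso; apply: (stop _ lv); left; rewrite pv'.
have grow z : pconn S u z -> pconn (known_occ Kn b) u z.
  move=> uz; have : pconn (fun z => S z /\ pconn (known_occ Kn b) u z) u z.
    apply: conn_inv uz _; last exact: conn0.
    move=> x y Sx Sy xy ux; apply: conn_trans (ux) _; apply: conn1 (xy); first exact: conn_end ux.
    by apply: closed (ux) xy => //; apply: conn_end ux.
  by move=> h; have [_ h2] := conn_end h.
exists a, c; split=> //; apply: (@conn_trans _ _ _ _ u).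
  by apply: pconn_sym; apply: grow; apply: pconn_sym.
by apply: grow; apply: conn_trans ac; apply: pconn_sym.
Qed.

Lemma explore_eval f Kn b w : agree Kn b w -> (#|~: Kn| <= f)%N ->
  deval (explore f Kn b) w = `[< xcross r (occ pos (cfg lab s w)) >].
Proof.
elim: f Kn b => [|f IH] Kn b ag le /=.
  apply: asbool_equiv_eq; apply: stop_correct => // v lv.
  have : label v \in ~: Kn by rewrite inE.
  by move: le; rewrite leqn0 cards_eq0 => /eqP ->; rewrite inE.
case: pickP => [i /andP[iK _]|none] /=.
  have le' : (#|~: (i |: Kn)| <= f)%N.
    by rewrite setCU setIC -setDE; move: le; rewrite (cardsD1 i) inE iK setDE => le.
  have := agree_upd (i := i) ag; case: (w i) => ag'; exact: IH.
apply: asbool_equiv_eq; apply: stop_correct => // v lv tv.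
by have := none (label v); rewrite /wanted /= lv /=; case: asboolP => // -[]; exists v.
Qed.

Lemma touches_mono (S S' : pt -> Prop) v : (forall z, S z -> S' z) -> touches S v -> touches S' v.
Proof.
move=> sub [h|[c [z [hc cz zv]]]]; [by left|right; exists c, z; split=> //].
exact: conn_mono cz.
Qed.

Lemma explore_query f Kn b w i : agree Kn b w -> dquery (explore f Kn b) w i ->
  exists v, label v = i /\ touches (occ pos (cfg lab s w)) v.
Proof.
elim: f Kn b => //= f IH Kn b ag; case: pickP => [j /andP[jK /asboolP[v [lv tv]]]|_] //=.
case/orP => [/eqP ->|].
  by exists v; split=> //; apply: touches_mono tv => z; apply: known_occ_sub.
have := agree_upd (i := j) ag; case: (w j) => ag'; exact: IH ag'.
Qed.

Definition column_tree : dtree I := explore #|I| set0 [ffun=> false].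

Lemma column_tree_eval w : deval column_tree w = `[< xcross r (occ pos (cfg lab s w)) >].
Proof. by apply: explore_eval => [i|]; rewrite ?inE // setC0 cardsT. Qed.

Lemma column_tree_query w i : dquery column_tree w i ->
  exists v, label v = i /\ touches (occ pos (cfg lab s w)) v.
Proof. by apply: explore_query => j; rewrite inE. Qed.

End Exploration.

Definition ptB (u v : pt) : pt := (u.1 - v.1, u.2 - v.2)%Z.

Lemma hnorm_coord z (n : Z) : (hnorm z <= n)%Z -> (- n <= z.1 <= n)%Z /\ (- n <= z.2 <= n)%Z.
Proof. by rewrite /hnorm; lia. Qed.

Lemma card_hnorm_ball (V : finType) (pos : V -> pt) (c : pt) (n : nat) : injective pos ->
  (#|[set u | `[< (hnorm (ptB (pos u) c) <= Z.of_nat n)%Z >]]| <= (2 * n + 1) ^ 2)%N.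
Proof.
move=> pos_inj; pose X : finType := ('I_(2 * n).+1 * 'I_(2 * n).+1)%type.
have eX : #|X| = ((2 * n + 1) ^ 2)%N by rewrite card_prod card_ord mulnn addn1.
have small (x : Z) : (- Z.of_nat n <= x <= Z.of_nat n)%Z -> (Z.to_nat (x + Z.of_nat n) < (2 * n).+1)%N.
  by lia.
have to_nat_inj (x y : Z) : (- Z.of_nat n <= x <= Z.of_nat n)%Z -> (- Z.of_nat n <= y <= Z.of_nat n)%Z ->
    Z.to_nat (x + Z.of_nat n) = Z.to_nat (y + Z.of_nat n) -> x = y by lia.
rewrite -eX; pose h (u : V) : X :=
  (inord (Z.to_nat ((ptB (pos u) c).1 + Z.of_nat n)), inord (Z.to_nat ((ptB (pos u) c).2 + Z.of_nat n))).
rewrite -(card_in_imset (f := h)); first exact: max_card.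
move=> u u'; rewrite !inE => /asboolP/hnorm_coord[x1 x2] /asboolP/hnorm_coord[y1 y2].
move=> [] /(congr1 val) e1 /(congr1 val) e2; move: e1 e2.
rewrite [LHS]inordK ?[RHS]inordK; [|exact: small..]; move/(to_nat_inj _ _ x1 y1) => e1.
rewrite [LHS]inordK ?[RHS]inordK; [|exact: small..]; move/(to_nat_inj _ _ x2 y2) => e2.
clear x1 x2 y1 y2 to_nat_inj small; move: e1 e2; rewrite /ptB; cbn [fst snd] => e1 e2; apply: pos_inj.
rewrite [LHS]surjective_pairing [RHS]surjective_pairing; congr pair; lia.
Qed.

(** * Revealment bounds from the one-arm estimate *)

Section Revealment.
Variables (K : realFieldType) (V I : finType) (lab : V -> I * bool) (unlab : I * bool -> V).
Hypothesis labK : cancel lab unlab.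
Variables (pos : V -> pt) (s : {perm V}) (J : nat).
Hypothesis pos_inj : injective pos.
Let L := Z.of_nat (scale J).

Definition ball v : {set V} := [set u | `[< (hnorm (ptB (pos u) (pos v)) <= L)%Z >]].

(** The cluster joins a neighbour of [v] to column [k], which lies outside the ball of radius [L],
    so it crosses every annulus around [v] up to that radius. *)
Lemma touches_arms k (S : pt -> Prop) v : (L < Z.abs ((pos v).1 - k))%Z -> touches pos k S v ->
  arms J (fun z => hnorm z <= L /\ S (z.1 + (pos v).1, z.2 + (pos v).2))%Z.
Proof.
move=> far [e|[c [z [hc cz zv]]]]; first by move: far; have := scale_ge2 J; rewrite /L; lia.
move=> j jJ; set m := Z.of_nat (scale j).
have m2 : (2 <= m)%Z by have := scale_ge2 j; rewrite /m; lia.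
have mL : (6 * m <= L)%Z by have := leq_scale jJ; rewrite scaleS /m /L; lia.
pose S' z := S (z.1 + (pos v).1, z.2 + (pos v).2)%Z.
have cz' : pconn S' (ptB z (pos v)) (ptB c (pos v)).
  apply: (conn_map (h := fun z => ptB z (pos v))) (pconn_sym cz) => [x Sx|x y _ _]; last first.
    by rewrite /pt_adj /ptB; cbn [fst snd]; lia.
  rewrite /S' /ptB; cbn [fst snd]; rewrite !Z.sub_add; by case: x Sx.
have m16 : (m + 1 <= 6 * m)%Z by lia.
have [||a [b [ab _ ha hb]]] := conn_crossing (@lip_hnorm S') m16 cz'.
- by move: zv; rewrite /pt_adj /hnorm /ptB; cbn [fst snd]; lia.
- by move: far hc; rewrite /hnorm /ptB; cbn [fst snd]; lia.
exists a, b; split=> //; apply: conn_mono ab => x [Sx hx].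
by split; [split=> //; lia|lia].
Qed.

Lemma prob_touches k v : ~~ crowded lab ball s -> (L < Z.abs ((pos v).1 - k))%Z ->
  prob K (fun w => touches pos k (occ pos (cfg lab s w)) v) <= 2 * arm_const K ^+ J.
Proof.
move=> nc far.
have [x hx] := not_crowded labK v v nc.
pose S : finType := {u : V | u \in ball v}.
have vB : v \in ball v.
  by rewrite inE; apply/asboolP; rewrite /hnorm /ptB /L; cbn [fst snd]; lia.
pose p (u : S) := ptB (pos (val u)) (pos v).
have ip : injective p.
  move=> u u' e; apply: val_inj; apply: pos_inj.
  have := congr1 snd e; have := congr1 fst e; rewrite /p /ptB; cbn [fst snd] => e1 e2.
  by rewrite [LHS]surjective_pairing [RHS]surjective_pairing; congr pair; lia.
pose e (u : S) := (lab (s (val u))).1.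
(* The vertex whose label may coincide with another one; [v] is the default if it lies outside the
   ball. *)
pose x' : S := insubd (exist _ v vB) x.
have he u u' : e u = e u' -> u = u' \/ u = x' \/ u' = x'.
  move=> /eqP euu.
  have lift (y : S) : val y = x -> y = x'.
    by move=> yx; apply: val_inj; rewrite /x' insubdK // -yx; apply: valP.
  case: (hx (val u) (val u') (valP u) (valP u') euu) => [/val_inj|[/lift|/lift]]; tauto.
apply: le_trans (prob_arms_labels K (fun u : S => (lab (s (val u))).2) J ip he).
apply: prob_le => w /(touches_arms far); apply: arms_mono => z [hz [u [pu wu]]].
have uB : u \in ball v.
  rewrite inE; apply/asboolP; rewrite /ptB pu; cbn [fst snd].
  by rewrite !Z.add_simpl_r; case: (z) hz.
exists (exist _ u uB); split; last by move: wu; rewrite !ffunE.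
by rewrite /p /ptB /= pu; cbn [fst snd]; rewrite !Z.add_simpl_r; case: (z).
Qed.

Lemma card_ball v : (#|ball v| <= (2 * scale J + 1) ^ 2)%N.
Proof. exact: card_hnorm_ball. Qed.

End Revealment.

(** * The box *)

Lemma cos_pi3 (K : realType) : cos (pi / 3) = 2^-1 :> K.
Proof.
set x : K := pi / 3.
have c0 : 0 < cos x by apply: cos_gt0_pihalf; have := pi_gt0 K; rewrite /x; lra.
have e : cos (x *+ 2 + x) = -1 by rewrite -mulrSr -cospi /x; congr cos; rewrite -[_ *+ 3]mulr_natr; field.
(* The triple angle formula for cos(pi) = -1 reads 4c^3 - 3c + 1 = 0, which factors in this way. *)
have e2 : (cos x + 1) * (2 * cos x - 1) ^+ 2 = 0.
  have -> : (cos x + 1) * (2 * cos x - 1) ^+ 2 =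
      (2 * cos x ^+ 2 - 1) * cos x - 2 * cos x * (1 - cos x ^+ 2) + 1 by ring.
  by rewrite -sin2cos2; move: e; rewrite cosD cos_mulr2n sin_mulr2n => e; lra.
move/eqP: e2; rewrite mulf_eq0 expf_eq0 /= => /orP[/eqP|/eqP]; lra.
Qed.

Lemma sin2_pi3 (K : realType) : sin (pi / 3) ^+ 2 = 3 / 4 :> K.
Proof. by rewrite sin2cos2 cos_pi3; field. Qed.

Definition bpos R (v : box R) : pt := (Z.of_nat v.1, - Z.of_nat v.2)%Z.

Lemma bpos_inj R : injective (@bpos R).
Proof. by move=> [a b] [c d] [/= h1 h2]; congr pair; apply: val_inj => /=; lia. Qed.

(** The squared distance is the integer a^2 + ab + b^2 in the coordinate differences, equal to 1
    exactly at the six neighbours. *)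
Lemma box_adjE (K : realType) R (v w : box R) : box_adj K v w <-> pt_adj (bpos v) (bpos w).
Proof.
rewrite /box_adj; set z := _ - _.
pose a : int := (v.1 : int) - (w.1 : int); pose b : int := (v.2 : int) - (w.2 : int).
have natC (n : nat) : (n%:R : K[i]) = (n%:R +i* 0)%C by rewrite -(rmorph_nat (real_complex K)).
have reZ : complex.Re z = a%:~R + b%:~R / 2.
  rewrite /z /box_pos /expi !natC cos_pi3 /= /a /b !rmorphB /= -!pmulrn; ring.
have imZ : complex.Im z = b%:~R * sin (pi / 3).
  rewrite /z /box_pos /expi !natC /= /b !rmorphB /= -!pmulrn; ring.
have -> : (`|z| == 1) = (a * a + a * b + b * b == 1).
  have e : complex.Re z ^+ 2 + complex.Im z ^+ 2 = (a * a + a * b + b * b)%:~R.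
    by clearbody a b; rewrite reZ imZ exprMn sin2_pi3 !rmorphD !rmorphM /=; field.
  rewrite normc_def e -[X in _ == X](rmorph1 (real_complex K)) (inj_eq (@complexI _)).
  have nn : 0 <= ((a * a + a * b + b * b)%:~R : K) by rewrite -e addr_ge0 // sqr_ge0.
  by rewrite -[X in _ == X]sqrtr1 eqr_sqrt // -[1]/(1%:~R) eqr_int.
rewrite /pt_adj /bpos; cbn [fst snd]; rewrite /a /b.
move: (nat_of_ord v.1) (nat_of_ord v.2) (nat_of_ord w.1) (nat_of_ord w.2) => x y x' y'.
clear z a b reZ imZ natC.
split; last first.
  move=> h.
  have : (x%:Z - x'%:Z = 1 /\ y%:Z - y'%:Z = 0) \/ (x%:Z - x'%:Z = -1 /\ y%:Z - y'%:Z = 0) \/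
    (x%:Z - x'%:Z = 0 /\ y%:Z - y'%:Z = 1) \/ (x%:Z - x'%:Z = 0 /\ y%:Z - y'%:Z = -1) \/
    (x%:Z - x'%:Z = 1 /\ y%:Z - y'%:Z = -1) \/ (x%:Z - x'%:Z = -1 /\ y%:Z - y'%:Z = 1) by lia.
  by case=> [[-> ->]|[[-> ->]|[[-> ->]|[[-> ->]|[[-> ->]|[-> ->]]]]]].
move/eqP; set a := (_ - _)%R; set b := (_ - _)%R => h.
have : (-1 <= a <= 1 /\ -1 <= b <= 1 /\ -1 <= a + b <= 1)%R by nia.
by have : (a <> 0 \/ b <> 0)%R by [nia|]; rewrite /a /b; lia.
Qed.

Section Box.
Variables (K : realType) (R : nat).
Hypothesis R0 : (0 < R)%N.
Let M := (Z.of_nat R - 1)%Z.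
Implicit Types w : config (box R).

Lemma bpos_range (v : box R) : (0 <= (bpos v).1 <= M /\ - M <= (bpos v).2 <= 0)%Z.
Proof. by case: v => [[x hx] [y hy]]; rewrite /bpos /M /=; lia. Qed.

Lemma bpos_surj z : (0 <= z.1 <= M /\ - M <= z.2 <= 0)%Z -> exists v : box R, bpos v = z.
Proof.
case: z => x y /=; rewrite /M => h.
have hx : (Z.to_nat x < R)%N by lia.
have hy : (Z.to_nat (- y) < R)%N by lia.
exists (Ordinal hx, Ordinal hy); rewrite /bpos /=; congr pair; lia.
Qed.

Lemma crossingP w : w \in crossing K R <-> xcross M (occ (@bpos R) w).
Proof.
rewrite inE; split=> [/asboolP[v [p [pth /andP[wv wp] v0 vl]]]|[a [b [ab ha hb]]]].
  exists (bpos v), (bpos (last v p)); split; rewrite /= ?v0 ?vl /M; [|lia|lia].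
  elim: p v {v0 vl} pth wv wp => [|u p IH] v /=; first by move=> _ wv _; apply: conn0; exists v.
  move=> /andP[vu pth] wv /andP[wu wp]; apply: (@connS _ _ _ _ (bpos u)).
  - by exists v.
  - exact/box_adjE/vu.
  - exact: IH.
have {ab} [v [p [pv pl pth al]]] : exists v p, [/\ bpos v = a, bpos (last v p) = b,
    path (@box_adj K R) v p & all (fun u => w u) (v :: p)].
  elim: ab {ha hb} => [z [v [<- wv]]|z z1 z2 [v [<- wv]] vz _ [u [p [pu pl pth al]]]].
    by exists v, [::]; split=> //=; rewrite wv.
  exists v, (u :: p); split=> //=; last by rewrite wv.
  by rewrite pth andbT; apply/box_adjE; rewrite pu.
apply/asboolP; exists v, p; split=> //; first by move: ha; rewrite -pv /=; lia.
by move: hb; rewrite -pl /= /M; lia.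
Qed.

Lemma crossing_incr w w' : cle w w' -> w \in crossing K R -> w' \in crossing K R.
Proof.
move=> le /crossingP[a [b [ab ha hb]]]; apply/crossingP; exists a, b; split=> //.
by apply: conn_mono ab => z [v [<- wv]]; exists v; split=> //; apply: (implyP (le v)).
Qed.

Definition dual w : config (box R) := [ffun v => ~~ w (v.2, v.1)].

Lemma dualK : involutive dual.
Proof. by move=> w; apply/ffunP => -[x y]; rewrite !ffunE negbK. Qed.

Lemma weight_dual w : (weight (dual w) + weight w = #|box R|)%N.
Proof.
have swK : involutive (fun v : box R => (v.2, v.1)) by case.
rewrite /weight (reindex_inj (inv_inj swK)) /= -big_split /= -sum1_card; apply: eq_bigr => -[x y] _.
by rewrite ffunE /=; case: (w _).
Qed.

(** Exchanging the coordinates turns a vacant vertical crossing of [w] into an occupied horizontal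
    one of [dual w]; Hex gives exactly one of the two crossings of [w]. *)
Lemma crossing_dual w : (dual w \in crossing K R) = (w \notin crossing K R).
Proof.
have M0 : (0 <= M)%Z by rewrite /M; lia.
pose S (z : pt) := occ (@bpos R) w (z.1, z.2 - M)%Z.
apply/idP/idP => [/crossingP[c [d [cd hc hd]]]|].
  apply/negP => /crossingP[a [b [ab ha hb]]].
  pose S' (z : pt) := exists v : box R, bpos v = (z.1, z.2 - M)%Z /\ ~~ w v.
  pose h (z : pt) : pt := (z.1, z.2 + M)%Z.
  pose g (z : pt) : pt := (- z.2, M - z.1)%Z.
  apply: (@hex_disjoint M S S' (h a) (h b) (g d) (g c)) => //.
  - move=> z _ [v [pv wv]] [v' [pv' /negP]]; apply; suff -> : v' = v by [].
    by apply: bpos_inj; rewrite pv.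
  - apply: (conn_map (h := h)) ab => [z [v [<- wv]]|x y _ _]; last by rewrite /pt_adj /h; cbn [fst snd]; lia.
    split; first by have := bpos_range v; rewrite /sq /h; cbn [fst snd]; lia.
    exists v; split=> //; rewrite /h; cbn [fst snd].
    by rewrite Z.add_simpl_r -surjective_pairing.
  - apply: (conn_map (h := g)) (pconn_sym cd) => [z [v [<- wv]]|x y _ _]; last by rewrite /pt_adj /g; cbn [fst snd]; lia.
    split; first by have := bpos_range v; rewrite /sq /g; cbn [fst snd]; lia.
    exists (v.2, v.1); split; last by move: wv; rewrite ffunE.
    by rewrite /g /bpos; cbn [fst snd]; congr pair; lia.
  - by rewrite /g hd; cbn [fst snd]; lia.
  - by rewrite /g hc; cbn [fst snd]; lia.
move=> nw; apply/crossingP; case: (hex_exists S M0) => [[a [b [ab ha hb]]]|[c [d [cd hc hd]]]].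
  case/negP: nw; apply/crossingP; exists (a.1, a.2 - M)%Z, (b.1, b.2 - M)%Z; split=> //.
  apply: (conn_map (h := fun z : pt => (z.1, z.2 - M)%Z)) ab => [z [_ //]|x y _ _].
  by rewrite /pt_adj; cbn [fst snd]; lia.
pose g (z : pt) : pt := (M - z.2, - z.1)%Z.
exists (g d), (g c); split; [|by rewrite /g hd; cbn [fst snd]; lia|by rewrite /g hc; cbn [fst snd]; lia].
apply: (conn_map (h := g)) (pconn_sym cd) => [z [qz Sz]|x y _ _]; last by rewrite /pt_adj /g; cbn [fst snd]; lia.
have [|v pv] := @bpos_surj (z.1, z.2 - M)%Z; first by move: qz; rewrite /sq; cbn [fst snd]; lia.
exists (v.2, v.1); split.
  move: pv; rewrite /g /bpos; cbn [fst snd] => -[h1 h2]; rewrite -h1; congr pair.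
  by rewrite (_ : z.2 = - Z.of_nat v.2 + M)%Z; [lia|rewrite h2; lia].
rewrite ffunE /= -surjective_pairing; apply/negP => wv; apply: Sz; exists v.
by split.
Qed.

(** At half filling [dual] maps the slice to itself and exchanges crossing with non-crossing. *)
Lemma slavg_crossing n : #|box R| = (n + n)%N ->
  slavg n (fun w => (w \in crossing K R)%:R) = 1 / 2 :> K.
Proof.
move=> e; rewrite /slavg; set X := \sum_(w | _) _.
have eX : X = \sum_(w : config (box R) | weight w == n) (1 - (w \in crossing K R)%:R).
  rewrite /X (reindex_inj (inv_inj dualK)) /=; apply: eq_big => w.
    by have := weight_dual w; rewrite e => h; apply/eqP/eqP; lia.
  by rewrite crossing_dual => _; case: (_ \in _) => /=; rewrite ?subrr ?subr0.
move: eX; rewrite sumrB sum_slice_const mul1r -/X => eX.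
have c0 : 0 < ('C(#|box R|, n)%:R : K) by rewrite ltr0n bin_gt0 e leq_addr.
have -> : X = 'C(#|box R|, n)%:R / 2 by lra.
by field; apply: lt0r_neq0.
Qed.

End Box.

Lemma labelling (V W : finType) : #|V| = #|W| ->
  exists (f : V -> W) (g : W -> V), cancel f g /\ cancel g f.
Proof.
move=> e; exists (fun v => enum_val (cast_ord e (enum_rank v))),
  (fun x => enum_val (cast_ord (esym e) (enum_rank x))); split=> x;
by rewrite enum_valK ?cast_ordK ?cast_ordKV enum_rankK.
Qed.

Lemma expect_fixedE (K : realType) (V : finType) n (X : config V -> K) :
  expect_fixed n X = slavg n X.
Proof.
rewrite /expect_fixed /slavg mulr_suml [RHS]big_mkcond; apply: eq_bigr => w _.
by rewrite /prob_fixed -/(weight w); case: eqP => _; rewrite ?mul0r // mulrC.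
Qed.

(** * Lower bounds on the expected number of pivotals *)

Section Assembly.
Variables (K : realType) (R n : nat).
Hypothesis R0 : (0 < R)%N.
Hypothesis card_box : #|box R| = (n + n)%N.
Variables (lab : box R -> 'I_n * bool) (unlab : 'I_n * bool -> box R).
Hypothesis labK : cancel lab unlab.
Hypothesis unlabK : cancel unlab lab.
Implicit Types (s : {perm box R}) (b : {ffun 'I_n -> bool}).

Let A := crossing K R.
Let g s b := cfg lab s b \in A.
Let p s := prob K (fun b => g s b).
Let N0 s : K := avg (fun b => (num_pivotal0 A (cfg lab s b))%:R).
Let EN : K := slavg n (fun w => (num_pivotal0 A w)%:R).
Let tree s (k : 'I_R) := column_tree lab (@bpos R) s (Z.of_nat R - 1) (Z.of_nat k).

Let EN_pavg : EN = pavg N0.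
Proof. by have := pavg_cfg labK unlabK (fun w => (num_pivotal0 A w)%:R : K); rewrite card_ord => h; rewrite /EN -h. Qed.

Let variance : 1 / 8 <= pavg (fun s => p s * (1 - p s)).
Proof.
have := slice_variance K labK unlabK (fun w => w \in A).
by rewrite card_ord slavg_crossing // -/(p _); rewrite /p /g; lra.
Qed.

Let treeE s k : deval (tree s k) = g s.
Proof.
apply/funext => b; rewrite column_tree_eval; last by have := ltn_ord k; lia.
by apply/asboolP/idP => /(crossingP K R0).
Qed.

Let p_osss s k : p s * (1 - p s) <= 4^-1 * \sum_i reveal K (tree s k) i * influence K (g s) i.
Proof.
have := osss K (explore_fresh lab (@bpos R) s (Z.of_nat R - 1) (Z.of_nat k) #|'I_n| set0 [ffun=> false]).
by rewrite -/(tree s k) treeE.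
Qed.

Let influence_N0 s : \sum_i influence K (g s) i <= 2 * N0 s.
Proof. by apply: (influence_pivotal K labK unlabK) => w w'; apply: crossing_incr. Qed.

(** Revealments are at most 1. This covers the small boxes, where no scale is available. *)
Lemma expected_pivotals_trivial : 1 / 4 <= EN.
Proof.
have h s : p s * (1 - p s) <= 1 / 2 * N0 s.
  apply: le_trans (p_osss s (Ordinal R0)) _; have := influence_N0 s.
  have : \sum_i reveal K (tree s (Ordinal R0)) i * influence K (g s) i <= \sum_i influence K (g s) i.
    apply: ler_sum => i _; rewrite ler_piMl ?influence_ge0 //.
    by rewrite -[X in _ <= X](avg_const 'I_n); apply: ler_avg => w; case: dquery.
  lra.
by have := ler_pavg h; rewrite pavgZ -EN_pavg; have := variance; lra.
Qed.

Section Scale.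
Variable J : nat.
Let L := Z.of_nat (scale J).
Let q := arm_const K.

Let near (v : box R) (k : 'I_R) : bool := `[< (Z.abs ((bpos v).1 - Z.of_nat k) <= L)%Z >].

Let sum_near v : (\sum_(k < R) near v k <= 2 * scale J + 1)%N.
Proof.
rewrite (eq_bigr (fun k => if k \in [set k | near v k] then 1 else 0)%N); last first.
  by move=> k _; rewrite inE; case: near.
rewrite -big_mkcond sum1_card addn1 -[X in (_ <= X)%N]card_ord.
pose h (k : 'I_R) : 'I_(2 * scale J).+1 := inord (Z.to_nat (Z.of_nat k - (bpos v).1 + L)).
rewrite -(card_in_imset (f := h)); first exact: max_card.
move=> k k'; rewrite !inE => /asboolP hk /asboolP hk' /(congr1 val) /=.
by rewrite !inordK => [e||]; [apply: val_inj => /=|..]; move: hk hk'; rewrite /L; lia.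
Qed.

(** A column within distance [L] of a vertex contributes at most 1, any other one the arm bound; the
    outer factor 2 counts the members of the pair. *)
Let reveal_le s i : ~~ crowded lab (ball (@bpos R) J) s ->
  \sum_(k < R) reveal K (tree s k) i <= 2 * ((2 * scale J + 1)%:R + R%:R * (2 * q ^+ J)).
Proof.
move=> nc.
pose T (v : box R) (k : 'I_R) := prob K (fun w => touches (@bpos R) (Z.of_nat k) (occ (@bpos R) (cfg lab s w)) v).
have hT v : \sum_(k < R) T v k <= (2 * scale J + 1)%:R + R%:R * (2 * q ^+ J).
  have q0 := exprn_ge0 J (arm_const_ge0 K).
  apply: (@le_trans _ _ (\sum_(k < R) ((near v k)%:R + 2 * q ^+ J))).
    apply: ler_sum => k _; rewrite /T; case: (boolP (near v k)) => [_|far].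
      by apply: le_trans (prob_le1 _ _) _; rewrite lerDl mulr_ge0.
    rewrite add0r; apply: (prob_touches K labK) => //; first exact: bpos_inj.
    by move: far => /asboolP; rewrite /L; lia.
  rewrite big_split /= sumr_const card_ord -[_ *+ R]mulr_natl lerD2r.
  by rewrite -natr_sum ler_nat; apply: sum_near.
pose v0 c := s^-1%g (unlab (i, c)).
apply: (@le_trans _ _ (\sum_(k < R) (T (v0 false) k + T (v0 true) k))); last first.
  by rewrite big_split /=; have := hT (v0 false); have := hT (v0 true); lra.
apply: ler_sum => k _.
apply: le_trans (prob_or K _ _).
have -> : reveal K (tree s k) i = prob K (fun w => dquery (tree s k) w i).
  by apply: eq_avg => w; rewrite asboolb.
apply: prob_le => w /column_tree_query[v [lv tv]].
have ev : v = v0 (lab (s v)).2.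
  by rewrite /v0 -lv -surjective_pairing labK permK.
by move: tv; rewrite ev; case: (lab (s v)).2; [right|left].
Qed.

(** The variance inequality is summed over the R columns. Crowded pairings have variance at most 1/4
    and take at most 1/16 of the mean variance 1/8, leaving 1/16. *)
Lemma expected_pivotals_scale : pavg (fun s => (crowded lab (ball (@bpos R) J) s)%:R) <= 1 / 4 :> K ->
  1 / 16 * R%:R <= ((2 * scale J + 1)%:R + R%:R * (2 * q ^+ J)) * EN.
Proof.
set D := (_ + _) => hc.
have RK : 0 < (R%:R : K) by rewrite ltr0n.
have D0 : 0 <= D.
  by rewrite addr_ge0 // mulr_ge0 // mulr_ge0 // exprn_ge0 // arm_const_ge0.
have N00 s : 0 <= N0 s by apply: avg_ge0.
have h s : R%:R * (p s * (1 - p s)) <= R%:R / 4 * (crowded lab (ball (@bpos R) J) s)%:R + D * N0 s.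
  case: (boolP (crowded _ _ s)) => [_|nc].
    have : p s * (1 - p s) <= 1 / 4 by have := sqr_ge0 (p s - 1 / 2); rewrite expr2; lra.
    move/(ler_wpM2l (ltW RK)); have := mulr_ge0 D0 (N00 s) => /=; lra.
  have : \sum_(k < R) (p s * (1 - p s)) <=
      \sum_(k < R) (4^-1 * \sum_i reveal K (tree s k) i * influence K (g s) i).
    by apply: ler_sum => k _; apply: p_osss.
  rewrite sumr_const card_ord -[_ *+ R]mulr_natl -mulr_sumr exchange_big /= => h1.
  have h2 : \sum_i \sum_(k < R) reveal K (tree s k) i * influence K (g s) i <=
      \sum_i 2 * D * influence K (g s) i.
    apply: ler_sum => i _; rewrite -mulr_suml ler_wpM2r ?influence_ge0 //.
    exact: reveal_le.
  have h3 := ler_wpM2l D0 (influence_N0 s).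
  by move: h1 h2 h3; rewrite -mulr_sumr; lra.
have := ler_pavg h; rewrite pavgZ pavgD !pavgZ -EN_pavg => h1.
have h2 := ler_wpM2l (ltW RK) variance.
have h3 := ler_wpM2l (ltW RK) hc.
lra.
Qed.

End Scale.
End Assembly.

(** * Choice of the scale and of the exponent *)

Lemma arm_const_bounds (K : realFieldType) : 1 / 2 <= arm_const K < 1.
Proof.
have x0 : 0 < (1 / 16 : K) by lra.
have : (1 / 16 : K) ^+ 119 <= 1 by apply: exprn_ile1; lra.
have : 0 < (1 / 16 : K) ^+ 119 by apply: exprn_gt0.
rewrite /arm_const (exprS _ 119); move: (_ ^+ 119) => y; lra.
Qed.

(* Balls of radius R^(1/10) have about R^(1/5) vertices, and a union bound over the centre and over the
   four vertices of two pairs gives the order R^2 (R^(1/5))^4 / (R^2)^2. *)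
Lemma crowded_rare (K : realType) (R J n : nat) (lab : box R -> 'I_n * bool) (unlab : 'I_n * bool -> box R) :
  cancel lab unlab -> cancel unlab lab -> (0 < J)%N -> (6 ^ (10 * J) <= R)%N ->
  pavg (fun s => (crowded lab (ball (@bpos R) J) s)%:R) <= 1 / 4 :> K.
Proof.
move=> labK unlabK J0 hR.
have hB v := card_ball J (@bpos_inj R) v.
have := pavg_crowded K labK hB.
have eN : #|box R| = (R * R)%N by rewrite card_prod card_ord.
rewrite eN; set N := (R * R)%N; set m := ((2 * scale J + 1) ^ 2)%N; set x := pavg _ => h.
have le6 a b : (a <= b)%N -> (6 ^ a <= 6 ^ b)%N by move=> ?; apply: leq_pexp2l.
have hm : (m <= 6 ^ 2 * 6 ^ (2 * J))%N.
  rewrite /m /scale [(2 * J)%N]mulnC expnM -expnMn leq_exp2r //.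
  have h6 : (0 < 6 ^ J)%N by rewrite expn_gt0.
  lia.
(* 32 is the product of the 8 lost to the falling factorial and the 4 of the target 1/4. *)
have hN : (32 * m ^ 4 <= N)%N.
  apply: (@leq_trans (6 ^ (20 * J))); last first.
    have -> : (20 * J = 10 * J + 10 * J)%N by lia.
    by rewrite expnD leq_mul.
  apply: (@leq_trans (6 ^ 2 * (6 ^ (2 + 2 * J)) ^ 4)).
    by rewrite leq_mul // leq_exp2r // expnD.
  by rewrite -expnM -expnD; apply: le6; lia.
have m1 : (1 <= m ^ 4)%N by rewrite expn_gt0 /m expn_gt0 addn1.
(* For N >= 6 each of the factors N - 1, N - 2, N - 3 is at least N / 2. *)
have hf : (N ^ 4 <= 8 * N ^_ 4)%N.
  have N6 : (6 <= N)%N by lia.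
  rewrite !ffactnS ffactn0 !expnS expn0 !muln1.
  apply: (@leq_trans (N * ((2 * N.-1) * ((2 * N.-2) * (2 * N.-2.-1))))); last by lia.
  by do 3 (apply: leq_mul; first by lia); lia.
have N0 : (0 < N)%N by lia.
have f0 : 0 < ((N ^_ 4)%:R : K) by rewrite ltr0n ffact_gt0; lia.
rewrite -(ler_pM2r f0); apply: le_trans h _.
rewrite mulrC mulrA mulr1 ler_pdivlMr // -natrM ler_nat.
rewrite -(leq_pmul2l (m := 8)) //; apply: leq_trans hf.
rewrite (_ : 8 * (N * m ^ 4 * N ^ 2 * 4) = N ^ 3 * (32 * m ^ 4))%N; last by rewrite !expnS expn0; ring.
by rewrite (expnSr N 3) leq_mul2l hN orbT.
Qed.

Lemma expected_pivotals_lower (K : realType) (R J n : nat) : (0 < J)%N -> (6 ^ (10 * J) <= R)%N ->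
  #|box R| = (n + n)%N ->
  1 / 48 <= arm_const K ^+ J * slavg n (fun w => (num_pivotal0 (crossing K R) w)%:R).
Proof.
move=> J0 hR e; have R0 : (0 < R)%N by apply: leq_trans hR; rewrite expn_gt0.
have [lab [unlab [labK unlabK]]] : exists (f : box R -> 'I_n * bool) g, cancel f g /\ cancel g f.
  by apply: labelling; rewrite e card_prod card_ord card_bool muln2 addnn.
have := expected_pivotals_scale R0 e labK unlabK (crowded_rare K labK unlabK J0 hR).
set EN := slavg _ _; set q := arm_const K.
have EN0 : 0 <= EN.
  by have := expected_pivotals_trivial K R0 e labK unlabK; rewrite -/EN; lra.
have RK : 0 < (R%:R : K) by rewrite ltr0n.
have /andP[q2 q1] := arm_const_bounds K.
(* The near columns are absorbed into the arm term through q >= 1/2; the total is then 3 R q^J,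
   whence 1/48. *)
have hs : (2 * scale J + 1)%:R <= R%:R * q ^+ J.
  have h2 : (2^-1 : K) ^+ J <= q ^+ J by apply: lerXn2r; rewrite ?nnegrE; rewrite /q; lra.
  apply: le_trans (ler_wpM2l (ltW RK) h2).
  rewrite exprVn ler_pdivlMr ?exprn_gt0 // -natrX -natrM ler_nat; apply: leq_trans hR.
  have [k -> Jk] : exists2 k, (10 * J = J + (J + k))%N & (J <= k)%N by exists (8 * J)%N; lia.
  have a1 : (6 <= 6 ^ J)%N by rewrite -{1}(expn1 6) leq_pexp2l.
  have a2 : (2 ^ J <= 6 ^ J)%N by rewrite leq_exp2r.
  rewrite !expnD /scale.
  apply: (@leq_trans ((6 ^ J * 6 ^ J) * 6 ^ J)).
    by apply: leq_mul => //; nia.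
  rewrite -!mulnA; apply: leq_mul => //; apply: leq_mul => //; rewrite leq_pexp2l //; lia.
move=> h.
have : 1 / 16 * R%:R <= R%:R * (3 * q ^+ J * EN).
  apply: le_trans h _; rewrite [X in _ <= X]mulrA; apply: ler_wpM2r => //.
  by move: hs; lra.
by rewrite mulrC (ler_pM2l RK); lra.
Qed.

Theorem theorem3p2 (K : realType) :
  exists alpha C : K,
    [/\ 0 < alpha, 0 < C &
      forall R : nat, (2 <= R)%N -> ~~ odd R ->
        C * R%:R `^ alpha <=
        expect_fixed (R ^ 2 %/ 2)
          (fun w : config (box R) => (num_pivotal0 (crossing K R) w)%:R)].
Proof.
have /andP[q2 q1] := arm_const_bounds K; set q := arm_const K in q2 q1.
have q0 : 0 < q by lra.
have l6 : 0 < ln (6 : K) by apply: ln_gt0; lra.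
have lq : ln q < 0 by apply: ln_lt0; rewrite q0.
(* Chosen so that (6^10)^alpha = 1/q. *)
pose alpha := - ln q / (10 * ln 6).
have a0 : 0 < alpha by rewrite divr_gt0 ?oppr_gt0 // mulr_gt0.
(* The factor [q] pays for rounding R up to the next power 6^(10(J + 1)). *)
exists alpha, (q / 48); split=> //; first by lra.
move=> R R2 oR; rewrite expect_fixedE; set n := (_ %/ _)%N.
have R0 : (0 < R)%N by lia.
have e : #|box R| = (n + n)%N.
  rewrite card_prod card_ord /n -mulnn.
  have -> : (R * R = (R./2 * R) * 2)%N by rewrite mulnAC muln2 halfK (negbTE oR) subn0.
  by rewrite mulnK // addnn muln2.
have p1 : (1 < 6 ^ 10)%N by rewrite -{1}(expn0 6) ltn_exp2l.
have [J hJ1 hJ2] : exists2 J, (6 ^ (10 * J) <= R)%N & (R < 6 ^ (10 * J.+1))%N.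
  exists (trunc_log (6 ^ 10) R); rewrite expnM.
    exact: trunc_logP.
  exact: trunc_log_ltn.
have hpow : R%:R `^ alpha <= q ^- J.+1.
  rewrite /powR pnatr_eq0 -[X in _ <= X]lnK; last by rewrite posrE invr_gt0 exprn_gt0.
  rewrite gtn_eqF // ler_expR lnV ?posrE ?exprn_gt0 // lnXn //.
  have hl : ln (R%:R : K) <= (10 * J.+1)%:R * ln 6.
    rewrite mulr_natl -lnXn // ler_ln ?posrE ?ltr0n ?exprn_gt0 // -natrX ler_nat.
    exact: ltnW.
  apply: le_trans (ler_wpM2l (ltW a0) hl) _.
  rewrite /alpha natrM -[ln q *+ _]mulr_natl le_eqVlt; apply/orP; left; apply/eqP.
  by field; rewrite lt0r_neq0.
have Cq : q / 48 * R%:R `^ alpha <= 1 / 48 * q ^- J.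
  have qJ : q ^- J.+1 = q^-1 * q ^- J by rewrite exprS invfM.
  apply: le_trans (ler_wpM2l _ hpow) _; first by lra.
  by rewrite qJ le_eqVlt; apply/orP; left; apply/eqP; field; rewrite expf_neq0 ?lt0r_neq0.
apply: le_trans Cq _.
(* J = 0 means R < 6^10, where the constant bound 1/4 is enough. *)
case: (posnP J) => [J0|J0].
  have [lab [unlab [labK unlabK]]] : exists (f : box R -> 'I_n * bool) g, cancel f g /\ cancel g f.
    by apply: labelling; rewrite e card_prod card_ord card_bool muln2 addnn.
  apply: le_trans (expected_pivotals_trivial K R0 e labK unlabK).
  by rewrite J0 expr0 invr1; lra.
have := expected_pivotals_lower K J0 hJ1 e.
by move=> h; rewrite ler_pdivrMr ?exprn_gt0 // [X in _ <= X]mulrC.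
Qed.
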